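(* Let $\Omega \subseteq \mathbb{R}^N$ be a bounded Lipschitz domain and let $U \subseteq \mathbb{R}^N$ be open with $\Omega \Subset U$. Let $1 \le p \le q < \infty$ be arbitrary, let $a \in C^\infty(U)$ be non-negative, and set $$\mathcal{F}[u;\Omega] = \int_\Omega \left(|\nabla u|^p + a(x)|\nabla u|^q\right)\,dx .$$ Then, for every $u_0 \in W^{1,1}(\Omega)$ such that $\mathcal{F}[u_0;\Omega] < \infty$, $$\inf_{u \in u_0 + W^{1,1}_0(\Omega)} \mathcal{F}[u;\Omega] = \inf_{u \in u_0 + C_c^\infty(\Omega)} \mathcal{F}[u;\Omega].$$
   Context: $\mathcal{F}[u;\Omega]$ takes values in $[0,\infty]$. $\Omega \Subset U$ means that $\overline{\Omega}$ is a compact subset of $U$. *)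

(* Defs.v *)
From HB Require Import structures.
From mathcomp Require Import all_boot all_order all_algebra.
From mathcomp Require Import all_classical all_reals all_analysis.

Set Implicit Arguments.
Unset Strict Implicit.
Unset Printing Implicit Defensive.

Import Order.TTheory GRing.Theory Num.Theory.
Import numFieldNormedType.Exports.

Local Open Scope classical_set_scope.
Local Open Scope ring_scope.

(* R^n is 'rV[R]_n. Its library topology is that of the sup norm, i.e. the
   usual one; the Euclidean norm is enorm below. *)

(* The product sigma-algebra of n copies of the Borel sigma-algebra of R (as
   the library does for n.-tuple), i.e. the Borel sigma-algebra of R^n. *)
Definition rV_display : measure_display.
Proof. exact: default_measure_display. Qed.

Section rV_measurable.
Context {R : realType} (n : nat).

Let coord (i : 'I_n) (x : 'rV[R]_n) : measurableTypeR R := x ord0 i.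

Let rV_set0 : g_sigma_preimage coord set0.
Proof. exact: sigma_algebra0. Qed.

Let rV_setC A : g_sigma_preimage coord A -> g_sigma_preimage coord (~` A).
Proof. exact: sigma_algebraC. Qed.

Let rV_bigcup (F : _^nat) : (forall i, g_sigma_preimage coord (F i)) ->
  g_sigma_preimage coord (\bigcup_i (F i)).
Proof. exact: sigma_algebra_bigcup. Qed.

HB.instance Definition _ := @isMeasurable.Build rV_display
  'rV[R]_n (g_sigma_preimage coord) rV_set0 rV_setC rV_bigcup.

Lemma measurable_coord (i : 'I_n) :
  measurable_fun [set: 'rV[R]_n] (fun x => x ord0 i : measurableTypeR R).
Proof.
move=> _ Y mY; rewrite setTI; apply: sub_sigma_algebra => /=.
rewrite -bigcup_seq/=; exists i => /=; first by rewrite mem_index_enum.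
by exists Y => //; rewrite setTI.
Qed.

Lemma measurable_rVP d (T : measurableType d) (f : T -> 'rV[R]_n) :
  (forall i, measurable_fun [set: T] (fun t => f t ord0 i : measurableTypeR R)) ->
  measurable_fun [set: T] f.
Proof.
move=> mf _ Y; rewrite setTI.
pose S := [set B : set 'rV[R]_n | measurable (f @^-1` B)].
suff sub : g_sigma_preimage coord `<=` S by move=> mY; exact: sub.
apply: smallest_sub.
  split => /=.
  - by rewrite /S /= preimage_set0.
  - by move=> A mA; rewrite /S /= setTD preimage_setC; exact: measurableC.
  - by move=> F mF; rewrite /S /= preimage_bigcup; exact: bigcupT_measurable.
rewrite -bigcup_seq => A [i _ [B mB <-]]; rewrite /S /= setTI.
by rewrite -[X in measurable X]setTI; exact: mf.
Qed.

End rV_measurable.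

(* Lebesgue measure on (the Borel sets of) R^n, as the iterated product of the
   Lebesgue measure on R; see lebesgue_rV_box. *)
Section lebesgue_rV.
Context {R : realType}.

Definition rV_cons n (z : measurableTypeR R * 'rV[R]_n) : 'rV[R]_n.+1 :=
  \row_i oapp (z.2 ord0) z.1 (unlift ord0 i).

Definition rV_uncons n (x : 'rV[R]_n.+1) : measurableTypeR R * 'rV[R]_n :=
  (x ord0 ord0, \row_j x ord0 (lift ord0 j)).

Lemma rV_consK n : cancel (@rV_cons n) (@rV_uncons n).
Proof.
move=> [t x]; rewrite /rV_cons /rV_uncons !mxE unlift_none /=; congr pair.
by apply/rowP => j; rewrite !mxE liftK.
Qed.

Lemma measurable_rV_cons n : measurable_fun setT (@rV_cons n).
Proof.
apply: measurable_rVP => i; rewrite /rV_cons.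
case: (unliftP ord0 i) => [j|] ->.
  under eq_fun do rewrite mxE liftK /=.
  by apply: (measurableT_comp (measurable_coord j)).
by under eq_fun do rewrite mxE unlift_none /=; exact: measurable_fst.
Qed.

Lemma measurable_rV_uncons n : measurable_fun setT (@rV_uncons n).
Proof.
apply/measurable_fun_pair; first exact: measurable_coord.
apply: measurable_rVP => j; under eq_fun do rewrite mxE.
exact: measurable_coord.
Qed.

Section step.
Variables (n : nat) (mu : {sigma_finite_measure set 'rV[R]_n -> \bar R}).

Definition lebesgue_rV_step : set 'rV[R]_n.+1 -> \bar R :=
  pushforward (@lebesgue_measure R \x mu)%E (@rV_cons n).

Let mcons := @measurable_rV_cons n.

Let step0 : lebesgue_rV_step set0 = 0%E.
Proof. exact: measure0. Qed.

Let step_ge0 A : (0 <= lebesgue_rV_step A)%E.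
Proof. exact: measure_ge0. Qed.

Let step_sigma_additive : semi_sigma_additive lebesgue_rV_step.
Proof. exact: measure_semi_sigma_additive. Qed.

HB.instance Definition _ := isMeasure.Build _ _ _ lebesgue_rV_step
  step0 step_ge0 step_sigma_additive.

Let step_sigma_finite : sigma_finite setT lebesgue_rV_step.
Proof.
have /sigma_finiteP[F [TF ndF Foo]] := sigma_finiteT (@lebesgue_measure R).
have /sigma_finiteP[G [TG ndG Goo]] := sigma_finiteT mu.
exists (fun k => @rV_uncons n @^-1` (F k `*` G k)).
  rewrite -preimage_bigcup; apply/esym/seteqP; split => // x _ /=.
  have [i _ Fi] : (\bigcup_i F i) (rV_uncons x).1 by rewrite -TF.
  have [j _ Gj] : (\bigcup_i G i) (rV_uncons x).2 by rewrite -TG.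
  exists (maxn i j) => //; split.
    by move: Fi; exact/subsetPset/ndF/leq_maxl.
  by move: Gj; exact/subsetPset/ndG/leq_maxr.
move=> k; have [mF Fk] := Foo k; have [mG Gk] := Goo k; split.
  rewrite -[X in measurable X]setTI; apply: measurable_rV_uncons => //.
  exact: measurableX.
rewrite /lebesgue_rV_step /pushforward -comp_preimage.
rewrite (_ : @rV_uncons n \o @rV_cons n = id) ?preimage_id.
  by rewrite product_measure1E// lte_mul_pinfty// ge0_fin_numE.
by apply/funext => z; rewrite /= rV_consK.
Qed.

HB.instance Definition _ := Measure_isSigmaFinite.Build _ _ _ lebesgue_rV_step
  step_sigma_finite.

End step.

Fixpoint lebesgue_rV n : {sigma_finite_measure set 'rV[R]_n -> \bar R} :=
  match n with
  | 0 => dirac (0 : 'rV[R]_0)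
  | n'.+1 => lebesgue_rV_step (lebesgue_rV n')
  end.

Lemma lebesgue_rV_box n (A : 'I_n -> set (measurableTypeR R)) :
  (forall i, measurable (A i)) ->
  lebesgue_rV n [set x | forall i, A i (x ord0 i)] =
  (\prod_(i < n) lebesgue_measure (A i))%E.
Proof.
elim: n A => [|n IH] A mA.
  by rewrite big_ord0 /= diracE mem_set // => -[].
rewrite big_ord_recl -IH //= /lebesgue_rV_step /pushforward.
rewrite -product_measure1E //; last first.
  rewrite [X in measurable X](_ : _ = \big[setI/setT]_(i < n)
    ((fun x : 'rV[R]_n => x ord0 i : measurableTypeR R) @^-1` A (lift ord0 i))).
    apply: bigsetI_measurable => i _.
    by rewrite -[X in measurable X]setTI; exact: measurable_coord.
  rewrite -bigcap_seq; apply/seteqP; split => x /=; first by move=> Ax i _; exact: Ax.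
  by move=> Ax i; apply: Ax; rewrite /= mem_index_enum.
congr (_ _); apply/seteqP; split => -[t x] /=.
  move=> Ax; split=> [|i]; first by have := Ax ord0; rewrite mxE unlift_none.
  by have := Ax (lift ord0 i); rewrite mxE liftK.
move=> [At Ax] i; rewrite mxE; case: (unliftP ord0 i) => [j|] -> /=; last by [].
exact: Ax.
Qed.
End lebesgue_rV.

Section smooth.
Context {R : realType} {n : nat}.
Implicit Types (f phi : 'rV[R]_n -> R) (U Omega : set 'rV[R]_n).

Definition enorm (v : 'rV[R]_n) : R := Num.sqrt (\sum_(i < n) v ord0 i ^+ 2).

Definition partial (i : 'I_n) f : 'rV[R]_n -> R := 'D_(delta_mx ord0 i) f.

Definition iter_partial (s : seq 'I_n) f : 'rV[R]_n -> R := foldr partial f s.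

(* C^oo(U) for U open: all iterated partial derivatives exist and are
   continuous on U. The values of f outside U play no role. *)
Definition smooth_on U f :=
  forall (s : seq 'I_n) x, U x ->
    {for x, continuous (iter_partial s f)} /\
    forall i, derivable (iter_partial s f) x (delta_mx ord0 i).

Definition supp f : set 'rV[R]_n := closure [set x | f x != 0].

(* C_c^oo(Omega), its elements being extended by 0 to R^n. *)
Definition test_functions Omega : set ('rV[R]_n -> R) :=
  [set phi | [/\ smooth_on setT phi, compact (supp phi) & supp phi `<=` Omega]].

Definition compactly_contained Omega U :=
  compact (closure Omega) /\ closure Omega `<=` U.

End smooth.

(* Near each boundary point, up to an isometry x |-> x *m Q, Omega is the set
   of points lying strictly above the graph of a Lipschitz function of the last
   n coordinates (the first coordinate being the vertical one). *)
Definition lipschitz_boundary {R : realType} {n : nat}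
    (Omega : set 'rV[R]_n.+1) :=
  forall x0, (closure Omega `\` interior Omega) x0 ->
  exists (Q : 'M[R]_n.+1) (gamma : 'rV[R]_n -> R),
    [/\ Q *m Q^T = 1%:M,
        lipschitz gamma &
        \forall x \near x0, Omega x <->
          gamma (\row_(j < n) (x *m Q) ord0 (lift ord0 j))
            < (x *m Q) ord0 ord0].

(* A domain is a nonempty connected open set. *)
Definition bounded_lipschitz_domain {R : realType} {n : nat}
    (Omega : set 'rV[R]_n.+1) :=
  [/\ open Omega, connected Omega, Omega !=set0, bounded_set Omega &
      lipschitz_boundary Omega].

(* Sobolev functions on Omega are represented by functions on R^n, of which
   only the restriction to Omega matters, and only up to null sets. *)
Section sobolev.
Context {R : realType} {n : nat}.
Variable Omega : set 'rV[R]_n.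
Implicit Types (u v : 'rV[R]_n -> R) (G : 'rV[R]_n -> 'rV[R]_n).

Local Notation mu := (lebesgue_rV n).

Definition L1 u := mu.-integrable Omega (EFin \o u).

Definition is_weak_gradient u G :=
  (forall i, L1 (fun x => G x ord0 i)) /\
  forall (i : 'I_n) phi, test_functions Omega phi ->
    (\int[mu]_(x in Omega) (u x * partial i phi x)%:E =
     - \int[mu]_(x in Omega) (G x ord0 i * phi x)%:E)%E.

Definition W11 : set ('rV[R]_n -> R) :=
  [set u | L1 u /\ exists G, is_weak_gradient u G].

(* The weak gradient of u in W11, which is unique up to null sets (and 0 if u
   has no integrable weak gradient). *)
Definition weak_gradient u : 'rV[R]_n -> 'rV[R]_n :=
  xget (fun=> 0) [set G | is_weak_gradient u G].

Definition W11_norm u : \bar R :=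
  (\int[mu]_(x in Omega) `|u x|%:E +
   \int[mu]_(x in Omega) (enorm (weak_gradient u x))%:E)%E.

(* The closure of C_c^oo(Omega) in W11. *)
Definition W110 : set ('rV[R]_n -> R) :=
  [set v | W11 v /\ forall e : R, 0 < e ->
    exists2 phi, test_functions Omega phi & (W11_norm (v \- phi)%R < e%:E)%E].

Definition double_phase (p q : R) (a u : 'rV[R]_n -> R) : \bar R :=
  \int[mu]_(x in Omega)
    (enorm (weak_gradient u x) `^ p + a x * enorm (weak_gradient u x) `^ q)%:E.

End sobolev.

(* Main.v *)
Require Import Defs.
From mathcomp Require Import all_boot all_order all_algebra.
From mathcomp Require Import all_classical all_reals all_analysis.
From mathcomp Require Import measurable_realfun ring lra zify.

Set Implicit Arguments.
Unset Strict Implicit.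
Unset Printing Implicit Defensive.

Import Order.TTheory GRing.Theory Num.Theory.
Import numFieldNormedType.Exports.

Local Open Scope classical_set_scope.
Local Open Scope ring_scope.

(** Since test functions belong to W^{1,1}_0, the point is to approximate the gradient of
    a function v of W^{1,1}_0 with finite energy by gradients of test functions, in energy;
    the bound (s + t)^q <= (1 + d)^q s^q + (1 + 1/d)^q t^q then handles u0 + v.

    Replacing v by k sin (v / k) one may assume that v is bounded, and by a partition of
    unity that v is supported where Omega satisfies a cone condition with a fixed axis.
    Averaging v over the points x + e r y, with y close to the opposite of the axis and r
    uniform in [1, 2], gives a test function w with gradient at most C / e. Its energy does
    not concentrate: let m < q - 1 <= m + 1. Where a(x) <= C e^(m+1), the bound on the
    gradient gives a |grad w|^q <= C |grad w|. Elsewhere a is so large, compared with its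
    derivative of order m + 1 on the segments {x + e r y}, that its sublevel sets on them
    are small (by Rolle's theorem and interpolation), which bounds the average of |grad v|
    on each segment by that of a |grad v|^q. In both cases the energy density of w is
    bounded by averages of translates of an integrable function; these are uniformly
    integrable, and the gradients of w converge to the gradient of v in L^1. *)

(** * Lebesgue measure on R^n *)

(** The obstacle is that [q] is not bounded in terms of [p], and that the weight at nearby points
    may be far smaller than at [x], so that Jensen's inequality gives no control of [a |grad w|^q].
    What works instead is in effect Hölder's inequality along a segment, which asks that
    [a^(-1/(q-1))] be integrable there. For a function that behaves like a polynomial of degree [m]
    this holds as soon as [m < q - 1]. On the other hand the bound [C / e] on the gradient, raised
    to the power [q - 1], is absorbed by [a <= C e^(m+1)] because [q - 1 <= m + 1]. The two
    requirements on [m] are compatible for every [q > 1], and smoothness of [a] supplies derivatives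
    of the order that [q] dictates. The scale [r] is averaged in order to produce whole segments, on
    which the places where [a] is small occupy little room. Directions opposite to the cone axis
    push the support of [w] inside [Omega] by averaging translates alone, without deforming the
    domain. The term [|grad u|^p] is the case of the constant weight 1 in the same estimate. *)

Lemma le_of_eq d (T : porderType d) (x y : T) : x = y -> (x <= y)%O.
Proof. by move=> ->. Qed.

Lemma rV_ballE (R : realType) n (c : 'rV[R]_n) (e : R) : 0 < e ->
  ball c e = [set x | forall i, `|c ord0 i - x ord0 i| < e].
Proof.
move=> e0; apply/seteqP; split => x /=.
  by case=> _ h i; have := h ord0 i.
by move=> h; split => // i j; rewrite (ord1 i); exact: h.
Qed.

Lemma coord_le_norm (R : realType) n (x : 'rV[R]_n) i : `|x ord0 i| <= `|x|.
Proof.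
by rewrite [leRHS]mx_normrE; exact: (@le_bigmax _ _ _ 0 (fun ij : 'I_1 * 'I_n => `|x ij.1 ij.2|) (ord0, i)).
Qed.

Lemma norm_le_coord (R : realType) n (x : 'rV[R]_n) (M : R) : 0 <= M ->
  (forall i, `|x ord0 i| <= M) -> `|x| <= M.
Proof.
move=> M0 h; rewrite [leLHS]mx_normrE; apply: bigmax_le => // -[i j] _ /=.
by rewrite (ord1 i).
Qed.

Section boxes.
Context {R : realType} {n : nat}.

Definition box (a b : 'I_n -> R) : set 'rV[R]_n :=
  [set x | forall i, `]a i, b i[%classic (x ord0 i)].

Definition boxes : set (set 'rV[R]_n) := [set A | exists a b, A = box a b].

Lemma box_bigcap (a b : 'I_n -> R) : box a b =
  \bigcap_i ((fun x : 'rV[R]_n => x ord0 i : measurableTypeR R) @^-1` `]a i, b i[).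
Proof. by apply/seteqP; split => [x h i _|x h i]; exact: h. Qed.

Lemma measurable_box a b : measurable (box a b).
Proof.
rewrite box_bigcap; apply: fin_bigcap_measurable; first exact: finite_finset.
by move=> i _; rewrite -[X in measurable X]setTI; exact: measurable_coord.
Qed.

(** The second set of each intersection does not depend on its point: it is everything when the box
    lies in [A] and empty otherwise. This lets the union range over one countable type. *)
Lemma open_rV_boxes (A : set 'rV[R]_n) : open A ->
  A = \bigcup_(u : 'rV[rat]_n * 'rV[rat]_n) 
    (box (fun i => ratr (u.1 ord0 i)) (fun i => ratr (u.2 ord0 i)) `&`
     [set x | box (fun i => ratr (u.1 ord0 i)) (fun i => ratr (u.2 ord0 i)) `<=` A]).
Proof.
move=> oA; apply/seteqP; split => [x Ax|x [u _ [ux /=]]]; last exact.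
have /nbhs_ballP[e /= e0 eA] : nbhs x A by exact: open_nbhs_nbhs.
have lo i : exists r : rat, x ord0 i - e < ratr r < x ord0 i.
  by have [|r] := @rat_in_itvoo R (x ord0 i - e) (x ord0 i); [lra | rewrite in_itv /= => ?; exists r].
have hi i : exists r : rat, x ord0 i < ratr r < x ord0 i + e.
  by have [|r] := @rat_in_itvoo R (x ord0 i) (x ord0 i + e); [lra | rewrite in_itv /= => ?; exists r].
have [l hl] := choice lo; have [h hh] := choice hi.
exists (\row_i l i, \row_i h i) => //=; split => [i|y /= yb].
  rewrite /= !mxE in_itv /=; have := hl i; have := hh i; lra.
apply: eA; rewrite rV_ballE // => i; have := yb i; rewrite !mxE /= in_itv /=.
have := hl i; have := hh i; rewrite ltr_norml; lra.
Qed.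

Lemma open_sigma_boxes (A : set 'rV[R]_n) : open A -> <<s boxes >> A.
Proof.
move=> oA; rewrite (open_rV_boxes oA).
apply: (@countable_bigcupT_measurable _ (g_sigma_algebraType boxes)) => // -[u v].
set B := box _ _.
have [BA|BA] := pselect (B `<=` A).
  rewrite (_ : _ `&` _ = B); last by apply/seteqP; split => x // -[].
  by apply: sub_sigma_algebra; do 2 eexists.
rewrite (_ : _ `&` _ = set0); last by apply/seteqP; split => x // -[].
exact: (@measurable0 _ (g_sigma_algebraType boxes)).
Qed.

(** Boxes are stable under intersection, so this is the form of the sigma-algebra required for
    uniqueness of measures and for the Dynkin argument of [fundamental_lemma]. Half-spaces in one
    coordinate are open, hence countable unions of boxes. *)
Lemma measurable_boxes : @measurable _ 'rV[R]_n = <<s boxes >>.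
Proof.
apply/seteqP; split; last first.
  by apply: smallest_sub; [exact: sigma_algebra_measurable
    |move=> A [a [b ->]]; exact: measurable_box].
apply: smallest_sub; first exact: smallest_sigma_algebra.
rewrite -bigcup_seq => A [i _ [B mB <-]]; rewrite setTI.
have {mB} := mB; rewrite RGenOInfty.measurableE.
move: B; apply: smallest_sub.
  split => /=.
  - by rewrite preimage_set0; exact: (@measurable0 _ (g_sigma_algebraType boxes)).
  - by move=> B mB; rewrite setTD preimage_setC; exact: (@measurableC _ (g_sigma_algebraType boxes)).
  - by move=> F mF; rewrite preimage_bigcup; exact: (@bigcupT_measurable _ (g_sigma_algebraType boxes)).
move=> B [x ->] /=; apply: open_sigma_boxes.
rewrite [X in open X](_ : _ = (fun y : 'rV[R]_n => y ord0 i) @^-1` [set t | x < t]); last first.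
  by apply/seteqP; split => y /=; rewrite in_itv /= andbT.
by apply: open_comp; [move=> y _; exact: coord_continuous|exact: open_gt].
Qed.

Lemma open_measurable_rV (A : set 'rV[R]_n) : open A -> measurable A.
Proof. by move=> oA; rewrite measurable_boxes; exact: open_sigma_boxes. Qed.

Lemma closed_measurable_rV (A : set 'rV[R]_n) : closed A -> measurable A.
Proof.
move=> cA; rewrite -(setCK A); apply: measurableC; apply: open_measurable_rV.
exact: closed_openC.
Qed.

Lemma setI_boxes : setI_closed boxes.
Proof.
move=> _ _ [a [b ->]] [c [d ->]].
exists (fun i => Num.max (a i) (c i)), (fun i => Num.min (b i) (d i)).
apply/seteqP; split => x /=.
  move=> [h1 h2] i; have := h1 i; have := h2 i; rewrite /= !in_itv /= gt_max lt_min.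
  by move=> /andP[-> ->] /andP[-> ->].
move=> h; split => i; have := h i; rewrite /= !in_itv /= gt_max lt_min;
  by move=> /andP[/andP[? ?] /andP[? ?]]; apply/andP.
Qed.

Definition cube (k : nat) : set 'rV[R]_n := box (fun=> - k%:R) (fun=> k%:R).

Lemma cube_cover : \bigcup_k cube k = setT.
Proof.
apply/seteqP; split => x // _.
exists (Num.truncn `|x|).+1 => //= i; rewrite /= in_itv /= -ltr_norml.
by apply: le_lt_trans (coord_le_norm _ _) _; exact: truncnS_gt.
Qed.

Lemma lebesgue_box (a b : 'I_n -> R) :
  lebesgue_rV n (box a b) = (\prod_(i < n) lebesgue_measure `]a i, b i[%classic)%E.
Proof. by rewrite -lebesgue_rV_box. Qed.

Lemma lebesgue_box_lty (a b : 'I_n -> R) : (lebesgue_rV n (box a b) < +oo)%E.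
Proof.
rewrite lebesgue_box; suff : (\prod_(i < n) lebesgue_measure `]a i, b i[%classic)%E \is a fin_num.
  by rewrite ge0_fin_numE // -lebesgue_box.
elim/big_ind : _ => // [x y|i _]; first exact: fin_numM.
by rewrite lebesgue_measure_itv /=; case: ifP.
Qed.

Lemma bounded_lebesgue_lty (A : set 'rV[R]_n) : measurable A -> bounded_set A ->
  (lebesgue_rV n A < +oo)%E.
Proof.
move=> mA [M [_ hM]].
apply: le_lt_trans (lebesgue_box_lty (fun=> - (`|M| + 2)) (fun=> `|M| + 2)).
apply: le_measure; rewrite ?inE //; first exact: measurable_box.
move=> x Ax i /=; rewrite in_itv /= -ltr_norml.
apply: le_lt_trans (coord_le_norm _ _) _.
by apply: (@le_lt_trans _ _ (`|M| + 1)); [apply: hM => //; have := ler_norm M; lra | lra].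
Qed.

Lemma lebesgue_rV_unique (m1 m2 : {measure set 'rV[R]_n -> \bar R}) :
  (forall a b, (m1 (box a b) < +oo)%E) ->
  (forall a b, m1 (box a b) = m2 (box a b)) ->
  forall A, measurable A -> m1 A = m2 A.
Proof.
move=> fin eqm; apply: (@measure_unique _ _ _ boxes cube).
- exact: measurable_boxes.
- exact: setI_boxes.
- by move=> i; do 2 eexists.
- exact: cube_cover.
- by move=> A [a [b ->]].
- by move=> k; exact: fin.
Qed.

End boxes.

Section continuous_measurable.
Context {R : realType} {n : nat}.

Lemma continuous_measurable_rV (D : set 'rV[R]_n) (f : 'rV[R]_n -> R) :
  open D -> (forall x, D x -> {for x, continuous f}) -> measurable_fun D f.
Proof.
move=> oD cf mD; apply: (measurability _ (RGenOInfty.measurableE R)) => //.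
move=> _ [_ [a ->] <-]; apply: open_measurable_rV.
rewrite openE => x [Dx /= fx]; apply: filterI; first exact: open_nbhs_nbhs.
apply: (cf x Dx); apply: open_nbhs_nbhs; split => //.
Qed.

Lemma continuous_measurable_rVT (f : 'rV[R]_n -> R) :
  continuous f -> measurable_fun setT f.
Proof. by move=> cf; apply: continuous_measurable_rV => [|x _]; [exact: openT|exact: cf]. Qed.

End continuous_measurable.

Section affine.
Context {R : realType} {n : nat}.
Implicit Types (z : 'rV[R]_n) (c : R).

Lemma measurable_affine c z : measurable_fun setT (fun x : 'rV[R]_n => c *: x + z).
Proof.
apply: measurable_rVP => i; under eq_fun do rewrite !mxE.
by apply: measurable_funD => //; apply: measurable_funM => //; exact: measurable_coord.
Qed.

Lemma measurable_shift z : measurable_fun setT (fun x : 'rV[R]_n => x + z).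
Proof.
by under eq_fun do rewrite -[x in x + _]scale1r; exact: measurable_affine.
Qed.

Let phi c z (x : 'rV[R]_n) : 'rV[R]_n := c *: x + z.

Let mphi c z : measurable_fun setT (phi c z).
Proof. exact: measurable_affine. Qed.

Let preimage_affine_box c z a b : 0 < c ->
  phi c z @^-1` box a b =
  box (fun i => (a i - z ord0 i) / c) (fun i => (b i - z ord0 i) / c).
Proof.
move=> c0; apply/seteqP; split => x /= h i; have := h i;
  by rewrite /= !in_itv /= !mxE ltr_pdivrMr // ltr_pdivlMr // ltrBlDr ltrBrDr (mulrC _ c).
Qed.

(** The right-hand side is itself a measure, a multiple of a push-forward; the map sends boxes to
    boxes, where both measures are products of lengths, and boxes determine a measure. *)
Lemma lebesgue_rV_affine c z (c0 : 0 < c) (A : set 'rV[R]_n) : measurable A ->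
  lebesgue_rV n A =
  ((c ^+ n)%:E * lebesgue_rV n ((fun x => (c *: x + z)%R) @^-1` A))%E.
Proof.
move=> mA; have cn0 : 0 <= c ^+ n by rewrite exprn_ge0 ?ltW.
pose m2' : measure 'rV[R]_n R :=
  mscale (NngNum cn0) (pushforward (lebesgue_rV n) (phi c z)).
pose m2 := m2' (mphi c z).
rewrite [LHS](@lebesgue_rV_unique _ _ (lebesgue_rV n) m2) //.
  exact: lebesgue_box_lty.
move=> a b; rewrite /m2 /m2' /= /mscale /= /pushforward preimage_affine_box // !lebesgue_box.
rewrite -[X in c ^+ X](card_ord n) -prodr_const -prodEFin -big_split /=.
apply: eq_bigr => i _; rewrite !lebesgue_measure_itv /= !lte_fin ltr_pM2r ?invr_gt0 //.
rewrite ltrD2r; case: ifPn => _; last by rewrite mule0.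
by rewrite -!EFinB -EFinM; congr EFin; field; rewrite gt_eqF.
Qed.

Lemma ge0_integral_affine c z (c0 : 0 < c) (f : 'rV[R]_n -> \bar R) :
  measurable_fun setT f -> (forall x, 0 <= f x)%E ->
  (\int[lebesgue_rV n]_x f x =
   (c ^+ n)%:E * \int[lebesgue_rV n]_x f (c *: x + z)%R)%E.
Proof.
move=> mf f0; have cn0 : 0 <= c ^+ n by rewrite exprn_ge0 ?ltW.
pose m2' : measure 'rV[R]_n R :=
  mscale (NngNum cn0) (pushforward (lebesgue_rV n) (phi c z)).
pose m2 := m2' (mphi c z).
rewrite (@eq_measure_integral _ _ _ _ m2); last first.
  by move=> A mA _; exact: (lebesgue_rV_affine z c0 mA).
by rewrite ge0_integral_mscale // ge0_integral_pushforward.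
Qed.

Lemma ge0_integral_shift z (f : 'rV[R]_n -> \bar R) :
  measurable_fun setT f -> (forall x, 0 <= f x)%E ->
  (\int[lebesgue_rV n]_x f (x + z)%R = \int[lebesgue_rV n]_x f x)%E.
Proof.
move=> mf f0; rewrite [RHS](ge0_integral_affine z ltr01) // expr1n mul1e.
by under [RHS]eq_integral do rewrite scale1r.
Qed.

Lemma lebesgue_rV_shift z (A : set 'rV[R]_n) : measurable A ->
  lebesgue_rV n ((fun x => x + z) @^-1` A) = lebesgue_rV n A.
Proof.
move=> mA; rewrite (lebesgue_rV_affine z ltr01 mA) expr1n mul1e.
by congr (lebesgue_rV n _); apply/seteqP; split => x /=; rewrite scale1r.
Qed.

Lemma integrable_affine c z (c0 : 0 < c) (f : 'rV[R]_n -> \bar R) :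
  (lebesgue_rV n).-integrable setT f ->
  (lebesgue_rV n).-integrable setT (fun x => f (c *: x + z)).
Proof.
move=> /integrableP[mf fy]; apply/integrableP; split.
  exact: (measurableT_comp mf (measurable_affine c z)).
move: fy; rewrite (ge0_integral_affine z c0) //; last exact: measurableT_comp.
rewrite [X in (X < _ -> _)%E]muleC => h; apply: contraLR h.
rewrite -!leNgt !leye_eq => /eqP ->; rewrite gt0_mulye // lte_fin exprn_gt0 //.
Qed.

Lemma integral_affine c z (c0 : 0 < c) (f : 'rV[R]_n -> \bar R) :
  (lebesgue_rV n).-integrable setT f ->
  (\int[lebesgue_rV n]_x f x =
   (c ^+ n)%:E * \int[lebesgue_rV n]_x f (c *: x + z)%R)%E.
Proof.
move=> intf; have [mf _] := integrableP _ _ _ intf.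
have intg := integrable_affine z c0 intf.
rewrite [LHS]integralE (@ge0_integral_affine c z c0 f^\+%E) //; last exact: measurable_funepos.
rewrite (@ge0_integral_affine c z c0 f^\-%E) //; last exact: measurable_funeneg.
rewrite [X in _ = (_ * X)%E]integralE.
rewrite [RHS]muleBr //.
  by under [in RHS]eq_integral do rewrite funeposE; under [X in _ = (_ - _ * X)%E]eq_integral do rewrite funenegE; under [X in (_ * X - _)%E = _]eq_integral do rewrite funeposE; under [X in (_ - _ * X)%E = _]eq_integral do rewrite funenegE.
by apply: fin_num_adde_defl; rewrite fin_numN; exact: integrable_neg_fin_num.
Qed.

Lemma integral_shift z (f : 'rV[R]_n -> \bar R) :
  (lebesgue_rV n).-integrable setT f ->
  (\int[lebesgue_rV n]_x f (x + z)%R = \int[lebesgue_rV n]_x f x)%E.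
Proof.
move=> intf; rewrite [RHS](integral_affine z ltr01) // expr1n mul1e.
by under [RHS]eq_integral do rewrite scale1r.
Qed.

End affine.

(** * Directional derivatives and smooth functions *)

Lemma MVT01 (R : realType) (g dg : R -> R) :
  (forall t : R, 0 <= t <= 1 -> is_derive t 1 g (dg t)) ->
  exists2 t : R, 0 <= t <= 1 & g 1 - g 0 = dg t.
Proof.
move=> h; have [|||t t01] := @MVT R g dg 0 1.
- exact: ltr01.
- by move=> t; rewrite in_itv /= => /andP[/ltW t0 /ltW t1]; apply: h; rewrite t0.
- apply: derivable_within_continuous => t; rewrite in_itv /= => t01.
  by have [] := h t t01.
rewrite subr0 mulr1 => e; exists t => //.
by move: t01; rewrite in_itv /= => /andP[/ltW -> /ltW ->].
Qed.

Section line_derivative.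
Context {R : realType} {V : normedModType R}.
Implicit Types (f : V -> R) (x v : V) (t : R).

(** The two difference quotients are the same function of [h]. This transfers the mean value theorem
    and the chain rule of one variable to directional derivatives. *)
Lemma is_derive_line f x v t df :
  is_derive (x + t *: v) v f df <-> is_derive t 1 (fun s : R => f (x + s *: v)) df.
Proof.
have E : (fun h : R => h^-1 *: ((f \o shift (x + t *: v)) (h *: v) - f (x + t *: v)))
  = (fun h : R => h^-1 *: (((fun s : R => f (x + s *: v)) \o shift t) (h *: (1 : R)) - f (x + t *: v))).
  apply/funext => h; congr (_ *: (_ - _)) => /=.
  by rewrite [h%:A]mulr1 scalerDl addrCA.
by split=> -[d e]; split; move: d e; rewrite /derivable /derive E.
Qed.

Lemma MVT_line f (df : V -> R) x v :
  (forall t : R, 0 <= t <= 1 -> is_derive (x + t *: v) v f (df (x + t *: v))) ->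
  exists2 t : R, 0 <= t <= 1 & f (x + v) - f x = df (x + t *: v).
Proof.
move=> h.
have [t t01 e] := @MVT01 R (fun s : R => f (x + s *: v)) (fun t : R => df (x + t *: v))
  (fun t t01 => (is_derive_line f x v t _).1 (h t t01)).
by exists t => //; rewrite -e scale1r scale0r addr0.
Qed.

End line_derivative.

Section directional.
Context {R : realType} {n : nat}.
Implicit Types (f : 'rV[R]_n -> R) (x v w : 'rV[R]_n) (U : set 'rV[R]_n).

Notation e_ i := (delta_mx (ord0 : 'I_1) (i : 'I_n) : 'rV[R]_n).

Lemma is_derive_partial f x (i : 'I_n) (c : R) :
  derivable f x (e_ i) -> is_derive x (c *: e_ i) f (c * partial i f x).
Proof.
move=> d.
have h : is_derive (0 : R) 1 (fun s : R => f (x + s *: e_ i)) (partial i f x).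
  by apply: (is_derive_line f x (e_ i) 0 _).1; rewrite scale0r addr0; exact: DeriveDef.
suff : is_derive (x + (0 : R) *: (c *: e_ i)) (c *: e_ i) f (c * partial i f x).
  by rewrite scale0r addr0.
apply: (is_derive_line f x (c *: e_ i) 0 _).2; under eq_fun do rewrite scalerA.
have -> : (fun s : R => f (x + (s * c) *: e_ i)) =
  (fun s : R => f (x + s *: e_ i)) \o (fun s => s * c) by [].
rewrite mulrC; apply: is_derive1_comp; first by rewrite mul0r.
have := is_deriveM (@is_derive_id _ _ (0:R) 1) (@is_derive_cst _ _ _ c (0:R) 1).
by rewrite scaler0 add0r => h'; apply: (is_derive_eq h'); rewrite [LHS]mulr1.
Qed.

(** The corners of the path from 0 to [w] that changes one coordinate at a time; in the sup norm the
    whole path stays within [|w|] of 0. *)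
Definition trunc_rV (k : nat) w : 'rV[R]_n := \row_i (if (i < k)%N then w ord0 i else 0).

Lemma trunc_rV0 w : trunc_rV 0 w = 0.
Proof. by apply/rowP => i; rewrite !mxE. Qed.

Lemma trunc_rVn w : trunc_rV n w = w.
Proof. by apply/rowP => i; rewrite !mxE ltn_ord. Qed.

Lemma trunc_rVS (i : 'I_n) w : trunc_rV i.+1 w = trunc_rV i w + w ord0 i *: e_ i.
Proof.
apply/rowP => j; rewrite !mxE /= ltnS leq_eqVlt -[(j == i :> nat)]/(j == i).
by case: (eqVneq j i) => [->|_] /=; rewrite ?ltnn ?mulr1 ?add0r ?mulr0 ?addr0.
Qed.

Lemma norm_trunc_rV (i : 'I_n) w (t : R) : 0 <= t <= 1 ->
  `|trunc_rV i w + t *: (w ord0 i *: e_ i)| <= `|w|.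
Proof.
move=> /andP[t0 t1]; apply: norm_le_coord => // j; rewrite !mxE /=.
case: (eqVneq j i) => [->|_]; last first.
  by rewrite !mulr0 addr0; case: ifP => _; rewrite ?normr0 // coord_le_norm.
rewrite ltnn add0r mulr1 normrM (ger0_norm t0); apply: le_trans (coord_le_norm w i).
by rewrite ler_piMl.
Qed.

(** The increment telescopes along the coordinate path, and on each edge the mean value theorem
    turns it into a partial derivative at some point of that edge. *)
Lemma partial_increment f (x w : 'rV[R]_n) (g : 'I_n -> R) (e : R) :
  (forall y i, `|y| <= `|w| -> derivable f (x + y) (e_ i)) ->
  (forall y i, `|y| <= `|w| -> `|partial i f (x + y) - g i| <= e) ->
  `|f (x + w) - f x - \sum_i w ord0 i * g i| <= e * \sum_i `|w ord0 i|.
Proof.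
move=> df ce; suff H k : (k <= n)%N ->
    `|f (x + trunc_rV k w) - f x - \sum_(i < n | (i < k)%N) w ord0 i * g i| <=
    e * \sum_(i < n | (i < k)%N) `|w ord0 i|.
  have := H n (leqnn _); rewrite trunc_rVn.
  have E (F : 'I_n -> R) : \sum_(i < n | (i < n)%N) F i = \sum_i F i.
    by apply: eq_bigl => i; rewrite ltn_ord.
  by rewrite !E.
elim: k => [|k IH] kn.
  by rewrite trunc_rV0 addr0 subrr !big_pred0 ?subr0 ?normr0 ?mulr0.
have := IH (ltnW kn); pose i := Ordinal kn.
have E (F : 'I_n -> R) : \sum_(j < n | (j < k.+1)%N) F j = F i + \sum_(j < n | (j < k)%N) F j.
  rewrite (bigD1 i) //=; congr (_ + _); apply: eq_bigl => j.
  by rewrite ltnS leq_eqVlt -(inj_eq val_inj) /=; case: (ltngtP j k).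
rewrite !E; set S := \sum_(j < n | _) _; set S' := \sum_(j < n | _) _ => {}IH.
have [|t t01] := @MVT_line R _ f (fun y => w ord0 i * partial i f y) (x + trunc_rV k w) (w ord0 i *: e_ i).
  move=> t t01; apply: is_derive_partial; rewrite -addrA; apply: df.
  exact: (@norm_trunc_rV i).
rewrite -addrA -(trunc_rVS i) /= -addrA => Et.
have := ce _ i (@norm_trunc_rV i w t t01); rewrite /= => h.
rewrite (_ : _ - _ - _ = (f (x + trunc_rV k w) - f x - S) +
  w ord0 i * (partial i f (x + (trunc_rV k w + t *: (w ord0 i *: e_ i))) - g i)); last by rewrite mulrBr -Et; ring.
apply: le_trans (ler_normD _ _) _; rewrite normrM mulrDr [leLHS]addrC.
by apply: lerD => //; rewrite mulrC ler_wpM2r.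
Qed.

Lemma is_derive_directional f U x v : open U -> U x ->
  (forall y i, U y -> derivable f y (e_ i)) ->
  (forall i, {for x, continuous (partial i f)}) ->
  is_derive x v f (\sum_i v ord0 i * partial i f x).
Proof.
move=> oU Ux df cf; set L := \sum_i _.
suff c : (fun h : R => h^-1 *: ((f \o shift x) (h *: v) - f x)) @ 0^' --> L.
  by split; [apply/cvg_ex; exists L|exact/cvg_lim].
apply/cvgrPdist_le => /= e e0.
pose C := 1 + \sum_i `|v ord0 i|.
have C0 : 0 < C by rewrite ltr_pwDl // sumr_ge0.
have near_x : \forall y \near x, U y /\ forall i, `|partial i f y - partial i f x| <= e / C.
  apply: filterI; first exact: open_nbhs_nbhs.
  apply: (@filter_forall _ _ (fun i y => `|partial i f y - partial i f x| <= e / C) (nbhs x)) => i; have := cf i; move/cvgrPdist_le => /(_ (e / C) (divr_gt0 e0 C0)).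
  by apply: filterS => y; rewrite distrC.
have /nbhs_ballP[d /= d0 hd] := near_x.
near=> h.
have h0 : h != 0 by near: h; exact: nbhs_dnbhs_neq.
have hv : `|h *: v| < d.
  rewrite normrZ; apply: (@le_lt_trans _ _ (`|h| * (1 + `|v|))).
    by rewrite ler_wpM2l // lerDr.
  rewrite -ltr_pdivlMr ?ltr_pwDl //; near: h; apply: dnbhs0_lt.
  by rewrite divr_gt0 // ltr_pwDl.
have ball_w y : `|y| <= `|h *: v| -> ball x d (x + y).
  move=> yv; rewrite mx_norm_ball /ball_ /= opprD addrA subrr add0r normrN.
  exact: le_lt_trans hv.
have := @partial_increment f x (h *: v) (fun i => partial i f x) (e / C)
  (fun y i yv => df _ i (hd _ (ball_w y yv)).1) (fun y i yv => (hd _ (ball_w y yv)).2 i).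
rewrite (_ : \sum_i _ = h * L); last first.
  by rewrite mulr_sumr; apply: eq_bigr => i _; rewrite mxE mulrA.
rewrite (_ : \sum_i _ = `|h| * \sum_i `|v ord0 i|); last first.
  by rewrite mulr_sumr; apply: eq_bigr => i _; rewrite mxE normrM.
move=> H; rewrite distrC [_ *: v + x]addrC.
rewrite (_ : _ - L = h^-1 * (f (x + h *: v) - f x - h * L)); last first.
  by rewrite mulrBr mulrA mulVf // mul1r.
rewrite normrM normfV ler_pdivrMl ?normr_gt0 //; apply: le_trans H _.
rewrite mulrCA ler_wpM2l // mulrAC ler_pdivrMr //.
by rewrite ler_wpM2l ?(ltW e0) // /C lerDr.
Unshelve. all: end_near. Qed.

End directional.

Section smooth_functions.
Context {R : realType} {n : nat}.
Implicit Types (f g : 'rV[R]_n -> R) (x v : 'rV[R]_n) (U Omega : set 'rV[R]_n).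

Notation e_ i := (delta_mx (ord0 : 'I_1) (i : 'I_n) : 'rV[R]_n).

(** A coinduction principle: a class stable under partial derivatives replaces formulas for iterated
    derivatives. It serves for the syntactic class [sm] and for superpositions. *)
Lemma smooth_coind (P : ('rV[R]_n -> R) -> Prop) :
  (forall f, P f -> [/\ continuous f, forall x i, derivable f x (e_ i) &
                      forall i, P (partial i f)]) ->
  forall f, P f -> smooth_on setT f.
Proof.
move=> H f Pf s x _.
have Ps : P (iter_partial s f) by elim: s => //= i s IH; have [_ _] := H _ IH; exact.
by have [cf df _] := H _ Ps; split => [|i]; [exact: cf|exact: df].
Qed.

Lemma iter_partial_rcons s (i : 'I_n) f :
  iter_partial (rcons s i) f = iter_partial s (partial i f).
Proof. by rewrite /iter_partial foldr_rcons. Qed.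

Lemma smooth_on_partial U f i : smooth_on U f -> smooth_on U (partial i f).
Proof. by move=> sf s x Ux; have := sf (rcons s i) x Ux; rewrite iter_partial_rcons. Qed.

Lemma smooth_on_derivable U f x i : smooth_on U f -> U x -> derivable f x (e_ i).
Proof. by move=> sf /(sf [::]) [_]; exact. Qed.

Lemma smooth_on_continuous U f x : smooth_on U f -> U x -> {for x, continuous f}.
Proof. by move=> sf /(sf [::]) []. Qed.

Lemma smooth_continuous f : smooth_on setT f -> continuous f.
Proof. by move=> sf x; apply: (smooth_on_continuous (U := setT)). Qed.

Lemma smooth_derivable f x i : smooth_on setT f -> derivable f x (e_ i).
Proof. by move=> sf; apply: (smooth_on_derivable (U := setT)). Qed.

Lemma smooth_measurable f : smooth_on setT f -> measurable_fun setT f.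
Proof. by move=> /smooth_continuous; exact: continuous_measurable_rVT. Qed.

Lemma smooth_partial_measurable f i : smooth_on setT f -> measurable_fun setT (partial i f).
Proof. by move=> sf; apply: smooth_measurable; exact: smooth_on_partial. Qed.

(* In [sm_comp], [h] lists the successive derivatives of the outer function. *)
Inductive sm : ('rV[R]_n -> R) -> Prop :=
| sm_smooth f : smooth_on setT f -> sm f
| sm_cst c : sm (fun=> c)
| sm_coord i : sm (fun x => x ord0 i)
| sm_add f g : sm f -> sm g -> sm (fun x => f x + g x)
| sm_mul f g : sm f -> sm g -> sm (fun x => f x * g x)
| sm_comp (h : nat -> R -> R) k f :
    (forall j (t : R), is_derive t 1 (h j) (h j.+1 t)) -> sm f ->
    sm (fun x => h k (f x))
| sm_inv f : sm f -> (forall x, f x != 0) -> sm (fun x => (f x)^-1).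

Lemma is_derive_comp_dir (h : R -> R) f x v (dh df : R) :
  is_derive (f x) 1 h dh -> is_derive x v f df ->
  is_derive x v (fun y => h (f y)) (dh * df).
Proof.
move=> Dh Df.
suff : is_derive (x + (0:R) *: v) v (fun y => h (f y)) (dh * df).
  by rewrite scale0r addr0.
apply: (is_derive_line (fun y => h (f y)) x v 0 _).2.
have Df0 : is_derive (0:R) 1 (fun s : R => f (x + s *: v)) df.
  by apply: (is_derive_line f x v 0 df).1; rewrite scale0r addr0.
apply: (@is_derive1_comp _ h (fun s : R => f (x + s *: v)) 0 dh df) => //.
by rewrite scale0r addr0.
Qed.

Lemma sm_closed f : sm f -> [/\ continuous f, forall x i, derivable f x (e_ i) &
  forall i, sm (partial i f)].
Proof.
elim => {f} [f sf|c|i|f g _ [cf df sf] _ [cg dg sg]|f g smf [cf df sf] smg [cg dg sg]|h k f dh smf [cf df sf]|f smf [cf df sf] f0].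
- split; [exact: smooth_continuous|by move=> x i; exact: smooth_derivable|].
  by move=> i; apply: sm_smooth; exact: smooth_on_partial.
- split; [by exact: cst_continuous|by move=> x i; exact: derivable_cst|].
  move=> i; rewrite (_ : partial _ _ = fun=> 0); first exact: sm_cst.
  by apply/funext => x; rewrite /partial derive_cst.
- have D x j : is_derive x (e_ j) (fun x : 'rV[R]_n => x ord0 i) ((i == j)%:R).
    have E : (fun h : R => h^-1 *: (((fun x : 'rV[R]_n => x ord0 i) \o shift x) (h *: e_ j) - x ord0 i)) @ 0^' --> ((i == j)%:R : R).
      apply: cvg_near_cst; near=> h; rewrite /= !mxE eqxx /= addrK.
      rewrite /GRing.scale /= mulrA mulVf ?mul1r //.
      by near: h; exact: nbhs_dnbhs_neq.
    by split; [apply/cvg_ex; eexists; exact: E|exact/cvg_lim].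
  split; [by move=> x; exact: coord_continuous|by move=> x j; have [] := D x j|].
  move=> j; rewrite (_ : partial _ _ = fun=> (i == j)%:R); first exact: sm_cst.
  by apply/funext => x; rewrite /partial; have [_ ->] := D x j.
- split; [by move=> x; exact: (continuousD (cf x) (cg x))|by move=> x i; apply: derivableD|].
  move=> i; rewrite (_ : partial _ _ = fun x => partial i f x + partial i g x); first exact: sm_add.
  by apply/funext => x; rewrite /partial; apply: deriveD.
- split; [by move=> x; exact: (continuousM (cf x) (cg x))|by move=> x i; apply: derivableM|].
  move=> i; rewrite (_ : partial _ _ = fun x => f x * partial i g x + g x * partial i f x).
    by apply: sm_add; exact: sm_mul.
  by apply/funext => x; rewrite /partial [LHS]deriveM.
- have D x j : is_derive x (e_ j) (fun x => h k (f x)) (h k.+1 (f x) * partial j f x).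
    exact: (@is_derive_comp_dir (h k) f x _ _ _ (dh k (f x)) (DeriveDef (df x j) erefl)).
  split.
  + move=> x; apply: (@continuous_comp _ _ _ f (h k)); first exact: cf.
    by apply/differentiable_continuous/derivable1_diffP; have [] := dh k (f x).
  + by move=> x i; have [] := D x i.
  + move=> i; rewrite (_ : partial _ _ = fun x => h k.+1 (f x) * partial i f x).
      by apply: sm_mul => //; exact: sm_comp.
    by apply/funext => x; rewrite /partial; have [_ ->] := D x i.
- split.
  + by move=> x; apply: (@continuousV _ _ f) => //; exact: cf.
  + by move=> x i; apply: derivableV => //; exact: df.
  + move=> i; rewrite (_ : partial _ _ = fun x => (- 1) * (((f x)^-1 * (f x)^-1) * partial i f x)).
      by apply: sm_mul; [exact: sm_cst|apply: sm_mul => //; apply: sm_mul; exact: sm_inv].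
    apply/funext => x; rewrite /partial [LHS](deriveV (f0 x) (df x i)).
    by rewrite /GRing.scale /= expr2 invfM !mulNr mul1r.
Unshelve. all: end_near. Qed.

Lemma smP f : sm f -> smooth_on setT f.
Proof. by move=> smf; apply: (smooth_coind sm_closed). Qed.

Lemma smooth_add f g : smooth_on setT f -> smooth_on setT g ->
  smooth_on setT (fun x => f x + g x).
Proof. by move=> sf sg; apply/smP/sm_add; exact: sm_smooth. Qed.

Lemma smooth_mul f g : smooth_on setT f -> smooth_on setT g ->
  smooth_on setT (fun x => f x * g x).
Proof. by move=> sf sg; apply/smP/sm_mul; exact: sm_smooth. Qed.

Lemma smooth_cst (c : R) : smooth_on setT ((fun=> c) : 'rV[R]_n -> R).
Proof. exact/smP/sm_cst. Qed.

Lemma partial_cst i (c : R) : partial i ((fun=> c) : 'rV[R]_n -> R) = fun=> 0.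
Proof. by apply/funext => x; rewrite /partial derive_cst. Qed.

Lemma partial_add f g x i : derivable f x (e_ i) -> derivable g x (e_ i) ->
  partial i (fun x => f x + g x) x = partial i f x + partial i g x.
Proof. exact: deriveD. Qed.

Lemma partial_mul f g x i : derivable f x (e_ i) -> derivable g x (e_ i) ->
  partial i (fun x => f x * g x) x = f x * partial i g x + g x * partial i f x.
Proof. exact: deriveM. Qed.

Lemma partial_comp (h : R -> R) f x i (dh : R) : is_derive (f x) 1 h dh ->
  derivable f x (e_ i) -> partial i (fun x => h (f x)) x = dh * partial i f x.
Proof.
move=> Dh df; have D : is_derive x (e_ i) f (partial i f x) by exact: DeriveDef.
by have [_] := @is_derive_comp_dir h f x _ _ _ Dh D.
Qed.

Lemma smooth_is_derive f x v : smooth_on setT f ->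
  is_derive x v f (\sum_i v ord0 i * partial i f x).
Proof.
move=> sf; apply: (@is_derive_directional _ _ f setT) => //; first exact: openT.
  by move=> y i _; exact: smooth_derivable.
by move=> i; apply: smooth_continuous; exact: smooth_on_partial.
Qed.

Lemma smooth_lipschitz f (M : R) x v : smooth_on setT f ->
  (forall i y, `|partial i f y| <= M) ->
  `|f (x + v) - f x| <= M * \sum_i `|v ord0 i|.
Proof.
move=> sf hM.
have [t t01 ->] := @MVT_line _ _ f (fun y => \sum_i v ord0 i * partial i f y) x v
  (fun t _ => smooth_is_derive (x + t *: v) v sf).
apply: le_trans (ler_norm_sum _ _ _) _; rewrite mulr_sumr; apply: ler_sum => i _.
by rewrite normrM mulrC ler_wpM2r.
Qed.

End smooth_functions.

Section test_functions.
Context {R : realType} {n : nat}.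
Implicit Types (f g phi psi : 'rV[R]_n -> R) (x v : 'rV[R]_n) (K Omega : set 'rV[R]_n).

Lemma supp0 f x : ~ supp f x -> f x = 0.
Proof. by move=> h; apply/eqP/negP => /negP fx; apply: h; exact: subset_closure. Qed.

Lemma test_of_compact Omega K f : smooth_on setT f -> compact K -> K `<=` Omega ->
  (forall x, ~ K x -> f x = 0) -> test_functions Omega f.
Proof.
move=> sf cK KO f0; have fK : supp f `<=` K.
  have cl : closed K by exact: compact_closed.
  rewrite [X in _ `<=` X](closure_id K).1 //; apply: closure_subset => x /= fx.
  by apply: contrapT => /f0 e; move: fx; rewrite e eqxx.
split => //; last exact: subset_trans KO.
by apply: (subclosed_compact _ cK fK); exact: closed_closure.
Qed.

Lemma test_add Omega f g : test_functions Omega f -> test_functions Omega g ->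
  test_functions Omega (fun x => f x + g x).
Proof.
move=> [sf cf fO] [sg cg gO].
apply: (@test_of_compact _ (supp f `|` supp g)); first exact: smooth_add.
- exact: compactU.
- by move=> x [/fO|/gO].
- by move=> x /not_orP[/supp0 -> /supp0 ->]; rewrite addr0.
Qed.

Lemma test_mul Omega f g : test_functions Omega f -> smooth_on setT g ->
  test_functions Omega (fun x => g x * f x).
Proof.
move=> [sf cf fO] sg; apply: (@test_of_compact _ (supp f) _ _ cf fO).
  exact: smooth_mul.
by move=> x /supp0 ->; rewrite mulr0.
Qed.

Lemma test_comp Omega f (h : nat -> R -> R) :
  (forall j (t : R), is_derive t 1 (h j) (h j.+1 t)) -> h 0 0 = 0 ->
  test_functions Omega f -> test_functions Omega (fun x => h 0 (f x)).
Proof.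
move=> dh h0 [sf cf fO]; apply: (@test_of_compact _ (supp f) _ _ cf fO).
  by apply: smP; apply: sm_comp => //; exact: sm_smooth.
by move=> x /supp0 ->.
Qed.

Lemma test0 Omega : test_functions Omega (fun=> 0).
Proof. by apply: (@test_of_compact _ set0) => //; [exact: smooth_cst|exact: compact0]. Qed.

Lemma test_smooth Omega f : test_functions Omega f -> smooth_on setT f.
Proof. by case. Qed.

Lemma partial_supp f i x : ~ supp f x -> partial i f x = 0.
Proof.
move=> h; rewrite /partial (@near_eq_derive _ _ _ f (cst 0)) ?derive_cst //.
have : open_nbhs x (~` supp f) by split => //; apply: closed_openC; exact: closed_closure.
by move/open_nbhs_nbhs; apply: filterS => y /= /supp0.
Qed.

Lemma test_partial Omega f i : test_functions Omega f -> test_functions Omega (partial i f).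
Proof.
move=> [sf cf fO]; apply: (@test_of_compact _ (supp f) _ _ cf fO).
  exact: smooth_on_partial.
by move=> x; exact: partial_supp.
Qed.

Lemma test_out Omega f x : test_functions Omega f -> ~ Omega x -> f x = 0.
Proof. by move=> [_ _ fO] Ox; apply: supp0 => /fO. Qed.

Lemma continuous_compact_bounded K f : compact K -> (forall x, K x -> {for x, continuous f}) ->
  exists2 M, 0 < M & forall x, K x -> `|f x| <= M.
Proof.
move=> cK cf; have : compact (f @` K).
  by apply: continuous_compact => //; apply: continuous_in_subspaceT => x /set_mem; exact: cf.
move=> /compact_bounded [M [_ hM]]; exists (`|M| + 1); first by rewrite ltr_pwDr.
by move=> x Kx; apply: (hM (`|M| + 1)); [have := ler_norm M; lra|exists x].
Qed.

Lemma test_bounded Omega f : test_functions Omega f -> exists2 M, 0 < M & forall x, `|f x| <= M.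
Proof.
move=> [sf cf _].
have [|M M0 hM] := continuous_compact_bounded (f := f) cf.
  by move=> x _; exact: smooth_continuous.
exists M => // x; have [/hM//|/supp0 ->] := pselect (supp f x).
by rewrite normr0 ltW.
Qed.

Lemma test_partial_bounded Omega f : test_functions Omega f ->
  exists2 M, 0 < M & forall i x, `|partial i f x| <= M.
Proof.
move=> tf; have h i := test_bounded (test_partial i tf).
have [M hM] := choice (fun i => let: ex_intro2 M M0 hM := h i in ex_intro (fun M => 0 < M /\ forall x, `|partial i f x| <= M) M (conj M0 hM)).
exists (1 + \sum_i M i) => [|i x].
  by rewrite ltr_pwDl // sumr_ge0 // => i _; rewrite ltW; have [] := hM i.
apply: le_trans ((hM i).2 x) _; rewrite (bigD1 i) //=.
have : 0 <= \sum_(j < n | j != i) M j by apply: sumr_ge0 => j _; rewrite ltW; have [] := hM j.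
lra.
Qed.

Lemma test_integrable Omega f : test_functions Omega f ->
  (lebesgue_rV n).-integrable setT (EFin \o f).
Proof.
move=> tf; have [M M0 hM] := test_bounded tf; have [sf cf _] := tf.
have mK : measurable (supp f) by apply: closed_measurable_rV; exact: closed_closure.
have mf := smooth_measurable sf.
apply/integrableP; split; first exact/measurable_EFinP.
apply: (@le_lt_trans _ _ (\int[lebesgue_rV n]_(x in supp f) M%:E)%E).
  rewrite [leRHS]integral_mkcond; apply: ge0_le_integral => //.
  - by apply/measurable_EFinP; exact: measurableT_comp.
  - by apply/(measurable_restrictT _ _).1 => //; exact: measurable_cst.
  - move=> x _ /=; rewrite patchE; case: ifPn => [_|]; first by rewrite lee_fin.
    by move/negP => h; rewrite (supp0 (f := f)) ?normr0 // => /mem_set.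
rewrite integral_cst // lte_mul_pinfty // ?lee_fin ?ltW //.
by apply: bounded_lebesgue_lty => //; exact: compact_bounded.
Qed.

End test_functions.

(** * A smooth step built from exp (-1/x), and bump functions *)

Section flat.
Context {R : realType}.
Implicit Types (P : {poly R}) (t x y : R).

(* The polynomial records the derivatives: those of [exp(-1/x)] have the form
   [P(1/x) exp(-1/x)] on the positive half-line. *)
Definition flat P x : R := if 0 < x then P.[x^-1] * expR (- x^-1) else 0.

(** With [y = 1/x] one has [dy/dx = - y^2], so [P(y) exp(-y)] has derivative
    [y^2 (P(y) - P'(y)) exp(-y)] in [x]. *)
Definition flat_step P : {poly R} := 'X^2 * (P - P^`()).

(** The exponential beats any power of [1/x]. A quadratic bound near the origin makes the difference
    quotient there tend to 0, the value that [flat] prescribes for the derivative. *)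
Lemma flat_le P : exists2 C, 0 <= C & forall x, `|flat P x| <= C * x ^+ 2 \/ 1 < `|x|.
Proof.
(* The term of degree [d + 1 = size P + 2] in the exponential series gives that many factors [x]:
   [size P] of them absorb the growth of [P(1/x)] and two remain. *)
pose d := (size P).+1; pose S := \sum_(i < size P) `|P`_i|.
exists (S * d.+1`!%:R) => [|x]; first by rewrite mulr_ge0 // sumr_ge0.
have S0 : 0 <= S by rewrite sumr_ge0.
have [x1|] := leP `|x| 1; [left|by right].
rewrite /flat; case: ifPn => [x0|_]; last by rewrite normr0 mulr_ge0 ?sqr_ge0 // mulr_ge0.
have y1 : 1 <= x^-1 by rewrite -[leLHS]invr1 lef_pV2 ?posrE // -(gtr0_norm x0).
have y0 : 0 < x^-1 by rewrite invr_gt0.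
have hP : `|P.[x^-1]| <= S * x^-1 ^+ size P.
  rewrite horner_coef; apply: le_trans (ler_norm_sum _ _ _) _; rewrite mulr_suml.
  apply: ler_sum => i _; rewrite normrM ler_wpM2l // normrX gtr0_norm //.
  by rewrite ler_weXn2l // ltnW.
have he : expR (- x^-1) <= d.+1`!%:R * x ^+ d.+1.
  rewrite expRN -[leRHS]invrK lef_pV2 ?posrE ?expR_gt0 ?invr_gt0 //; last first.
    by rewrite mulr_gt0 ?exprn_gt0 // ltr0n fact_gt0.
  rewrite invfM -exprVn mulrC; apply: le_trans (expR_ge1Dxn d (ltW y0)).
  by rewrite lerDr.
rewrite normrM (gtr0_norm (expR_gt0 _)).
apply: (@le_trans _ _ ((S * x^-1 ^+ size P) * (d.+1`!%:R * x ^+ d.+1))).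
  by apply: ler_pM => //; exact: expR_ge0.
rewrite -!mulrA ler_wpM2l // mulrCA ler_wpM2l ?ler0n //.
by rewrite /d -addn2 exprD mulrA -exprMn mulVf ?gt_eqF // expr1n mul1r.
Qed.

Lemma is_derive_horner P x : is_derive x 1 (horner P) P^`().[x].
Proof.
rewrite (derivE P) derive1E; split; [exact: derivable_horner|by []].
Qed.

Lemma is_derive_flat P x : is_derive x 1 (flat P) (flat (flat_step P) x).
Proof.
have [x0|x0|->] := ltgtP x 0.
- rewrite /(flat (flat_step P)) ltNge (ltW x0) /=.
  apply: (near_eq_is_derive _ (is_derive_cst (0 : R) x (1 : R))).
  near=> y; rewrite /flat ifF //; apply/negbTE; rewrite -leNgt ltW //.
  by near: y; exact: lt_nbhsl.
- have D : is_derive x 1 (fun y => P.[y^-1] * expR (- y^-1)) (flat (flat_step P) x).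
    have Di : is_derive x (1 : R) (fun y : R => y^-1) (- x ^- 2).
      apply: is_derive_eq; first by apply: is_deriveV; rewrite ?gt_eqF //.
      by rewrite [LHS]mulr1.
    have DP : is_derive x 1 (fun y => P.[y^-1]) (P^`().[x^-1] * - x ^- 2).
      exact: (@is_derive1_comp _ (horner P) (fun y => y^-1) x _ _ (is_derive_horner P x^-1) Di).
    have De : is_derive x 1 (fun y => expR (- y^-1)) (expR (- x^-1) * x ^- 2).
      apply: (@is_derive1_comp _ expR (fun y => - y^-1)).
      by rewrite -[x ^- 2]opprK; exact: is_deriveN.
    have DM := is_deriveM DP De.
    apply: (is_derive_eq DM).
    rewrite /flat x0 /flat_step !hornerE /GRing.scale /= exprVn; ring.
  apply: (near_eq_is_derive _ D).
  near=> y; rewrite /flat ifT //.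
  by near: y; exact: lt_nbhsr.
- have f0 Q : flat Q 0 = 0 by rewrite /flat ltxx.
  have [C C0 hC] := flat_le P; have C1 : 0 < C + 1 by lra.
  have c : (fun h : R => h^-1 *: ((flat P \o shift 0) (h *: (1 : R)) - flat P 0)) @ 0^' --> (0 : R).
    apply/cvgrPdist_le => /= e e0; near=> h.
    rewrite f0 subr0 sub0r normrN addr0 [h%:A]mulr1 [_ *: _]/(_ * _) normrM normfV.
    have h0 : h != 0 by near: h; exact: nbhs_dnbhs_neq.
    rewrite ler_pdivrMl ?normr_gt0 //.
    case: (hC h) => [hh|h1]; last first.
      exfalso; move: h1; apply/negP; rewrite -leNgt; near: h.
      exact: dnbhs0_le.
    apply: le_trans hh _; rewrite -(normr_id h) -[in h ^+ 2](ger0_norm (sqr_ge0 h)) normrX expr2 mulrA mulrC normr_id ler_wpM2l //.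
    apply: (@le_trans _ _ ((C + 1) * `|h|)); first by rewrite ler_wpM2r // lerDl.
    rewrite mulrC -ler_pdivlMr //; near: h; apply: dnbhs0_le.
    exact: divr_gt0.
  by rewrite f0; split; [apply/cvg_ex; exists 0|exact/cvg_lim].
Unshelve. all: end_near. Qed.

Definition flat_iter j := flat (iter j flat_step 1).

Lemma is_derive_flat_iter j t : is_derive t 1 (flat_iter j) (flat_iter j.+1 t).
Proof. exact: is_derive_flat. Qed.

Lemma flat1_gt0 t : 0 < t -> 0 < flat 1 t.
Proof. by move=> t0; rewrite /flat t0 hornerC mul1r expR_gt0. Qed.

Lemma flat_le0 P t : t <= 0 -> flat P t = 0.
Proof. by move=> t0; rewrite /flat ltNge t0. Qed.

Lemma flat1_ge0 t : 0 <= flat 1 t.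
Proof. by have [/flat_le0 ->//|/flat1_gt0/ltW] := leP t 0. Qed.

Lemma flat_sum_gt0 t : 0 < flat 1 t + flat 1 (1 - t).
Proof.
have [t0|t0] := leP t 0; first by rewrite ltr_wpDl ?flat1_ge0 // flat1_gt0; lra.
by rewrite ltr_pwDl ?flat1_ge0 // flat1_gt0.
Qed.

Definition smooth_step t := flat 1 t / (flat 1 t + flat 1 (1 - t)).

Lemma smooth_step0 t : t <= 0 -> smooth_step t = 0.
Proof. by move=> t0; rewrite /smooth_step flat_le0 // mul0r. Qed.

Lemma smooth_step1 t : 1 <= t -> smooth_step t = 1.
Proof.
move=> t0; have := flat_sum_gt0 t; rewrite /smooth_step (@flat_le0 _ (1 - t)); last lra.
by rewrite addr0 => h; rewrite divff // gt_eqF.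
Qed.

End flat.

Section bump.
Context {R : realType} {n : nat}.
Implicit Types (c x : 'rV[R]_n).

Lemma sm_prod (F : 'I_n -> 'rV[R]_n -> R) : (forall i, sm (F i)) ->
  sm (fun x => \prod_i F i x).
Proof.
move=> sF; elim: index_enum => [|i s IH].
  by under eq_fun do rewrite big_nil; exact: sm_cst.
by under eq_fun do rewrite big_cons; exact: sm_mul.
Qed.

Lemma sm_flat (f : 'rV[R]_n -> R) : sm f -> sm (fun x => flat 1 (f x)).
Proof. by move=> sf; apply: (@sm_comp _ _ flat_iter 0) => // j t; exact: is_derive_flat_iter. Qed.

Lemma sm_step (f : 'rV[R]_n -> R) : sm f -> sm (fun x => smooth_step (f x)).
Proof.
move=> sf; apply: sm_mul; first exact: sm_flat.
apply: (@sm_inv _ _ (fun x => flat 1 (f x) + flat 1 (1 - f x))); last first.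
  by move=> x; rewrite gt_eqF // flat_sum_gt0.
apply: sm_add; first exact: sm_flat.
apply: sm_flat; under eq_fun do rewrite -mulN1r; apply: sm_add; first exact: sm_cst.
by apply: sm_mul => //; exact: sm_cst.
Qed.

Lemma sm_coord_affine (i : 'I_n) (b a : R) : sm (fun x => b + a * x ord0 i).
Proof. by apply: sm_add; [exact: sm_cst|apply: sm_mul; [exact: sm_cst|exact: sm_coord]]. Qed.

(** In each coordinate the first factor climbs from 0 at [c - 2 d] to 1 at [c - d], and the second
    one descends symmetrically. The affine arguments are written in the form of
    [sm_coord_affine]. *)
Definition plateau c (d : R) x : R :=
  \prod_i (smooth_step ((2 - c ord0 i / d) + d^-1 * x ord0 i) *
           smooth_step ((2 + c ord0 i / d) + (- d^-1) * x ord0 i)).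

Lemma smooth_plateau c d : smooth_on setT (plateau c d).
Proof.
by apply: smP; apply: sm_prod => i; apply: sm_mul; apply: sm_step; exact: sm_coord_affine.
Qed.

Lemma plateau1 c d x : 0 < d -> `|x - c| <= d -> plateau c d x = 1.
Proof.
move=> d0 xc; apply: big1 => i _.
have := le_trans (coord_le_norm (x - c) i) xc; rewrite !mxE ler_norml => /andP[h1 h2].
have h3 : -1 <= (x ord0 i - c ord0 i) / d by rewrite ler_pdivlMr // mulN1r.
have h4 : (x ord0 i - c ord0 i) / d <= 1 by rewrite ler_pdivrMr // mul1r.
rewrite mulrBl in h3 h4.
by rewrite !smooth_step1 ?mulr1 //; lra.
Qed.

Lemma plateau0 c d x : 0 < d -> 2 * d <= `|x - c| -> plateau c d x = 0.
Proof.
move=> d0 xc; have [i hi] : exists i, 2 * d <= `|x ord0 i - c ord0 i|.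
  apply: contrapT => /forallNP h; have := lt_irreflexive.
  have : `|x - c| < 2 * d.
    rewrite -[_ - _]opprK normrN opprB; have : ball c (2 * d) x.
      by rewrite rV_ballE ?mulr_gt0 // => i; rewrite distrC ltNge; apply/negP/h.
    by rewrite mx_norm_ball /ball_ /=.
  by rewrite ltNge xc.
rewrite /plateau (bigD1 i) //= -[RHS](mul0r (\prod_(j < n | j != i) (smooth_step ((2 - c ord0 j / d) + d^-1 * x ord0 j) *
           smooth_step ((2 + c ord0 j / d) + (- d^-1) * x ord0 j)))); congr (_ * _).
have hd : 2 <= `|(x ord0 i - c ord0 i) / d|.
  by rewrite normrM normfV (gtr0_norm d0) ler_pdivlMr.
move: hd; rewrite mulrBl ler_normr => /orP[h|h].
  by rewrite [X in _ * X]smooth_step0 ?mulr0 //; lra.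
by rewrite [X in X * _]smooth_step0 ?mul0r //; lra.
Qed.

Definition box_bump (a b : 'I_n -> R) x : R :=
  \prod_i (flat 1 (- a i + 1 * x ord0 i) * flat 1 (b i + (-1) * x ord0 i)).

Lemma sm_box_bump a b : sm (box_bump a b).
Proof. by apply: sm_prod => i; apply: sm_mul; apply: sm_flat; exact: sm_coord_affine. Qed.

Lemma box_bump_ge0 a b x : 0 <= box_bump a b x.
Proof. by apply: prodr_ge0 => i _; rewrite mulr_ge0 // flat1_ge0. Qed.

Lemma box_bump_gt0 a b x : box a b x -> 0 < box_bump a b x.
Proof.
move=> h; apply: prodr_gt0 => i _; have := h i; rewrite /= in_itv /= => /andP[h1 h2].
by rewrite mulr_gt0 // flat1_gt0; lra.
Qed.

Lemma box_bump_out a b x : ~ box a b x -> box_bump a b x = 0.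
Proof.
move=> /existsNP[i]; rewrite /= in_itv /= => /negP; rewrite negb_and -!leNgt => h.
rewrite /box_bump (bigD1 i) //= -[RHS](mul0r (\prod_(j < n | j != i) (flat 1 (- a j + 1 * x ord0 j) * flat 1 (b j + (-1) * x ord0 j)))); congr (_ * _).
case/orP: h => h; first by rewrite flat_le0 ?mul0r //; lra.
by rewrite [X in _ * X]flat_le0 ?mulr0 //; lra.
Qed.

Lemma closed_box_compact (a b : 'I_n -> R) :
  compact [set x : 'rV[R]_n | forall i, `[a i, b i]%classic (x ord0 i)].
Proof. by apply: (@rV_compact _ _ (fun i => `[a i, b i]%classic)) => i; exact: segment_compact. Qed.

End bump.

(** * Sublevel sets along segments *)

Section rolle.
Context {R : realType}.
Implicit Types (g dg : R -> R) (a b x y : R) (s : seq R).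

(** The new zeros interlace the old ones; recording that they are increasing is what allows the
    lemma to be iterated. *)
Lemma rolle_seq g dg a b x s :
  (forall t, a <= t <= b -> is_derive t 1 g (dg t)) ->
  sorted <%R (x :: s) -> all (fun t => a <= t <= b) (x :: s) ->
  all (fun t => g t == 0) (x :: s) ->
  exists s', [/\ size s' = size s, path <%R x s', all (fun t => a <= t <= b) s' &
     all (fun t => dg t == 0) s'].
Proof.
move=> dgab; elim: s x => [|y s IH] x; first by move=> _ _ _; exists [::].
move=> /= /andP[xy ys] /andP[xab yab] /andP[gx gy].
have [s' [ss ps abs zs]] := IH y ys yab gy.
move: yab gy => /= /andP[yab _] /andP[gy _].
have [|||z zxy dz] := @Rolle _ g x y xy.
- move=> t; rewrite in_itv /= => /andP[xt ty].
  have tab : a <= t <= b by move: xab yab => /andP[? ?] /andP[? ?]; apply/andP; split; lra.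
  by have [] := dgab t tab.
- apply: derivable_within_continuous => t; rewrite in_itv /= => /andP[xt ty].
  have tab : a <= t <= b by move: xab yab => /andP[? ?] /andP[? ?]; apply/andP; split; lra.
  by have [] := dgab t tab.
- by rewrite (eqP gx) (eqP gy).
move: zxy; rewrite in_itv /= => /andP[xz zy].
have zab : a <= z <= b.
  by move: xab yab => /andP[? ?] /andP[? ?]; apply/andP; split; lra.
exists (z :: s'); split => /=.
- by rewrite ss.
- rewrite xz /=; case: s' ps {ss abs zs} => //= w s' /andP[yw ->].
  by rewrite (lt_trans zy yw).
- by rewrite zab.
- rewrite zs andbT; apply/eqP; have [_ e1] := dz; have [_ e2] := dgab z zab.
  by rewrite -e2 e1.
Qed.

Lemma rolle_iter (F : nat -> R -> R) a b k s :
  (forall j t, (j < k)%N -> a <= t <= b -> is_derive t 1 (F j) (F j.+1 t)) ->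
  size s = k.+1 -> sorted <%R s -> all (fun t => a <= t <= b) s ->
  all (fun t => F 0 t == 0) s ->
  exists2 t, a <= t <= b & F k t = 0.
Proof.
elim: k F s => [|k IH] F [//|x s] dF.
  by case: s => // _ _ /= /andP[xab _] /andP[/eqP Fx _]; exists x.
move=> [ss] ssort sab sz.
have [s' [ss' ps' abs' zs']] := rolle_seq (fun t => dF 0 t isT) ssort sab sz.
have sz1 : size s' = k.+1 by rewrite ss'; case: ss.
have [t tab Ft] := IH (fun j => F j.+1) s' (fun j t jk => dF j.+1 t jk) sz1
  (path_sorted ps') abs' zs'.
by exists t.
Qed.

End rolle.

Section interpolation.
Context {R : realType} (k : nat) (x : 'I_k.+1 -> R).
Hypothesis xinj : injective x.

Definition node_poly (j : 'I_k.+1) : {poly R} :=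
  \prod_(i <- [seq i <- index_enum 'I_k.+1 | i != j]) ('X - (x i)%:P).

Let size_nodes j : size [seq i <- index_enum 'I_k.+1 | i != j] = k.
Proof.
rewrite size_filter -sum1_count sum1_card.
by have := cardC1 j; rewrite card_ord /= => h; rewrite -[RHS]h; apply: eq_card.
Qed.

Lemma size_node_poly j : size (node_poly j) = k.+1.
Proof. by rewrite size_prod_XsubC size_nodes. Qed.

Lemma coef_node_poly j : (node_poly j)`_k = 1.
Proof.
have /monicP := monic_prod_XsubC [seq i <- index_enum 'I_k.+1 | i != j] predT x.
by rewrite /lead_coef -/(node_poly j) size_node_poly.
Qed.

Lemma horner_node_poly j t : (node_poly j).[t] = \prod_(i | i != j) (t - x i).
Proof.
rewrite /node_poly big_filter horner_prod; apply: eq_bigr => i _.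
by rewrite hornerXsubC.
Qed.

Lemma node_poly_neq j i : i != j -> (node_poly j).[x i] = 0.
Proof. by move=> ij; rewrite horner_node_poly (bigD1 i) //= subrr mul0r. Qed.

Lemma node_poly_neq0 j : (node_poly j).[x j] != 0.
Proof.
rewrite horner_node_poly; apply/prodf_neq0 => i ij.
by rewrite subr_eq0; apply: contra ij => /eqP/xinj ->.
Qed.

Definition interp (f : R -> R) : {poly R} :=
  \sum_j (f (x j) / (node_poly j).[x j]) *: node_poly j.

Lemma interpE f i : (interp f).[x i] = f (x i).
Proof.
rewrite /interp horner_sum (bigD1 i) //= big1 => [|j ji].
  by rewrite addr0 hornerZ divfK // node_poly_neq0.
by rewrite hornerZ (_ : (node_poly j).[x i] = 0) ?mulr0 // node_poly_neq // eq_sym.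
Qed.

Lemma coef_interp f : (interp f)`_k = \sum_j f (x j) / (node_poly j).[x j].
Proof.
by rewrite /interp coef_sum; apply: eq_bigr => j _; rewrite coefZ coef_node_poly mulr1.
Qed.

Lemma size_interp f : (size (interp f) <= k.+1)%N.
Proof.
apply: leq_trans (size_sum _ _ _) _; apply/bigmax_leqP => j _.
by apply: leq_trans (size_scale_leq _ _) _; rewrite size_node_poly.
Qed.

Lemma derivn_interp f : (interp f)^`(k) = ((interp f)`_k *+ k`!)%:P.
Proof.
apply/polyP => i; rewrite coef_derivn coefC; case: eqP => [->|/eqP i0].
  by rewrite addn0 ffactnn.
rewrite nth_default ?mul0rn //; apply: leq_trans (size_interp f) _.
by rewrite -addn1 leq_add2l lt0n.
Qed.

(** The difference between [f 0] and its Lagrange interpolant vanishes at [k + 1] nodes, so its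
    [k]-th derivative has a zero by Rolle, and the [k]-th derivative of the interpolant is [k!]
    times its leading coefficient. *)
Lemma divided_difference (f : nat -> R -> R) (a b : R) :
  (forall j t, (j < k)%N -> a <= t <= b -> is_derive t 1 (f j) (f j.+1 t)) ->
  (forall i, a <= x i <= b) ->
  exists2 t, a <= t <= b & f k t = (\sum_j f 0 (x j) / (node_poly j).[x j]) *+ k`!.
Proof.
move=> df xab; pose p := interp (f 0).
pose F j t := f j t - (p^`(j)).[t].
have dF j t : (j < k)%N -> a <= t <= b -> is_derive t 1 (F j) (F j.+1 t).
  move=> jk tab; rewrite /F derivnS.
  exact: (is_deriveB (df j t jk tab) (is_derive_horner (p^`(j)) t)).
have [|||| t tab] := @rolle_iter _ F a b k (sort <=%R (codom x)) dF.
- by rewrite size_sort size_codom card_ord.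
- rewrite sort_lt_sorted map_inj_uniq ?enum_uniq //.
- by apply/allP => t; rewrite mem_sort => /codomP[i ->].
- apply/allP => t; rewrite mem_sort => /codomP[i ->].
  by rewrite /F derivn0 interpE subrr.
rewrite /F derivn_interp hornerC coef_interp => /eqP; rewrite subr_eq0 => /eqP e.
by exists t.
Qed.

End interpolation.

Section sublevel.
Context {R : realType}.

(** The divided difference over the nodes 0 and [r i] is a value of [f m.+1] over [(m+1)!]; solving
    for [f 0 0] bounds it by the values at the [r i]. The denominator at 0 is the product of the
    [r i], at most [2^(m+1)]; the one at [r i] contains [r i >= 1] and [m] differences of size at
    least [h]. *)
Lemma separated_bound (m : nat) (f : nat -> R -> R) (H h s : R) (r : 'I_m.+1 -> R) :
  (forall j (t : R), (j <= m)%N -> 0 <= t <= 2 -> is_derive t 1 (f j) (f j.+1 t)) ->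
  (forall t : R, 0 <= t <= 2 -> `|f m.+1 t| <= H) ->
  0 < h -> (forall i, 1 <= r i <= 2) ->
  (forall i j, i != j -> h <= `|r i - r j|) ->
  (forall i, `|f 0 (r i)| <= s) ->
  `|f 0 0| <= 2 ^+ m.+1 * (m.+1%:R * (s / h ^+ m) + H).
Proof.
move=> df fH h0 r12 rsep fs.
pose x (i : 'I_m.+2) : R := oapp r 0 (unlift ord0 i).
have x0 : x ord0 = 0 by rewrite /x unlift_none.
have xl i : x (lift ord0 i) = r i by rewrite /x liftK.
have xinj : injective x.
  move=> i j; case: (unliftP ord0 i) => [i'|] ->; case: (unliftP ord0 j) => [j'|] ->; rewrite ?x0 ?xl //.
  - move=> e; congr lift; apply/eqP/negPn/negP => /rsep.
    by rewrite e subrr normr0 leNgt h0.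
  - by move=> e; have := r12 i'; rewrite e ler10.
  - by move=> e; have := r12 j'; rewrite -e ler10.
have xab i : 0 <= x i <= 2.
  case: (unliftP ord0 i) => [i'|] ->; rewrite ?x0 ?xl; last by rewrite lexx ler0n.
  by have /andP[h1 ->] := r12 i'; rewrite (le_trans ler01 h1).
have [t tab] := @divided_difference _ _ _ xinj f 0 2 df xab.
rewrite big_ord_recl x0 => e.
pose P := \prod_i r i.
have P0 : 0 < P by apply: prodr_gt0 => i _; have /andP[h1 _] := r12 i; lra.
have P2 : P <= 2 ^+ m.+1.
  rewrite /P -[X in 2 ^+ X]card_ord -prodr_const; apply: ler_prod => i _.
  by have /andP[h1 ->] := r12 i; rewrite (le_trans ler01 h1).
have n0 : `|(node_poly x ord0).[0]| = P.
  rewrite horner_node_poly normr_prod (eq_bigl (fun i => i \in predC1 ord0)) //.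
  rewrite big_mkcond big_ord_recl /= mul1r /P; apply: eq_bigr => i _.
  by rewrite sub0r normrN xl ger0_norm //; have /andP[h1 _] := r12 i; lra.
have nj i : h ^+ m <= `|(node_poly x (lift ord0 i)).[r i]|.
  rewrite -xl horner_node_poly normr_prod big_mkcond big_ord_recl /= x0 xl subr0.
  apply: (@le_trans _ _ (1 * \prod_(j < m.+1 | j != i) h)).
    by rewrite mul1r prodr_const cardC1 card_ord.
  have /andP[h1 _] := r12 i.
  apply: ler_pM => //; first by apply: prodr_ge0 => j _; exact: ltW.
    by rewrite ger0_norm //; lra.
  rewrite [leLHS]big_mkcond; apply: ler_prod => j _; rewrite (inj_eq lift_inj).
  case: ifPn => [ji|_]; last by rewrite ler01 lexx.
  by rewrite xl (ltW h0) rsep // eq_sym.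
have hm : 0 < h ^+ m by rewrite exprn_gt0.
have s0 : 0 <= s by apply: le_trans (fs ord0).
have fH' : `|f m.+1 t| / (m.+1)`!%:R <= H.
  rewrite ler_pdivrMr ?ltr0n ?fact_gt0 //; apply: le_trans (fH t tab) _.
  by rewrite ler_peMr ?ler1n ?fact_gt0 // (le_trans _ (fH t tab)).
have e' : f 0 0 / (node_poly x ord0).[0] = f m.+1 t / (m.+1)`!%:R -
   \sum_(i < m.+1) f 0 (r i) / (node_poly x (lift ord0 i)).[r i].
  rewrite e -mulr_natr mulfK ?pnatr_eq0 ?gtn_eqF ?fact_gt0 //.
  by under [X in _ - X]eq_bigr do rewrite -xl; rewrite addrK.
have : `|f 0 0| / P <= m.+1%:R * (s / h ^+ m) + H.
  rewrite -n0 -normf_div e'; apply: le_trans (ler_normB _ _) _.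
  rewrite addrC; apply: lerD; last by rewrite normf_div (@ger0_norm _ (_`!)%:R).
  apply: le_trans (ler_norm_sum _ _ _) _.
  rewrite mulr_natl -[X in _ *+ X]card_ord -sumr_const; apply: ler_sum => i _.
  rewrite normf_div ler_pM // lef_pV2 ?posrE // (lt_le_trans hm) //.
rewrite ler_pdivrMr // mulrC => hP; apply: le_trans hP _; rewrite ler_wpM2r //.
by rewrite addr_ge0 ?mulr_ge0 ?invr_ge0 ?(ltW hm) // (le_trans _ fH') // divr_ge0.
Qed.

(** As long as the intervals of radius [h] around the points already chosen have total length [2 h]
    times their number, less than the measure of [E], they leave a point of [E] uncovered. *)
Lemma greedy_separated (E : set R) (h : R) (m : nat) :
  measurable E -> 0 < h -> ((m.*2%:R * h)%:E < lebesgue_measure E)%E ->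
  exists r : 'I_m.+1 -> R, (forall i, E (r i)) /\
    (forall i j, i != j -> h <= `|r i - r j|).
Proof.
move=> mE h0; elim: m => [|m IH] hE.
  have [x Ex] : exists x, E x.
    apply: contrapT => /forallNP nE; move: hE; rewrite (_ : E = set0); last first.
      by apply/seteqP; split => // x /nE.
    by rewrite measure0 mul0r ltxx.
  by exists (fun=> x); split => // i j; rewrite (ord1 i) (ord1 j) eqxx.
have [|r [Er sr]] := IH.
  by apply: le_lt_trans hE; rewrite lee_fin ler_wpM2r ?(ltW h0) // ler_nat doubleS; lia.
pose B := \big[setU/set0]_(i < m.+1) (ball (r i) h : set R).
have mB : measurable B by apply: bigsetU_measurable => i _; exact: measurable_ball.
have [x [Ex xB]] : exists x, E x /\ ~ B x.
  apply: contrapT => /forallNP nE; move: hE; apply/negP; rewrite -leNgt.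
  apply: (@le_trans _ _ (lebesgue_measure B)).
    by apply: le_measure; rewrite ?inE // => x Ex; apply: contrapT => nB; apply: (nE x).
  apply: le_trans (@content_subadditive _ _ _ lebesgue_measure _ (fun i : nat => oapp (fun i => ball (r i) h) set0 (insub i : option 'I_m.+1)) m.+1 _ _ _) _.
  - by move=> i _; case: insubP => [j _ _|_] /=; [exact: measurable_ball|exact: measurable0].
  - exact: mB.
  - rewrite /B; apply: subset_trans (_ : _ `<=` \big[setU/set0]_(i < m.+1) oapp (fun i => ball (r i) h) set0 (insub (val i) : option 'I_m.+1)) _ => //.
    by rewrite (eq_bigr (fun i : 'I_m.+1 => oapp (fun i => ball (r i) h) set0 (insub (val i) : option 'I_m.+1))) // => i _; rewrite valK.
  - apply: (@le_trans _ _ (\sum_(i < m.+1) (h *+ 2)%:E)%E).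
      by apply: lee_sum => i _; rewrite valK /= lebesgue_measure_ball // ltW.
    by rewrite sumEFin lee_fin sumr_const card_ord -mulrnA mulr_natl mul2n.
exists (fun i => oapp r x (unlift ord_max i)); split => [i|i j].
  by case: (unlift ord_max i) => [j|] /=.
have sx k : h <= `|x - r k|.
  rewrite leNgt; apply/negP => hk; apply: xB; rewrite /B -bigcup_seq.
  by exists k => /=; [rewrite mem_index_enum|rewrite /ball /= distrC].
case: (unliftP ord_max i) => [i'|] ->; case: (unliftP ord_max j) => [j'|] ->.
- by rewrite (inj_eq lift_inj); exact: sr.
- by move=> _ /=; rewrite distrC.
- by move=> _ /=.
- by rewrite eqxx.
Qed.

(** A larger sublevel set would contain [m + 1] points at mutual distance at least [h]. The two
    strict inequalities make each of the two terms in [separated_bound] smaller than half of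
    [f 0 0], a contradiction. *)
Lemma sublevel_measure (m : nat) (f : nat -> R -> R) (H h s : R) :
  (forall j (t : R), (j <= m)%N -> 0 <= t <= 2 -> is_derive t 1 (f j) (f j.+1 t)) ->
  (forall t : R, 0 <= t <= 2 -> `|f m.+1 t| <= H) ->
  (forall t : R, 0 <= t <= 2 -> 0 <= f 0 t) ->
  2 ^+ m.+2 * H < f 0 0 -> 0 < h ->
  2 ^+ m.+2 * m.+1%:R * s < f 0 0 * h ^+ m ->
  measurable ([set t | f 0 t < s] `&` `[1, 2]%classic) ->
  (lebesgue_measure ([set t | (f 0%N t < s)%R] `&` `[1%R, 2%R]) <= (m.*2%:R * h)%:E)%E.
Proof.
move=> df fH f0 Hf h0 sf mE; rewrite leNgt; apply/negP.
move=> /(greedy_separated mE h0)[r [Er sr]].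
have r12 i : 1 <= r i <= 2 by have [_] := Er i; rewrite /= in_itv.
have hm : 0 < h ^+ m by rewrite exprn_gt0.
have := separated_bound df fH h0 r12 sr (s := s).
have fs i : `|f 0 (r i)| <= s.
  have [fr _] := Er i; rewrite ger0_norm; first exact: ltW.
  by apply: f0; have /andP[h1 ->] := r12 i; rewrite (le_trans ler01 h1).
move=> /(_ fs); rewrite ger0_norm; last by apply: f0; rewrite lexx ler0n.
have sf' : 2 ^+ m.+2 * (m.+1%:R * (s / h ^+ m)) < f 0 0.
  by rewrite !mulrA ltr_pdivrMr.
rewrite leNgt => /negP; apply.
move: sf' Hf; rewrite !(exprS 2 m.+1); set a := 2 ^+ m.+1; set u := m.+1%:R * _; lra.
Qed.

End sublevel.

Lemma bernoulli {R : realType} (b : R) k : 1 <= b -> 1 + k%:R * (b - 1) <= b ^+ k.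
Proof.
move=> b1; elim: k => [|k IH]; first by rewrite mul0r addr0 expr0.
rewrite exprS; apply: le_trans (ler_wpM2l (le_trans ler01 b1) IH).
rewrite -subr_ge0 (_ : _ - _ = k%:R * (b - 1) ^+ 2); last by rewrite -natr1; ring.
by rewrite mulr_ge0 // sqr_ge0.
Qed.

Section line_estimate.
Context {R : realType}.

(** At height [2^-k f(0)] the separation [h] may be taken of order [2^(-k/m)], as for the monomial
    [t^m]. Hence the ratio [l = 2^(-1/m)], and [b^m < 2] says precisely that [b l < 1], which makes
    a series with terms [(b l)^k] converge. *)
Lemma sublevel_decay (m : nat) (b : R) : 1 <= b -> b ^+ m < 2 ->
  exists C l : R, [/\ 0 <= C, 0 < l, b * l < 1 &
  forall (f : nat -> R -> R) (H : R),
  (forall j (t : R), (j <= m)%N -> 0 <= t <= 2 -> is_derive t 1 (f j) (f j.+1 t)) ->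
  (forall t : R, 0 <= t <= 2 -> `|f m.+1 t| <= H) ->
  (forall t : R, 0 <= t <= 2 -> 0 <= f 0%N t) ->
  2 ^+ m.+2 * H < f 0%N 0 ->
  (forall k, measurable ([set t | f 0%N t < 2^-1 ^+ k * f 0%N 0] `&` `[1, 2]%classic)) ->
  forall k, (lebesgue_measure ([set t | (f 0%N t < 2^-1 ^+ k * f 0%N 0)%R] `&` `[1%R, 2%R])
    <= (C * l ^+ k)%:E)%E].
Proof.
move=> b1; have b0 : 0 < b by lra.
case: m => [|m] bm.
  (* For [m = 0] a single low point is contradictory, so the sublevel sets are null for [k >= 3] and
     any ratio below [1/b] will do. The constant only has to cover [k <= 2], where the measure is at
     most 1. *)
  exists ((2 * b) ^+ 2), (2 * b)^-1; split.
  - by rewrite sqr_ge0.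
  - by rewrite invr_gt0 mulr_gt0.
  - by rewrite invfM mulrCA divff ?gt_eqF // mulr1; lra.
  move=> f H df fH f0 Hf mE k; case: (ltnP k 3) => k3.
    apply: (@le_trans _ _ (lebesgue_measure (`[1, 2]%classic : set R))).
      by apply: le_measure; rewrite ?inE //; exact: mE.
    rewrite lebesgue_measure_itv /= lte_fin ltr1n -EFinB lee_fin.
    rewrite exprVn -[leLHS]/(2 - 1 : R) (_ : 2 - 1 = (1 : R)); last by lra.
    rewrite ler_pdivlMr ?exprn_gt0 ?mulr_gt0 // mul1r ler_weXn2l //; first by lra.
  have H0 : 0 <= H by apply: le_trans (fH 0 _) => //; rewrite lexx ler0n.
  have ff : 0 < f 0%N 0 by apply: le_lt_trans Hf; rewrite mulr_ge0 // exprn_ge0.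
  apply: le_trans (sublevel_measure df fH f0 Hf ltr01 _ (mE k)) _.
    rewrite expr0 mulr1 mulr1 expr2 mulrA gtr_pMl //.
    apply: (@le_lt_trans _ _ (2 * 2 * 2^-1 ^+ 3)).
      by rewrite ler_wpM2l // ler_wiXn2l //; lra.
    by rewrite !exprS expr0; lra.
  by rewrite mul0r lee_fin mulr_ge0 ?sqr_ge0 // exprn_ge0 // invr_ge0 mulr_ge0 // ltW.
pose l : R := 2^-1 `^ (m.+1%:R^-1).
have l0 : 0 < l by apply: powR_gt0; lra.
have lm : l ^+ m.+1 = 2^-1.
  rewrite -powR_mulrn ?powR_ge0 // /l -powRrM mulVf ?pnatr_eq0 // powRr1 //; lra.
(* With [h = c l^k] the factor [2^-k] appears on both sides of the second condition of
   [sublevel_measure]; what remains is that [c] to a positive power exceeds [c / 2]. *)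
pose c : R := 2 * (2 ^+ m.+3 * m.+2%:R).
have c1 : 1 < 2 ^+ m.+3 * m.+2%:R :> R.
  rewrite -[ltLHS]mulr1 -[X in X * _ < _](expr1n _ m.+3); apply: ltr_pM => //.
  - by rewrite ltrXn2r //; lra.
  - by rewrite ltr1n.
have c0 : 0 < c by rewrite /c; lra.
exists (m.+1.*2%:R * c), l; split => //.
- by rewrite mulr_ge0 // ltW.
- rewrite ltNge; apply/negP => bl; have : 1 <= (b * l) ^+ m.+1 by rewrite exprn_ege1.
  by rewrite exprMn lm; lra.
move=> f H df fH f0 Hf mE k.
have H0 : 0 <= H by apply: le_trans (fH 0 _) => //; rewrite lexx ler0n.
have ff : 0 < f 0%N 0 by apply: le_lt_trans Hf; rewrite mulr_ge0 // exprn_ge0.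
have h0 : 0 < c * l ^+ k by rewrite mulr_gt0 // exprn_gt0.
rewrite -mulrA; apply: (sublevel_measure df fH f0 Hf h0 _ (mE k)).
rewrite exprMn -exprM mulnC exprM lm mulrA [ltRHS]mulrC -[ltRHS]mulrA.
rewrite [ltLHS]mulrAC -[ltLHS]mulrA.
have p0 : 0 < 2^-1 ^+ k * f 0%N 0 by rewrite mulr_gt0 // exprn_gt0 // invr_gt0.
rewrite [X in _ < X](_ : _ = c ^+ m.+1 * (2^-1 ^+ k * f 0%N 0)); last by ring.
rewrite [X in X < _](_ : _ = (2 ^+ m.+3 * m.+2%:R) * (2^-1 ^+ k * f 0%N 0)); last by ring.
rewrite ltr_pM2r //; apply: (@lt_le_trans _ _ c); first by rewrite /c; lra.
by apply: ler_eXnr => //; rewrite /c; lra.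
Qed.

(* The first term on the right dominates [g] where [g] is at most
   [A (f/f(0))^(-1/(q-1))], a function whose integral is controlled by the
   measure of the sublevel sets of [f]; elsewhere the second term does. *)
Lemma line_estimate (m : nat) (q : R) : m%:R < q - 1 -> exists2 C : R, 0 <= C &
  forall (f : nat -> R -> R) (H A : R) (g : R -> R),
  (forall j (t : R), (j <= m)%N -> 0 <= t <= 2 -> is_derive t 1 (f j) (f j.+1 t)) ->
  (forall t : R, 0 <= t <= 2 -> `|f m.+1 t| <= H) ->
  (forall t : R, 0 <= t <= 2 -> 0 <= f 0%N t) ->
  2 ^+ m.+2 * H < f 0%N 0 -> 0 < A ->
  measurable_fun (`[1, 2]%classic : set R) g -> (forall t, 0 <= g t) ->
  (\int[lebesgue_measure]_(t in `[1%R, 2%R]) (g t)%:E <= (C * A)%:E +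
   \int[lebesgue_measure]_(t in `[1%R, 2%R])
     ((A `^ (1 - q) / f 0%N 0)%R * (f 0%N t * g t `^ q))%:E)%E.
Proof.
move=> mq; have q1 : 0 < q - 1 by apply: le_lt_trans mq; rewrite ler0n.
(* Halving [f] multiplies [f^(-1/(q-1))] by [b]; the hypothesis [m < q - 1] becomes [b^m < 2]. *)
pose b : R := 2 `^ (q - 1)^-1.
have b0 : 0 < b by rewrite powR_gt0.
have bq : b `^ (q - 1) = 2 by rewrite /b -powRrM mulVf ?gt_eqF // powRr1.
have b1 : 1 < b.
  rewrite ltNge; apply/negP => b1.
  have : b `^ (q - 1) <= 1 `^ (q - 1) by rewrite ge0_ler_powR ?nnegrE ?ler01 ?(ltW q1) ?(ltW b0).
  by rewrite bq powR1; lra.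
have bm : b ^+ m < 2.
  have q2 : 0 < q - 1 - m%:R by lra.
  have h : 1 `^ (q - 1 - m%:R) < b `^ (q - 1 - m%:R) by rewrite gt0_ltr_powR ?nnegrE ?ler01 ?(ltW b0).
  rewrite -bq (_ : q - 1 = m%:R + (q - 1 - m%:R)); last by lra.
  rewrite powRD; last by rewrite (gt_eqF b0) implybT.
  by rewrite powR_mulrn ?(ltW b0) // ltr_pMr ?exprn_gt0 //; move: h; rewrite powR1.
have [C [l [C0 l0 bl hC]]] := sublevel_decay (ltW b1) bm.
(* The length of [[1, 2]] plus the geometric series of the terms [b^(k+1) * C l^k]. *)
exists (1 + C * b / (1 - b * l)).
  by rewrite addr_ge0 // divr_ge0 ?mulr_ge0 ?(ltW b0) // subr_ge0 ltW.
move=> f H A g df fH f0 Hf A0 mg g0.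
have H0 : 0 <= H by apply: le_trans (fH 0 _) => //; rewrite lexx ler0n.
have ff : 0 < f 0%N 0 by apply: le_lt_trans Hf; rewrite mulr_ge0 // exprn_ge0.
have mf : measurable_fun (`[1, 2]%classic : set R) (f 0%N).
  apply: subspace_continuous_measurable_fun => //.
  apply: derivable_within_continuous => t; rewrite in_itv /= => /andP[t1 t2].
  by have [||//] := df 0%N t; rewrite // t2 (le_trans ler01 t1).
pose E k : set R := [set t | f 0%N t < 2^-1 ^+ k * f 0%N 0] `&` `[1, 2]%classic.
have mE k : measurable (E k).
  rewrite /E setIC; apply: (mf _ [set x | x < 2^-1 ^+ k * f 0%N 0]) => //.
  by rewrite -set_itvNyo; exact: measurable_itv.
have EC := hC f H df fH f0 Hf mE.
(* A layered majorant of [A (f/f(0))^(-1/(q-1))]: where [f] lies between [2^-(k+1) f(0)] and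
   [2^-k f(0)] this function is at most [A b^(k+1)], and the [k]-th term supplies that much. *)
pose h t : \bar R := (A%:E * (1 + \sum_(0 <= k <oo) (b ^+ k.+1 * \1_(E k) t)%:E))%E.
have t0 k t : (0 <= (b ^+ k.+1 * \1_(E k) t)%:E)%E.
  by rewrite lee_fin mulr_ge0 // exprn_ge0 // ltW.
have s0 t : (0 <= \sum_(0 <= k <oo) (b ^+ k.+1 * \1_(E k) t)%:E)%E.
  by apply: nneseries_ge0 => k _ _; exact: t0.
have mt k : measurable_fun setT (fun t => (b ^+ k.+1 * \1_(E k) t)%:E).
  by apply/measurable_EFinP; apply: measurable_funM => //; exact: measurable_indic.
have ms : measurable_fun (`[1%R, 2%R]%classic : set R) (fun t => \sum_(0 <= k <oo) (b ^+ k.+1 * \1_(E k) t)%:E)%E.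
  apply: ge0_emeasurable_sum => k //.
    by move=> _; apply: measurable_funTS; exact: mt.
have inth : (\int[lebesgue_measure]_(t in `[1%R, 2%R]) h t <= ((1 + C * b / (1 - b * l)) * A)%:E)%E.
  rewrite ge0_integralZl //; last 3 first.
  - by apply: emeasurable_funD => //; exact: measurable_cst.
  - by move=> t _; rewrite adde_ge0.
  - by rewrite lee_fin ltW.
  rewrite mulrC EFinM lee_wpmul2l // ?lee_fin ?(ltW A0) //.
  rewrite ge0_integralD //.
  rewrite EFinD; apply: leeD.
    apply: (@le_trans _ _ (lebesgue_measure (`[1%R, 2%R]%classic : set R))).
      by rewrite integral_cst // mul1e.
    rewrite lebesgue_measure_itv /= lte_fin ltr1n -EFinB lee_fin; lra.
  rewrite integral_nneseries //; last first.
    by move=> k; apply: measurable_funTS; exact: mt.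
  apply: lime_le; first by apply: is_cvg_nneseries => k _ _; apply: integral_ge0.
  apply: nearW => N; apply: (@le_trans _ _ (\sum_(0 <= k < N) ((C * b) * (b * l) ^+ k)%:E)%E).
    apply: lee_sum => k _; under eq_integral do rewrite EFinM.
    rewrite ge0_integralZl //; last 2 first.
    - by apply/measurable_EFinP; apply: measurable_indic; exact: mE.
    - by rewrite lee_fin exprn_ge0 // ltW.
    apply: (@le_trans _ _ ((b ^+ k.+1)%:E * (C * l ^+ k)%:E)%E).
      rewrite lee_wpmul2l ?lee_fin ?exprn_ge0 ?(ltW b0) //.
      apply: (@le_trans _ _ (lebesgue_measure (E k `&` (`[1%R, 2%R]%classic : set R)))).
        by rewrite le_eqVlt integral_indic ?eqxx //; exact: mE.
      apply: le_trans (EC k).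
      by apply: le_measure; rewrite ?inE //; [apply: measurableI => //; exact: mE|exact: mE].
    by rewrite -EFinM lee_fin exprS exprMn; apply: le_of_eq; ring.
  rewrite sumEFin lee_fin -mulr_sumr ler_wpM2l ?mulr_ge0 ?(ltW b0) //.
  rewrite -[leRHS]mul1r ler_pdivlMr ?subr_gt0 // big_mkord mulrC.
  have -> : (1 - b * l) * \sum_(i < N) (b * l) ^+ i = 1 - (b * l) ^+ N.
    by rewrite -[X in _ = X - _](expr1n _ N) subrXX; congr (_ * _); apply: eq_bigr => i _; rewrite expr1n mul1r.
  by rewrite gerBl exprn_ge0 // mulr_ge0 // ltW.
pose X t : R := (A `^ (1 - q) / f 0%N 0) * (f 0%N t * g t `^ q).
have X0 t : `[1, 2]%classic t -> 0 <= X t.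
  rewrite /= in_itv /= => /andP[h1 h2]; rewrite /X mulr_ge0 ?divr_ge0 ?powR_ge0 ?(ltW ff) //.
  by rewrite mulr_ge0 ?powR_ge0 // f0 // h2 (le_trans ler01 h1).
have mX : measurable_fun (`[1, 2]%classic : set R) X.
  apply: measurable_funM; first exact: measurable_cst.
  apply: measurable_funM => //.
  by apply: (measurableT_comp (measurable_powR q)).
have h0 t : (0 <= h t)%E by rewrite mule_ge0 ?lee_fin ?(ltW A0) // adde_ge0.
have mh : measurable_fun (`[1, 2]%classic : set R) h.
  apply: measurable_funeM; apply: emeasurable_funD => //; exact: measurable_cst.
(* [X t] is [g t] times [g(t)^(q-1) A^(1-q) f(t)/f(0)], and this factor exceeds 1 once [g t] is
   above the threshold [B]. *)
have key B t : 0 < B -> B < g t -> 1 <= B `^ (q - 1) * (A `^ (1 - q) / f 0%N 0 * f 0%N t) ->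
    g t <= X t.
  move=> B0 Bg hB; have gt0 : 0 < g t by exact: lt_trans Bg.
  have -> : X t = (g t `^ (q - 1) * (A `^ (1 - q) / f 0%N 0 * f 0%N t)) * g t.
    rewrite /X [in g t `^ q](_ : q = (q - 1) + 1); last by rewrite subrK.
    rewrite powRD; last by rewrite (gt_eqF gt0) implybT.
    by rewrite powRr1 ?(ltW gt0) //; ring.
  rewrite ler_peMl ?(ltW gt0) //; apply: (le_trans hB).
  have p0 : 0 <= A `^ (1 - q) / f 0%N 0 * f 0%N t.
    rewrite leNgt; apply/negP => n0; move: hB; rewrite leNgt => /negP; apply.
    apply: le_lt_trans ltr01; rewrite mulr_ge0_le0 ?powR_ge0 // ltW //.
  by rewrite ler_wpM2r // ge0_ler_powR ?nnegrE ?(ltW q1) ?(ltW B0) ?(ltW gt0) // ltW.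
have Aq : A `^ (q - 1) * A `^ (1 - q) = 1.
  by rewrite -powRD ?(gt_eqF A0) ?implybT // -[1 - q]opprB subrr powRr0.
apply: (@le_trans _ _ (\int[lebesgue_measure]_(t in `[1%R, 2%R]) (h t + (X t)%:E))%E); last first.
  rewrite ge0_integralD //; last exact/measurable_EFinP.
  by rewrite leeD2r.
apply: ge0_le_integral => //.
- by move=> t _; rewrite lee_fin.
- exact/measurable_EFinP.
- by apply: emeasurable_funD => //; exact/measurable_EFinP.
move=> t t12; have [gX|Xg] := leP (g t) (X t).
  by apply: (@le_trans _ _ (X t)%:E); rewrite ?lee_fin // leeDr.
apply: (@le_trans _ _ (h t)); last by rewrite leeDl // lee_fin X0.
have hA : (A%:E <= h t)%E by rewrite -[leLHS]mule1 lee_wpmul2l ?lee_fin ?(ltW A0) // leeDl.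
have hE k : E k t -> ((A * b ^+ k.+1)%:E <= h t)%E.
  move=> Ek; rewrite EFinM lee_wpmul2l ?lee_fin ?(ltW A0) //.
  apply: (@le_trans _ _ (\sum_(0 <= j < k.+1) (b ^+ j.+1 * \1_(E j) t)%:E)%E).
    rewrite big_nat_recr //= indicE mem_set // mulr1 leeDr //.
    by apply: sume_ge0 => j _; exact: t0.
  apply: le_trans (nneseries_lim_ge _ _) _; first by move=> j _ _; exact: t0.
  by rewrite leeDr.
have [gA|Ag] := leP (g t) A; first by apply: le_trans hA; rewrite lee_fin.
(* At a zero of [f] the point lies in every [E k], so [h t] exceeds [A b^(k+1)] for all [k];
   Bernoulli's inequality provides a [k] for which this is at least [g t]. *)
have [ft0|ft0] := leP (f 0%N t) 0.
  pose k := Num.truncn (g t / (A * (b - 1))).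
  apply: le_trans (hE k _); last first.
    split => //=; apply: le_lt_trans ft0 _; rewrite mulr_gt0 // exprn_gt0 //.
  rewrite lee_fin -ler_pdivrMl //.
  apply: (@le_trans _ _ (1 + k.+1%:R * (b - 1))).
    have := truncnS_gt (g t / (A * (b - 1))); rewrite -/k invfM mulrA ltr_pdivrMr ?subr_gt0 //.
    by rewrite [_ / A]mulrC => /ltW/le_trans; apply; rewrite lerDr.
  by apply: bernoulli; exact: ltW.
have [k hk] : exists k, 2^-1 ^+ k.+1 * f 0%N 0 <= f 0%N t.
  pose k := Num.truncn (f 0%N 0 / f 0%N t); exists k.
  have := truncnS_gt (f 0%N 0 / f 0%N t); rewrite -/k ltr_pdivrMr // => hk.
  rewrite exprVn ler_pdivrMl ?exprn_gt0 //; apply: (le_trans (ltW hk)).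
  by rewrite ler_wpM2r ?(ltW ft0) // -natrX ler_nat ltnW // ltn_expl.
have [f01|f01] := leP (f 0%N 0) (f 0%N t).
  exfalso; move: Xg; apply/negP; rewrite -leNgt; apply: (key A t A0 Ag).
  by rewrite !mulrA Aq mul1r mulrC ler_pdivlMr // mul1r.
(* Minimality places [t] in the layer of index [k0]: [f t] is at least [2^-(k0+1) f(0)] and below
   [2^-k0 f(0)]. *)
have [k0 hk0 mink] := ex_minnP (ex_intro (fun k => 2^-1 ^+ k.+1 * f 0%N 0 <= f 0%N t) k hk).
have Ek0 : E k0 t.
  split => //=; case: k0 hk0 mink => [|k0] hk0 mink; first by rewrite expr0 mul1r.
  by rewrite ltNge; apply/negP => /mink; rewrite ltnn.
have [gB|Bg] := leP (g t) (A * b ^+ k0.+1); first by apply: le_trans (hE _ Ek0); rewrite lee_fin.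
exfalso; move: Xg; apply/negP; rewrite -leNgt.
apply: (key (A * b ^+ k0.+1) t _ Bg); first by rewrite mulr_gt0 // exprn_gt0.
rewrite powRM ?(ltW A0) ?exprn_ge0 ?(ltW b0) //.
rewrite -(powR_mulrn _ (ltW b0)) -powRrM [_ * (q - 1)]mulrC powRrM bq powR_mulrn //.
rewrite [leRHS](_ : _ = (A `^ (q - 1) * A `^ (1 - q)) * (2 ^+ k0.+1 * f 0%N t / f 0%N 0)); last by ring.
rewrite Aq mul1r ler_pdivlMr // mul1r -ler_pdivrMl ?exprn_gt0 // -exprVn //.
Qed.

End line_estimate.

(** * The cone condition *)

Section cone_condition.
Context {R : realType} {n : nat}.
Implicit Types (Omega U : set 'rV[R]_n) (x y z : 'rV[R]_n).

Lemma mx_ballP x y (e : R) : ball x e y <-> `|x - y| < e.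
Proof. by rewrite mx_norm_ball. Qed.

Lemma closure_mx_approx (A : set 'rV[R]_n) y (e : R) : closure A y -> 0 < e ->
  exists2 y', A y' & `|y - y'| < e.
Proof.
move=> cy e0; have [y' [Ay' By']] := cy _ (nbhsx_ballx y e e0).
by exists y' => //; exact/mx_ballP.
Qed.

(* Near [x0], the truncated cone [{t w : |w - v| <= eta, 0 < t <= tau}] attached to
   any point of the closure of [Omega] stays inside [Omega]. *)
Definition cone_at Omega x0 (d : R) (v : 'rV[R]_n) (eta tau : R) :=
  forall y w t, closure Omega y -> `|y - x0| <= d -> `|w - v| <= eta ->
    0 < t <= tau -> Omega (y + t *: w).

Lemma cone_at_of_interior Omega x0 d v eta tau : 0 < d -> 0 < eta ->
  (forall y w t, Omega y -> `|y - x0| < d -> `|w - v| < eta ->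
    0 < t <= tau -> Omega (y + t *: w)) ->
  cone_at Omega x0 (d / 2) v (eta / 2) tau.
Proof.
move=> d0 e0 h y w t cy yx wv /andP[t0 tt].
have m0 : 0 < Num.min (d / 2) (t * (eta / 2)) by rewrite lt_min !(divr_gt0, mulr_gt0).
have [y' Oy'] := closure_mx_approx cy m0; rewrite lt_min => /andP[yd yt].
have -> : y + t *: w = y' + t *: (w + t^-1 *: (y - y')).
  by rewrite scalerDr scalerA divff ?gt_eqF // scale1r addrCA [y' + _]addrC subrK addrC.
apply: h => //; last by rewrite t0.
- rewrite (_ : y' - x0 = - (y - y') + (y - x0)); last by rewrite opprB addrA subrK.
  apply: le_lt_trans (ler_normD _ _) _; rewrite normrN.
  by rewrite [ltRHS]splitr ltr_leD.
- rewrite addrAC; apply: le_lt_trans (ler_normD _ _) _.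
  rewrite [ltRHS]splitr; apply: ler_ltD => //.
  by rewrite normrZ gtr0_norm ?invr_gt0 // ltr_pdivrMl.
Qed.

Lemma compact_neighborhood Omega U : compact (closure Omega) -> closure Omega `<=` U -> open U ->
  exists2 d : R, 0 < d & forall y z, closure Omega y -> `|z| <= d -> U (y + z).
Proof.
move=> /compact_near_coveringP cO OU oU.
have H := cO R (0 : R)^'+ (fun d y => forall z, `|z| <= d -> U (y + z)) _.
have : \forall d \near (0 : R)^'+, closure Omega `<=` (fun y => forall z, `|z| <= d -> U (y + z)).
  apply: H => x /OU Ux.
  have /nbhs_ballP[e /= e0 eU] : nbhs x U by exact: open_nbhs_nbhs.
  exists (ball x (e / 2), [set d | d <= e / 2]); first split => /=.
  - by apply: nbhsx_ballx; rewrite divr_gt0.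
  - by apply: nbhs_right_le; rewrite divr_gt0.
  move=> [y d] /= [/mx_ballP xy de] z zd; apply: eU; apply/mx_ballP.
  rewrite opprD addrA; apply: le_lt_trans (ler_normB _ _) _.
  by rewrite [ltRHS]splitr; apply: ltr_leD => //; exact: le_trans de.
move=> h; near (0 : R)^'+ => d.
have d0 : 0 < d by [].
have hd : closure Omega `<=` (fun y => forall z, `|z| <= d -> U (y + z)) by near: d.
by exists d => // y z cy; exact: hd.
Unshelve. all: end_near. Qed.

End cone_condition.

Section lipschitz_domain.
Context {R : realType} {n : nat}.
Implicit Types (Omega U : set 'rV[R]_n.+1) (x y z : 'rV[R]_n.+1).

Lemma norm_mulmx_le (Q : 'M[R]_n.+1) : exists2 C : R, 0 < C &
  forall x, `|x *m Q| <= C * `|x|.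
Proof.
exists (1 + \sum_i \sum_j `|Q i j|).
  by rewrite ltr_pwDl // sumr_ge0 // => i _; rewrite sumr_ge0.
move=> x; apply: norm_le_coord => [|j].
  by rewrite mulr_ge0 // addr_ge0 // sumr_ge0 // => i _; rewrite sumr_ge0.
rewrite !mxE; apply: le_trans (ler_norm_sum _ _ _) _.
apply: (@le_trans _ _ (\sum_i `|Q i j| * `|x|)).
  by apply: ler_sum => i _; rewrite normrM mulrC ler_wpM2l // coord_le_norm.
rewrite -mulr_suml ler_wpM2r //.
apply: (@le_trans _ _ (\sum_i \sum_j `|Q i j|)); last by rewrite lerDr.
apply: ler_sum => i _; rewrite (bigD1 j) //= lerDl; exact: sumr_ge0.
Qed.

(** Above a Lipschitz graph, a steep enough cone around the vertical direction stays above the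
    graph; the axis is the vertical unit vector carried back by the isometry. *)
Lemma lipschitz_cone Omega x0 : bounded_lipschitz_domain Omega -> closure Omega x0 ->
  exists (d : R) v (eta tau : R), [/\ 0 < d, 0 < eta, 0 < tau & cone_at Omega x0 d v eta tau].
Proof.
move=> [oO _ _ _ lO] cx0; have [Ox0|nOx0] := pselect (interior Omega x0).
  have /nbhs_ballP[e /= e0 eO] := Ox0.
  (* At an interior point the axis is 0 and the truncated cone is a full ball. *)
  exists (e / 2 / 2), 0, (1 / 2), (e / 2); split; rewrite ?divr_gt0 //.
  apply: cone_at_of_interior; rewrite ?divr_gt0 // => y w t _ yx; rewrite subr0 => w1 /andP[t0 te].
  apply: eO; apply/mx_ballP; rewrite opprD addrA; apply: le_lt_trans (ler_normB _ _) _.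
  rewrite [ltRHS]splitr distrC; apply: ltr_leD => //.
  rewrite normrZ gtr0_norm //; apply: le_trans te.
  by rewrite ler_piMr ?(ltW t0) ?(ltW w1).
have [Q [gamma [QQ [L0 [_ hL]] /nbhs_ballP[e /= e0 he]]]] := lO x0 (conj cx0 nOx0).
pose L := `|L0| + 1; have Lp : 0 < L by rewrite ltr_pwDr.
have {}hL (u w : 'rV[R]_n) : `|gamma u - gamma w| <= L * `|u - w|.
  by apply: (hL L _ (u, w)) => //; rewrite /L; have := ler_norm L0; lra.
have QTQ : Q^T *m Q = 1%:M by exact: mulmx1C.
have [C C0 hC] := norm_mulmx_le Q.
pose v : 'rV[R]_n.+1 := delta_mx ord0 ord0 *m Q^T.
have vQ : v *m Q = delta_mx ord0 ord0 by rewrite /v -mulmxA QTQ mulmx1.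
(* After applying [Q], such directions differ from the vertical unit vector by at most
   [k = 1 / (2 (L + 1))] in each coordinate. A step [t] then rises by at least [t (1 - k)], the
   graph by at most [L t k], and [(L + 1) k = 1/2 < 1]. The factor [C] is present because [Q] need
   not preserve the sup norm. *)
pose eta := (C * (2 * (L + 1)))^-1.
have eta0 : 0 < eta by rewrite invr_gt0 !mulr_gt0 // addr_gt0.
pose tau := e / 2 / (`|v| + eta).
have ve : 0 < `|v| + eta by rewrite ltr_wpDl.
exists (e / 2 / 2), v, (eta / 2), tau; split; rewrite ?divr_gt0 //.
apply: cone_at_of_interior; rewrite ?divr_gt0 // => y w t Oy yx wv /andP[t0 tt].
have yB : ball x0 e y by apply/mx_ballP; rewrite distrC; apply: lt_trans yx _; lra.
have wB : `|w| <= `|v| + eta.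
  rewrite -[w](subrK v) addrC; apply: le_trans (ler_normD _ _) _.
  by rewrite lerD2l ltW.
have ywB : ball x0 e (y + t *: w).
  apply/mx_ballP; rewrite opprD addrA; apply: le_lt_trans (ler_normB _ _) _.
  rewrite [ltRHS]splitr distrC; apply: ltr_leD => //.
  rewrite normrZ gtr0_norm //; apply: (@le_trans _ _ (tau * (`|v| + eta))).
    by apply: ler_pM => //; exact: ltW.
  by rewrite /tau divfK // gt_eqF.
apply/(he _ ywB); have := (he _ yB).1 Oy.
set u := \row_j _; set u' := \row_j _ => gu.
have wQ : w *m Q = delta_mx ord0 ord0 + (w - v) *m Q.
  by rewrite mulmxBl vQ addrCA subrr addr0.
have small i : `|((w - v) *m Q) ord0 i| <= (2 * (L + 1))^-1.
  apply: le_trans (coord_le_norm _ _) _; apply: le_trans (hC _) _.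
  apply: (@le_trans _ _ (C * eta)); first by rewrite ler_wpM2l ?(ltW C0) ?(ltW wv).
  by rewrite /eta invfM mulrA divff ?gt_eqF // mul1r.
have k0 : 0 < (2 * (L + 1))^-1 by rewrite invr_gt0 mulr_gt0 // addr_gt0.
have ywE k : ((y + t *: w) *m Q) ord0 k =
    (y *m Q) ord0 k + t * ((k == ord0)%:R + ((w - v) *m Q) ord0 k).
  rewrite mulmxDl -scalemxAl wQ; move: (y *m Q) ((w - v) *m Q) => A B.
  by rewrite !mxE eqxx.
have uu : `|u' - u| <= t * (2 * (L + 1))^-1.
  apply: norm_le_coord => [|j]; first by rewrite mulr_ge0 ?ltW.
  have -> : (u' - u) ord0 j = t * ((w - v) *m Q) ord0 (lift ord0 j).
    rewrite /u' /u; under eq_mx do rewrite ywE.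
    by move: (y *m Q) ((w - v) *m Q) => A B; rewrite !mxE /= add0r addrAC subrr add0r.
  by rewrite normrM gtr0_norm // ler_wpM2l ?(ltW t0).
have v0 : ((y + t *: w) *m Q) ord0 ord0 = (y *m Q) ord0 ord0 + t * (1 + ((w - v) *m Q) ord0 ord0).
  exact: ywE.
rewrite v0; have gg := le_trans (hL u' u) (ler_wpM2l (ltW Lp) uu).
have := small ord0; rewrite ler_norml => /andP[s0 _].
have := ler_norm (gamma u' - gamma u).
have : L * (t * (2 * (L + 1))^-1) < t * (1 - (2 * (L + 1))^-1).
  rewrite mulrCA ltr_pM2l // ltrBrDr -[X in _ + X]mul1r -mulrDl invfM mulrCA divff ?mulr1; last by rewrite gt_eqF // addr_gt0.
  by lra.
have : t * (1 - (2 * (L + 1))^-1) <= t * (1 + ((w - v) *m Q) ord0 ord0).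
  by rewrite ler_wpM2l ?(ltW t0) // lerD2l.
move: gu gg; set a1 := t * _; set a2 := t * (1 - _); set a3 := L * _; lra.
Qed.

End lipschitz_domain.

Section plateau_balls.
Context {R : realType} {n : nat}.
Implicit Types (x c : 'rV[R]_n).

Lemma compact_norm_ball (v : 'rV[R]_n) (eta : R) : 0 <= eta -> compact [set w : 'rV[R]_n | `|w - v| <= eta].
Proof.
move=> eta0; rewrite (_ : mkset _ = [set w : 'rV[R]_n | forall i, `[v ord0 i - eta, v ord0 i + eta]%classic (w ord0 i)]).
  exact: (@closed_box_compact _ _ (fun i => v ord0 i - eta) (fun i => v ord0 i + eta)).
apply/seteqP; split => w /=.
  by move=> wv i; rewrite in_itv /= -ler_distlC distrC; have := le_trans (coord_le_norm (w - v) i) wv; rewrite !mxE.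
by move=> h; apply: norm_le_coord => // i; have := h i; rewrite in_itv /= -ler_distlC distrC !mxE.
Qed.

Lemma partial_plateau1 c (d : R) x i : 0 < d -> `|x - c| < d -> partial i (plateau c d) x = 0.
Proof.
move=> d0 xc; rewrite /partial (@near_eq_derive _ _ _ (plateau c d) (cst 1)) ?derive_cst //.
have : nbhs x (ball c d).
  apply: open_nbhs_nbhs; split; first exact: ball_open.
  by apply/mx_ballP; rewrite distrC.
by apply: filterS => y /mx_ballP cy; rewrite /= plateau1 // distrC ltW.
Qed.

Lemma test_plateau c (d : R) : 0 < d -> test_functions setT (plateau c d).
Proof.
move=> d0; have d20 : 0 <= 2 * d by rewrite mulr_ge0 // ltW.
have out (x : 'rV[R]_n) : ~ [set w : 'rV[R]_n | `|w - c| <= 2 * d] x -> plateau c d x = 0.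
  by move=> /negP; rewrite -ltNge => /ltW; exact: plateau0.
exact: (test_of_compact (smooth_plateau c d) (compact_norm_ball d20) (@subsetT _ _) out).
Qed.

End plateau_balls.

(** * Averages over directions and scales *)

Section real_integrable.
Context {R : realType} d {T : measurableType d}.
Variables (m : {measure set T -> \bar R}) (D : set T).
Hypothesis mD : measurable D.
Implicit Types f g : T -> R.

Lemma rintegrableD f g : m.-integrable D (EFin \o f) -> m.-integrable D (EFin \o g) ->
  m.-integrable D (EFin \o (fun t => f t + g t)).
Proof. by move=> jf jg; apply: (integrableD mD jf jg). Qed.

Lemma rintegrableB f g : m.-integrable D (EFin \o f) -> m.-integrable D (EFin \o g) ->
  m.-integrable D (EFin \o (fun t => f t - g t)).
Proof. by move=> jf jg; apply: (integrableB mD jf jg). Qed.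

Lemma rintegrableZ k f : m.-integrable D (EFin \o f) ->
  m.-integrable D (EFin \o (fun t => k * f t)).
Proof. by move=> jf; apply: (integrableZl mD k jf). Qed.

Lemma rintegrable_norm f : m.-integrable D (EFin \o f) ->
  m.-integrable D (EFin \o (fun t => `|f t|)).
Proof. by move=> jf; apply: (integrable_norm jf). Qed.

Lemma rintegrable_measurable f : m.-integrable D (EFin \o f) -> measurable_fun D f.
Proof. by move=> /integrableP[/measurable_EFinP]. Qed.

Lemma rintegrable_mul_bounded f g (M : R) : m.-integrable D (EFin \o f) ->
  measurable_fun D g -> (forall t, D t -> `|g t| <= M) ->
  m.-integrable D (EFin \o (fun t => f t * g t)).
Proof.
move=> jf mg hM; have mf := rintegrable_measurable jf.
apply: (le_integrable mD _ _ (rintegrableZ M jf)).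
  by apply/measurable_EFinP; exact: measurable_funM.
move=> t Dt /=; rewrite lee_fin !normrM mulrC ler_wpM2r //.
by apply: le_trans (hM t Dt) _; exact: ler_norm.
Qed.

Lemma rintegrable_sum (I : finType) (F : I -> T -> R) :
  (forall i, m.-integrable D (EFin \o F i)) ->
  m.-integrable D (EFin \o (fun t => \sum_i F i t)).
Proof.
move=> jF; elim: index_enum => [|i s IH].
  by under eq_fun do rewrite big_nil; exact: integrable0.
by under eq_fun do rewrite big_cons; exact: rintegrableD.
Qed.

End real_integrable.

Section superposition.
Context {R : realType} {n : nat} d {T : measurableType d}.
Variable m : {measure set T -> \bar R}.
Implicit Types (g : 'rV[R]_n -> R) (x : 'rV[R]_n) (c al : T -> R) (y : T -> 'rV[R]_n).

Notation e_ i := (delta_mx (ord0 : 'I_1) (i : 'I_n) : 'rV[R]_n).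

(** One form for two uses: [al] the dilation and [g] the kernel when the kernel is differentiated,
    [al = -1] and [g] a test function when the averaged function is. The weight [c] is merely
    integrable, and a derivative multiplies it by [- al] while it replaces [g] by a partial
    derivative, so the form is stable. *)
Definition superposition al y c g x : R :=
  (\int[m]_t (c t * g (al t *: (y t - x))))%R.

Variables (al : T -> R) (y : T -> 'rV[R]_n) (K : R).
Hypothesis mal : measurable_fun setT al.
Hypothesis my : measurable_fun setT y.
Hypothesis alK : forall t, `|al t| <= K.

Lemma measurable_superposed g x : measurable_fun setT g ->
  measurable_fun setT (fun t => g (al t *: (y t - x))).
Proof.
move=> mg; apply: (measurableT_comp mg); apply: measurable_rVP => i.
under eq_fun do rewrite !mxE.
apply: measurable_funM => //; apply: measurable_funD; last exact: measurable_cst.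
exact: (measurableT_comp (measurable_coord i) my).
Qed.

Lemma superposed_integrable c g x M : m.-integrable setT (EFin \o c) ->
  measurable_fun setT g -> (forall x, `|g x| <= M) ->
  m.-integrable setT (EFin \o (fun t => c t * g (al t *: (y t - x)))).
Proof.
move=> ic mg gM; apply: (@rintegrable_mul_bounded _ _ _ _ _ measurableT _ _ M) => //.
exact: measurable_superposed.
Qed.

Let integrable_al_mul c : m.-integrable setT (EFin \o c) ->
  m.-integrable setT (EFin \o (fun t => - al t * c t)).
Proof.
move=> ic; under eq_fun do rewrite mulrC.
apply: (@rintegrable_mul_bounded _ _ _ _ _ measurableT _ _ K) => //; first exact: measurable_funN.
by move=> t _; rewrite normrN.
Qed.

Lemma superposition_continuous c g : m.-integrable setT (EFin \o c) ->
  test_functions setT g -> continuous (superposition al y c g).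
Proof.
move=> ic tg x.
have sg := test_smooth tg; have mg := smooth_measurable sg.
have [M M0 gM] := test_bounded tg; have [M' M'0 gM'] := test_partial_bounded tg.
pose C := M' * K * (\int[m]_t `|c t|)%R * n%:R.
have K0 : 0 <= K.
  have [[t _]|/forallNP nT] := pselect (exists t : T, True); first exact: le_trans (alK t).
  by exfalso; exact: (nT point).
have C0 : 0 <= C by rewrite !mulr_ge0 ?(ltW M'0) // Rintegral_ge0.
have L z : `|superposition al y c g z - superposition al y c g x| <= C * `|z - x|.
  rewrite /superposition -RintegralB //; [|exact: superposed_integrable..].
  apply: le_trans (le_normr_Rintegral _ _) _ => //.
    by apply: rintegrableB => //; exact: superposed_integrable.
  apply: (@le_trans _ _ (\int[m]_t ((M' * K * (n%:R * `|z - x|)) * `|c t|))%R).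
    apply: le_Rintegral => //.
    - by apply: rintegrable_norm; apply: rintegrableB => //; exact: superposed_integrable.
    - by apply: rintegrableZ => //; exact: rintegrable_norm.
    move=> t _; rewrite -mulrBr normrM mulrC ler_wpM2r //.
    rewrite (_ : al t *: (y t - z) = al t *: (y t - x) + al t *: (x - z)); last first.
      by rewrite -scalerDr addrA subrK.
    apply: le_trans (smooth_lipschitz _ _ sg gM') _; rewrite -mulrA ler_wpM2l ?(ltW M'0) //.
    apply: (@le_trans _ _ (\sum_(i < n) (K * `|z - x|))).
      apply: ler_sum => i _; rewrite mxE normrM; apply: ler_pM => //.
      by rewrite distrC; exact: coord_le_norm.
    by rewrite sumr_const card_ord mulr_natl mulrnAr.
  rewrite RintegralZl //; last exact: rintegrable_norm.
  by rewrite /C; apply: le_of_eq; ring.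
have C1 : 0 < C + 1 by rewrite ltr_wpDl.
move=> A /nbhs_ballP[e /= e0 eA]; apply/nbhs_ballP; exists (e / (C + 1)) => /=.
  by rewrite divr_gt0.
move=> z /mx_ballP xz; apply: eA; rewrite /ball /= distrC; apply: le_lt_trans (L z) _.
apply: (@le_lt_trans _ _ ((C + 1) * `|z - x|)); first by rewrite ler_wpM2r // lerDl.
by rewrite mulrC -ltr_pdivlMr // distrC.
Qed.

Lemma is_derive_superposition c g x i : m.-integrable setT (EFin \o c) ->
  test_functions setT g ->
  is_derive x (e_ i) (superposition al y c g)
    (superposition al y (fun t => - al t * c t) (partial i g) x).
Proof.
move=> ic tg.
have sg := test_smooth tg; have mg := smooth_measurable sg.
have [M M0 gM] := test_bounded tg; have [M' M'0 gM'] := test_partial_bounded tg.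
pose f (s : R) t := c t * g (al t *: (y t - (x + s *: e_ i))).
have D (s : R) t : is_derive s 1 (f^~ t) (- al t * c t * partial i g (al t *: (y t - (x + s *: e_ i)))).
  have E : f^~ t = (fun s => c t * g (al t *: (y t - x) + s *: (- al t *: e_ i))).
    apply/funext => s'; rewrite /f; congr (_ * g _).
    by rewrite opprD addrA scalerDr scalerN !scalerA mulrN -scaleNr mulrC.
  have -> : al t *: (y t - (x + s *: e_ i)) = al t *: (y t - x) + s *: (- al t *: e_ i).
    by rewrite opprD addrA scalerDr scalerN !scalerA mulrN -scaleNr mulrC.
  rewrite E mulrAC; set p := _ + s *: _.
  have h := (is_derive_line g (al t *: (y t - x)) (- al t *: e_ i) s _).1
    (@is_derive_partial R n g p i (- al t) (@smooth_derivable R n g p i sg)).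
  have h2 := is_deriveM (@is_derive_cst _ _ _ (c t) s 1) h.
  apply: (is_derive_eq h2); rewrite scaler0 addr0 /GRing.scale /= -/p; ring.
pose G t := `|K * M'| * `|c t|.
have I0 : (`]-1, 1[%classic : set R) 0 by rewrite /= in_itv /= ltrN10 ltr01.
have fint (s : R) : `]-1, 1[%classic s -> m.-integrable setT (EFin \o f s).
  by move=> _; exact: superposed_integrable.
have fder (s : R) t : `]-1, 1[%classic s -> setT t -> derivable (f^~ t) s 1.
  by move=> _ _; have [] := D s t.
have G0 t : 0 <= G t by rewrite mulr_ge0.
have intG : m.-integrable setT (EFin \o G).
  by apply: rintegrableZ => //; exact: rintegrable_norm.
have Gub (s : R) t : `]-1, 1[%classic s -> setT t -> `|lebesgue_integral_under.partial1of2 f s t| <= G t.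
  move=> _ _; rewrite /lebesgue_integral_under.partial1of2 derive1E.
  have [_ ->] := D s t; rewrite /G !normrM normrN mulrAC ler_wpM2r // ler_pM //.
  - by apply: le_trans (alK t) _; exact: ler_norm.
  - by apply: le_trans (gM' i _) _; exact: ler_norm.
have := derivable_under_integral measurableT I0 fint fder G0 intG Gub.
have := differentiation_under_integral measurableT I0 fint fder G0 intG Gub.
rewrite derive1E => e1 d1.
have : is_derive (0 : R) 1 (fun s => superposition al y c g (x + s *: e_ i))
   (superposition al y (fun t => - al t * c t) (partial i g) x).
  apply: DeriveDef; first exact: d1.
  rewrite [LHS]e1 /superposition; apply: eq_Rintegral => t _.
  rewrite /lebesgue_integral_under.partial1of2 derive1E; have [_ ->] := D 0 t.
  by rewrite scale0r addr0.
by move/(is_derive_line (superposition al y c g) x (e_ i) 0 _).2; rewrite scale0r addr0.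
Qed.

Lemma superposition_smooth c g : m.-integrable setT (EFin \o c) ->
  test_functions setT g -> smooth_on setT (superposition al y c g).
Proof.
move=> ic tg; pose P (f : 'rV[R]_n -> R) := exists c g,
  [/\ m.-integrable setT (EFin \o c), test_functions setT g & f = superposition al y c g].
apply: (@smooth_coind _ _ P); last by exists c, g.
move=> _ {ic tg} [{}c [{}g [ic tg ->]]]; split.
- exact: superposition_continuous.
- by move=> x i; have [] := is_derive_superposition x i ic tg.
- move=> i; exists (fun t => - al t * c t), (partial i g); split.
  + exact: integrable_al_mul.
  + exact: test_partial.
  + by apply/funext => x; have [_] := is_derive_superposition x i ic tg.
Qed.

Lemma partial_superposition c g x i : m.-integrable setT (EFin \o c) ->
  test_functions setT g -> partial i (superposition al y c g) x =
  superposition al y (fun t => - al t * c t) (partial i g) x.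
Proof. by move=> ic tg; have [_] := is_derive_superposition x i ic tg. Qed.

End superposition.

(** * Averages over directions with a random scale *)

Section averaging.
Context {R : realType} {n : nat}.
Local Notation mu := (lebesgue_rV n : {sigma_finite_measure set 'rV[R]_n -> \bar R}).

Definition lt12 : (1 : R) < 2 := ltr1n R 2.

Local Notation P1 := (uniform_prob lt12).
Local Notation M := (P1 \x mu)%E.
Local Notation T := (measurableTypeR R * 'rV[R]_n)%type.

Lemma integral_uniform_cst (c : \bar R) : (\int[P1]_r c = c)%E.
Proof. by rewrite integral_cst // [X in (_ * X)%E](_ : _ = 1%E) ?mule1 //; exact: probability_setT. Qed.

(* The mollifiers below average over the scales [e r], with [r] uniform in [[1, 2]];
   clamping [r] makes all formulas meaningful for every [r]. *)
Definition clamp (r : R) : R := Num.max 1 (Num.min r 2).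

Lemma clamp_ge1 r : 1 <= clamp r.
Proof. by rewrite /clamp le_max lexx. Qed.

Lemma clamp_le2 r : clamp r <= 2.
Proof. by rewrite /clamp ge_max ler1n /= ge_min lexx orbT. Qed.

Lemma clamp_id r : 1 <= r <= 2 -> clamp r = r.
Proof. by move=> /andP[r1 r2]; rewrite /clamp min_l // max_r. Qed.

Lemma measurable_clamp : measurable_fun setT clamp.
Proof. by apply: measurable_maxr => //; apply: measurable_minr. Qed.

Variable e : R.
Hypothesis e0 : 0 < e.

Definition dilation (r : R) : R := (e * clamp r)^-1.

Lemma clamp_gt0 r : 0 < e * clamp r.
Proof. by rewrite mulr_gt0 // (lt_le_trans ltr01) // clamp_ge1. Qed.

Lemma dilation_gt0 r : 0 < dilation r.
Proof. by rewrite invr_gt0 clamp_gt0. Qed.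

Lemma dilation_le r : dilation r <= e^-1.
Proof.
by rewrite lef_pV2 ?posrE ?clamp_gt0 // ler_peMr ?clamp_ge1 // ltW.
Qed.

Lemma measurable_dilation : measurable_fun setT dilation.
Proof.
have cf : continuous (fun r : R => (e * clamp r)^-1).
  move=> r; apply: (@continuousV _ _ (fun r : R => e * clamp r)); first by rewrite gt_eqF ?clamp_gt0.
  apply: continuousM; first exact: cst_continuous.
  apply: continuous_max; first exact: cst_continuous.
  by apply: continuous_min; [move=> A; exact|exact: cst_continuous].
exact: continuous_measurable_fun.
Qed.

Lemma measurable_snd_rV : measurable_fun setT (fun t : T => t.2).
Proof. exact: measurable_snd. Qed.

Lemma measurable_dil : measurable_fun setT (fun t : T => dilation t.1).
Proof. exact: (measurableT_comp measurable_dilation measurable_fst). Qed.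

Lemma measurable_move (x : 'rV[R]_n) :
  measurable_fun setT (fun t : T => x + (e * clamp t.1) *: t.2).
Proof.
apply: measurable_rVP => i; under eq_fun do rewrite !mxE.
apply: measurable_funD => //; apply: measurable_funM.
  apply: measurable_funM => //; exact: (measurableT_comp measurable_clamp measurable_fst).
exact: (measurableT_comp (measurable_coord i) measurable_snd).
Qed.

(* A change of variables exchanges the two forms of the average of [h] with weight [s]
   around [x]: the first one can be differentiated in [x] when only [s] is smooth, the
   second one is an average of translates of [h]. *)
Definition kernel_form (s h : 'rV[R]_n -> R) x (t : T) : R :=
  h t.2 * dilation t.1 ^+ n * s (dilation t.1 *: (t.2 - x)).

Definition shift_form (s h : 'rV[R]_n -> R) x (t : T) : R :=
  s t.2 * h (x + (e * clamp t.1) *: t.2).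

(** Valued in the extended reals, so that averages of nonnegative functions can be compared before
    anything is known of their finiteness. *)
Definition Av (s h : 'rV[R]_n -> R) x : \bar R := (\int[M]_t (shift_form s h x t)%:E)%E.

Section measurability.
Variables (s h : 'rV[R]_n -> R).
Hypotheses (ms : measurable_fun setT s) (mh : measurable_fun setT h).

Lemma measurable_kernel_form x : measurable_fun setT (kernel_form s h x).
Proof.
apply: measurable_funM; first apply: measurable_funM.
- exact: (measurableT_comp mh measurable_snd_rV).
- by apply: (measurableT_comp (exprn_measurable n)); exact: measurable_dil.
- exact: (@measurable_superposed _ _ _ _ (fun t : T => dilation t.1) (fun t : T => t.2) measurable_dil measurable_snd_rV s x ms).
Qed.

Lemma measurable_shift_form x : measurable_fun setT (shift_form s h x).
Proof.
apply: measurable_funM; first exact: (measurableT_comp ms measurable_snd_rV).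
exact: (measurableT_comp mh (measurable_move x)).
Qed.

Hypotheses (s0 : forall x, 0 <= s x) (h0 : forall x, 0 <= h x).

Lemma shift_form_ge0 x t : 0 <= shift_form s h x t.
Proof. by rewrite mulr_ge0. Qed.

Lemma kernel_form_ge0 x t : 0 <= kernel_form s h x t.
Proof. by rewrite !mulr_ge0 // exprn_ge0 // ltW ?dilation_gt0. Qed.

Lemma kernel_shift_ge0 x : (\int[M]_t (kernel_form s h x t)%:E = Av s h x)%E.
Proof.
rewrite /Av fubini_tonelli1; [|apply/measurable_EFinP; exact: measurable_kernel_form|by move=> t; rewrite lee_fin kernel_form_ge0].
rewrite fubini_tonelli1; [|apply/measurable_EFinP; exact: measurable_shift_form|by move=> t; rewrite lee_fin shift_form_ge0].
apply: eq_integral => r _; rewrite /fubini_F.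
have mk : measurable_fun setT (fun y => (kernel_form s h x (r, y))%:E).
  apply/measurable_EFinP; apply: (measurableT_comp (measurable_kernel_form x)).
  exact: measurable_pair1.
rewrite (ge0_integral_affine x (clamp_gt0 r)) //; last by move=> y; rewrite lee_fin kernel_form_ge0.
rewrite -ge0_integralZl //; first last.
- by rewrite lee_fin exprn_ge0 // ltW ?clamp_gt0.
- by move=> y _; rewrite lee_fin kernel_form_ge0.
- exact: (measurableT_comp mk (measurable_affine _ _)).
apply: eq_integral => y _; rewrite -EFinM; congr EFin.
rewrite /kernel_form /shift_form /= addrK /dilation scalerA mulVf ?gt_eqF ?clamp_gt0 // scale1r.
rewrite exprVn [_ *: _ + x]addrC; have E0 : (e * clamp r) ^+ n != 0 by rewrite expf_neq0 // gt_eqF ?clamp_gt0.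
move: E0; set E := _ ^+ n; set H := h _ => E0.
by rewrite [H * _]mulrC -mulrA mulVKf // mulrC.
Qed.

(** Integration over the scale comes first here: for fixed [y] the inner integral runs along a
    segment, where one-variable estimates apply. *)
Lemma Av_outer x : (Av s h x =
  \int[mu]_y ((s y)%:E * \int[P1]_r (h (x + (e * clamp r) *: y))%:E))%E.
Proof.
rewrite /Av fubini_tonelli2; [|apply/measurable_EFinP; exact: measurable_shift_form|by move=> t; rewrite lee_fin shift_form_ge0].
apply: eq_integral => y _; rewrite /fubini_G /shift_form /=.
under eq_integral do rewrite EFinM; rewrite ge0_integralZl //.
- apply/measurable_EFinP; apply: (measurableT_comp mh).
  exact: (measurableT_comp (measurable_move x) (measurable_pair2 y)).
- by move=> r _; rewrite lee_fin.
- by rewrite lee_fin.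
Qed.

Lemma Av_ge0 x : (0 <= Av s h x)%E.
Proof. by apply: integral_ge0 => t _; rewrite lee_fin shift_form_ge0. Qed.

Lemma integral_kernel_le x (C : R) : (forall y, s y <= C) ->
  (Av s h x <= (e^-1 ^+ n * C)%:E * \int[mu]_y (h y)%:E)%E.
Proof.
move=> sC; rewrite -kernel_shift_ge0.
have C0 : 0 <= C by exact: le_trans (sC 0).
apply: (@le_trans _ _ (\int[M]_t ((e^-1 ^+ n * C) * h t.2)%:E)%E).
  apply: ge0_le_integral => //.
  - by move=> t _; rewrite lee_fin kernel_form_ge0.
  - apply/measurable_EFinP; exact: measurable_kernel_form.
  - apply/measurable_EFinP; apply: measurable_funM; first exact: measurable_cst.
    exact: (measurableT_comp mh measurable_snd_rV).
  move=> t _; rewrite lee_fin /kernel_form -mulrA [leRHS]mulrC ler_wpM2l //; apply: ler_pM => //.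
  - by rewrite exprn_ge0 // ltW ?dilation_gt0.
  - apply: lerXn2r; [|by rewrite nnegrE invr_ge0 ltW|exact: dilation_le].
    by rewrite nnegrE ltW // dilation_gt0.
rewrite fubini_tonelli1; last 2 first.
- apply/measurable_EFinP; apply: measurable_funM; first exact: measurable_cst.
  exact: (measurableT_comp mh measurable_snd_rV).
- by move=> t; rewrite lee_fin mulr_ge0 // mulr_ge0 // exprn_ge0 // invr_ge0 ltW.
rewrite /fubini_F /=.
have E : (\int[mu]_y (e^-1 ^+ n * C * h y)%:E = (e^-1 ^+ n * C)%:E * \int[mu]_y (h y)%:E)%E.
  under eq_integral do rewrite EFinM; rewrite ge0_integralZl //.
  - exact/measurable_EFinP.
  - by move=> y _; rewrite lee_fin.
  - by rewrite lee_fin mulr_ge0 // exprn_ge0 // invr_ge0 ltW.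
under eq_integral do rewrite E.
by rewrite integral_uniform_cst.
Qed.

End measurability.

End averaging.

Lemma EFin_Rintegral_int {R : realType} d {T : measurableType d}
    (m : {measure set T -> \bar R}) (D : set T) (f : T -> R) : measurable D ->
  m.-integrable D (EFin \o f) -> ((\int[m]_(t in D) f t)%R)%:E = (\int[m]_(t in D) (f t)%:E)%E.
Proof. by move=> mD jf; rewrite /Rintegral fineK //; exact: (integrable_fin_num mD jf). Qed.

Section mollification.
Context {R : realType} {n : nat}.
Local Notation mu := (lebesgue_rV n : {sigma_finite_measure set 'rV[R]_n -> \bar R}).
Local Notation P1 := (uniform_prob (@lt12 R)).
Local Notation M := (P1 \x mu)%E.
Local Notation T := (measurableTypeR R * 'rV[R]_n)%type.
Local Notation L1T u := (mu.-integrable setT (EFin \o u)).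
Implicit Types (u v s : 'rV[R]_n -> R) (x : 'rV[R]_n).

Variable e : R.
Hypothesis e0 : 0 < e.

Definition moll (rho u : 'rV[R]_n -> R) : 'rV[R]_n -> R :=
  superposition M (fun t : T => dilation e t.1) (fun t : T => t.2)
    (fun t : T => u t.2 * dilation e t.1 ^+ n) rho.

Let dil_bound (t : T) : `|dilation e t.1| <= e^-1.
Proof. by rewrite gtr0_norm ?dilation_gt0 // dilation_le. Qed.

Lemma integrable_snd u : L1T u -> M.-integrable setT (EFin \o (fun t : T => u t.2)).
Proof.
move=> iu; have mu_ := rintegrable_measurable iu.
have mf : measurable_fun setT (fun t : T => u t.2).
  exact: (measurableT_comp mu_ measurable_snd).
apply/integrableP; split; first exact/measurable_EFinP.
rewrite fubini_tonelli1 //=; last by apply/measurable_EFinP; exact: measurableT_comp.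
by rewrite /fubini_F /= integral_uniform_cst; have /integrableP[] := iu.
Qed.

Lemma moll_weight_integrable u : L1T u ->
  M.-integrable setT (EFin \o (fun t : T => u t.2 * dilation e t.1 ^+ n)).
Proof.
move=> iu; apply: (@rintegrable_mul_bounded _ _ _ _ _ measurableT _ _ (e^-1 ^+ n)).
- exact: integrable_snd.
- by apply: (measurableT_comp (exprn_measurable n)); exact: measurable_dil.
- move=> t _; rewrite normrX; apply: lerXn2r; [by rewrite nnegrE| |exact: dil_bound].
  by rewrite nnegrE invr_ge0 ltW.
Qed.

Lemma kernel_form_integrable u s x (B : R) : L1T u -> measurable_fun setT s ->
  (forall y, `|s y| <= B) -> M.-integrable setT (EFin \o kernel_form e s u x).
Proof.
move=> iu ms sB; apply: (superposed_integrable _ _ _ _ _ sB) => //.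
- exact: measurable_dil.
- exact: moll_weight_integrable.
Qed.

Lemma norm_superposition_le u s x (B : R) : L1T u -> measurable_fun setT s ->
  (forall y, `|s y| <= B) ->
  ((`|(\int[M]_t kernel_form e s u x t)%R|%R)%:E <= Av e (fun y => `|s y|%R) (fun y => `|u y|%R) x)%E.
Proof.
move=> iu ms sB; have ik := kernel_form_integrable x iu ms sB.
have mu_ := rintegrable_measurable iu.
apply: (@le_trans _ _ ((\int[M]_t `|kernel_form e s u x t|)%R)%:E).
  by rewrite lee_fin le_normr_Rintegral.
rewrite -kernel_shift_ge0 //; [|exact: measurableT_comp|exact: measurableT_comp].
rewrite EFin_Rintegral_int //; last exact: rintegrable_norm.
apply: le_of_eq; apply: eq_integral => t _; congr EFin.
by rewrite /kernel_form !normrM [`|_ ^+ n|]ger0_norm // exprn_ge0 // ltW ?dilation_gt0.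
Qed.

Section fixed_kernel.
Variable rho : 'rV[R]_n -> R.
Hypotheses (trho : test_functions setT rho) (rho0 : forall y, 0 <= rho y).

Let srho := test_smooth trho.
Let mrho := smooth_measurable srho.

Lemma moll_smooth u : L1T u -> smooth_on setT (moll rho u).
Proof.
move=> iu; apply: superposition_smooth => //.
- exact: measurable_dil.
- exact: measurable_snd.
- exact: moll_weight_integrable.
Qed.

Lemma norm_moll_le u x : L1T u ->
  ((`|moll rho u x|%R)%:E <= Av e rho (fun y => `|u y|%R) x)%E.
Proof.
move=> iu; have [B _ hB] := test_bounded trho.
apply: le_trans (norm_superposition_le x iu mrho hB) _.
by rewrite (_ : (fun y => `|rho y|%R) = rho) //; apply/funext => y; rewrite ger0_norm.
Qed.

Lemma mollB u v x : L1T u -> L1T v ->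
  moll rho u x - moll rho v x = moll rho (fun y => u y - v y) x.
Proof.
move=> iu iv; have [B _ hB] := test_bounded trho.
rewrite /moll /superposition -RintegralB //; last 2 first.
- exact: kernel_form_integrable hB.
- exact: kernel_form_integrable hB.
by apply: eq_Rintegral => t _; rewrite -!mulrBl.
Qed.

Lemma partial_moll u x i : L1T u -> partial i (moll rho u) x =
  (\int[M]_t (- dilation e t.1 * kernel_form e (partial i rho) u x t))%R.
Proof.
move=> iu; rewrite /moll (@partial_superposition _ _ _ _ _ _ _ e^-1) //; last 3 first.
- exact: measurable_dil.
- exact: measurable_snd.
- exact: moll_weight_integrable.
by apply: eq_Rintegral => t _; rewrite /kernel_form !mulrA.
Qed.

Lemma norm_partial_moll_le u x i : L1T u ->
  ((`|partial i (moll rho u) x|%R)%:E <=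
   (e^-1)%:E * Av e (fun y => `|partial i rho y|%R) (fun y => `|u y|%R) x)%E.
Proof.
move=> iu; have [B _ hB] := test_partial_bounded trho; rewrite partial_moll //.
have mp := smooth_partial_measurable i srho.
have ik := kernel_form_integrable x iu mp (hB i).
have mu_ := rintegrable_measurable iu.
have iak : M.-integrable setT (EFin \o (fun t : T => - dilation e t.1 * kernel_form e (partial i rho) u x t)).
  under eq_fun do rewrite mulrC.
  apply: (@rintegrable_mul_bounded _ _ _ _ _ measurableT _ _ e^-1) => //.
    by apply: measurable_funN => //; exact: measurable_dil.
  by move=> t _; rewrite normrN.
apply: (@le_trans _ _ ((\int[M]_t (e^-1 * `|kernel_form e (partial i rho) u x t|))%R)%:E).
  rewrite lee_fin; apply: le_trans (le_normr_Rintegral measurableT iak) _.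
  apply: le_Rintegral => //.
  - exact: rintegrable_norm.
  - by apply: rintegrableZ => //; exact: rintegrable_norm.
  - by move=> t _; rewrite normrM normrN ler_wpM2r.
rewrite RintegralZl //; last exact: rintegrable_norm.
rewrite EFinM lee_wpmul2l ?lee_fin ?invr_ge0 ?(ltW e0) //.
rewrite -kernel_shift_ge0 //; [|exact: measurableT_comp|exact: measurableT_comp].
rewrite EFin_Rintegral_int //; last exact: rintegrable_norm.
apply: le_of_eq; apply: eq_integral => t _; congr EFin.
by rewrite /kernel_form !normrM [`|_ ^+ n|]ger0_norm // exprn_ge0 // ltW ?dilation_gt0.
Qed.

Lemma norm_partial_moll_L1 u x i (B : R) : L1T u -> (forall i y, `|partial i rho y| <= B) ->
  ((`|partial i (moll rho u) x|%R)%:E <= (e^-1 * (e^-1 ^+ n * B))%:E * \int[mu]_y (`|u y|%R)%:E)%E.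
Proof.
move=> iu hB; apply: le_trans (norm_partial_moll_le x i iu) _.
rewrite EFinM -muleA lee_wpmul2l ?lee_fin ?invr_ge0 ?(ltW e0) //.
have mu_ := rintegrable_measurable iu.
by apply: integral_kernel_le => //; apply: measurableT_comp => //; exact: smooth_partial_measurable.
Qed.

Lemma Av_cst s (B : R) (y : 'rV[R]_n) : measurable_fun setT s -> (forall z, 0 <= s z) -> 0 <= B ->
  (Av e s (fun=> B) y = B%:E * \int[mu]_z (s z)%:E)%E.
Proof.
move=> ms s0 B0; rewrite Av_outer //.
under eq_integral do rewrite integral_uniform_cst.
rewrite -ge0_integralZl //; last 2 first.
- exact/measurable_EFinP.
- by move=> z _; rewrite lee_fin.
by apply: eq_integral => z _; rewrite muleC.
Qed.

Lemma Av_mono s (h k : 'rV[R]_n -> R) x : measurable_fun setT s -> (forall z, 0 <= s z) ->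
  measurable_fun setT h -> measurable_fun setT k ->
  (forall z, 0 <= h z) -> (forall z, h z <= k z) -> (Av e s h x <= Av e s k x)%E.
Proof.
move=> ms s0 mh mk h0 hk; apply: ge0_le_integral => //.
- by move=> t _; rewrite lee_fin shift_form_ge0.
- by apply/measurable_EFinP; exact: measurable_shift_form.
- by apply/measurable_EFinP; exact: measurable_shift_form.
- by move=> t _; rewrite lee_fin ler_wpM2l.
Qed.

(** Differentiating the kernel costs a factor [1/e] and uses the size of [u] alone. This is the
    source of the bound [Cu / e] in [pointwise_estimate], and the reason for truncating [u]. *)
Lemma norm_partial_moll_bounded u x i (B C : R) : L1T u -> (forall y, `|u y| <= B) ->
  (\int[mu]_y (`|partial i rho y|%R)%:E <= C%:E)%E ->
  `|partial i (moll rho u) x| <= e^-1 * (B * C).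
Proof.
move=> iu uB hC; have B0 : 0 <= B by exact: le_trans (uB 0).
have mp := smooth_partial_measurable i srho.
have mp' : measurable_fun setT (fun y => `|partial i rho y|%R) by exact: measurableT_comp.
have mu_ := rintegrable_measurable iu.
rewrite -lee_fin; apply: le_trans (norm_partial_moll_le x i iu) _.
rewrite EFinM lee_wpmul2l ?lee_fin ?invr_ge0 ?(ltW e0) //.
apply: (@le_trans _ _ (Av e (fun y => `|partial i rho y|%R) (fun=> B) x)).
  by apply: Av_mono => //; exact: measurableT_comp.
by rewrite Av_cst // EFinM lee_wpmul2l ?lee_fin.
Qed.

(** The change of variables is available for nonnegative functions; since [rho >= 0], both forms
    commute with positive and negative parts of [u]. *)
Lemma moll_shift u x : L1T u ->
  moll rho u x = (\int[M]_t shift_form e rho u x t)%R.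
Proof.
move=> iu; have mu_ := rintegrable_measurable iu.
rewrite /moll /superposition /Rintegral; congr fine.
have pos (f : 'rV[R]_n -> R) : measurable_fun setT f ->
    (\int[M]_t (kernel_form e rho (fun y => Num.max (f y) 0) x t)%:E =
     \int[M]_t (shift_form e rho (fun y => Num.max (f y) 0) x t)%:E)%E.
  move=> mf; rewrite kernel_shift_ge0 //; first exact: measurable_maxr.
  by move=> y; rewrite le_max lexx orbT.
have mN : measurable_fun setT (fun y => - u y) by exact: measurable_funN.
have K0 (t : T) : 0 <= dilation e t.1 ^+ n * rho (dilation e t.1 *: (t.2 - x)).
  by rewrite mulr_ge0 // exprn_ge0 // ltW ?dilation_gt0.
have kp (f : 'rV[R]_n -> R) t : Num.max (kernel_form e rho f x t) 0 = kernel_form e rho (fun y => Num.max (f y) 0) x t.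
  by rewrite /kernel_form -!mulrA -[X in Num.max _ X](mul0r (dilation e t.1 ^+ n * rho (dilation e t.1 *: (t.2 - x)))) -maxr_pMl.
have sp (f : 'rV[R]_n -> R) t : Num.max (shift_form e rho f x t) 0 = shift_form e rho (fun y => Num.max (f y) 0) x t.
  by rewrite /shift_form -[X in Num.max _ X](mulr0 (rho t.2)) -maxr_pMr.
rewrite [LHS]integralE [RHS]integralE; congr (_ - _)%E.
  transitivity (\int[M]_t (kernel_form e rho (fun y => Num.max (u y) 0) x t)%:E)%E.
    by apply: eq_integral => t _; rewrite funeposE -kp EFin_max.
  rewrite pos //; apply: eq_integral => t _.
  by rewrite funeposE -sp EFin_max.
transitivity (\int[M]_t (kernel_form e rho (fun y => Num.max (- u y) 0) x t)%:E)%E.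
  by apply: eq_integral => t _; rewrite funenegE -kp EFin_max /kernel_form !mulNr.
rewrite pos //; apply: eq_integral => t _.
by rewrite funenegE -sp EFin_max /shift_form mulrN.
Qed.

(** The shift form is also a superposition, now with the test function in the role of the smooth
    factor, so that the derivative falls on [phi] instead of the kernel. *)
Lemma partial_moll_test phi x i : test_functions setT phi ->
  partial i (moll rho phi) x = moll rho (partial i phi) x.
Proof.
move=> tphi; have iphi := test_integrable tphi.
have irho : M.-integrable setT (EFin \o (fun t : T => rho t.2)).
  by apply: integrable_snd; exact: test_integrable trho.
pose y (t : T) : 'rV[R]_n := - ((e * clamp t.1) *: t.2).
have E psi z : test_functions setT psi -> moll rho psi z =
    superposition M (fun=> -1) y (fun t : T => rho t.2) psi z.
  move=> tpsi; rewrite (moll_shift z (test_integrable tpsi)).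
  apply: eq_Rintegral => t _; rewrite /shift_form; congr (_ * psi _).
  by rewrite /y scaleN1r opprB opprK.
have my : measurable_fun setT y.
  apply: measurable_rVP => j; under eq_fun do rewrite !mxE.
  apply: measurable_funN => //; apply: measurable_funM.
    apply: measurable_funM => //; exact: (measurableT_comp measurable_clamp measurable_fst).
  exact: (measurableT_comp (measurable_coord j) measurable_snd).
rewrite (_ : moll rho phi = superposition M (fun=> -1) y (fun t : T => rho t.2) phi); last first.
  by apply/funext => z; exact: E.
rewrite (@partial_superposition _ _ _ _ _ _ _ 1) //; last by move=> t; rewrite normrN normr1.
rewrite E; last exact: test_partial.
by apply: eq_Rintegral => t _; rewrite opprK mul1r.
Qed.

End fixed_kernel.

End mollification.

(** * The energy of mollifications *)

Section iterated_directional.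
Context {R : realType} {n : nat}.
Implicit Types (a : 'rV[R]_n -> R) (v x : 'rV[R]_n) (U K : set 'rV[R]_n).

(** The [j]-th derivative in direction [v], expanded into partial derivatives, which are what
    [smooth_on] controls; [s] accumulates the coordinates already used. The expansion makes the
    bound by [|v|^j] on compact sets visible. *)
Fixpoint iter_dir a v (j : nat) (s : seq 'I_n) x : R :=
  if j is j'.+1 then \sum_i v ord0 i * iter_dir a v j' (i :: s) x
  else iter_partial s a x.

Lemma is_derive_iter_dir U a v j s x : open U -> smooth_on U a -> U x ->
  is_derive x v (iter_dir a v j s) (iter_dir a v j.+1 s x).
Proof.
move=> oU sa; elim: j s => [|j IH] s Ux.
  apply: (is_derive_directional v oU Ux).
    by move=> y i Uy; have [_] := sa s y Uy; exact.
  by move=> i; have [] := sa (i :: s) x Ux.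
have -> : iter_dir a v j.+1 s = \sum_i (v ord0 i \*: iter_dir a v j (i :: s)).
  by apply/funext => y; rewrite fct_sumE.
rewrite /= -/(iter_dir a v j.+1); apply: is_derive_sum => i.
by apply: is_deriveZ; exact: IH.
Qed.

Lemma iter_dir_bound U K a j s : smooth_on U a -> compact K -> K `<=` U ->
  exists2 B : R, 0 <= B & forall v x, K x -> `|iter_dir a v j s x| <= B * `|v| ^+ j.
Proof.
move=> sa cK KU; elim: j s => [|j IH] s.
  have [|B B0 hB] := continuous_compact_bounded (f := iter_partial s a) cK.
    by move=> x /KU Ux; have [] := sa s x Ux.
  by exists B => [|v x Kx /=]; [exact: ltW|rewrite expr0 mulr1 hB].
have [B hB] := choice (fun i => let: ex_intro2 b b0 h := IH (i :: s) in
  ex_intro (fun b => 0 <= b /\ forall v x, K x -> `|iter_dir a v j (i :: s) x| <= b * `|v| ^+ j) b (conj b0 h)).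
exists (\sum_i B i) => [|v x Kx].
  by apply: sumr_ge0 => i _; have [] := hB i.
rewrite /=; apply: le_trans (ler_norm_sum _ _ _) _; rewrite mulr_suml.
apply: ler_sum => i _; rewrite normrM exprS mulrCA.
by apply: ler_pM => //; [exact: coord_le_norm|exact: (hB i).2].
Qed.

End iterated_directional.

Section pointwise.
Context {R : realType} {n : nat}.
Local Notation mu := (lebesgue_rV n : {sigma_finite_measure set 'rV[R]_n -> \bar R}).
Local Notation P1 := (uniform_prob (@lt12 R)).
Implicit Types (g rho : 'rV[R]_n -> R) (x : 'rV[R]_n).

Lemma fattening_compact (K : set 'rV[R]_n) (d : R) : 0 <= d -> compact K ->
  compact [set w | exists y z, [/\ K y, `|z| <= d & w = y + z]].
Proof.
move=> d0 cK; have cB : compact [set z : 'rV[R]_n | `|z| <= d].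
  by have := compact_norm_ball (v := 0 : 'rV[R]_n) d0; under eq_set do rewrite subr0.
rewrite (_ : [set w | _] = (fun p : 'rV[R]_n * 'rV[R]_n => p.1 + p.2) @` (K `*` [set z | `|z| <= d])).
  apply: continuous_compact; last exact: compact_setX.
  by apply: continuous_subspaceT => p; exact: add_continuous.
apply/seteqP; split => w /=.
  by move=> [y [z [Ky zd ->]]]; exists (y, z).
by move=> [[y z] [Ky zd] <-]; exists y, z.
Qed.

Lemma exists_nat_ceil (q : R) : 0 < q -> exists m : nat, m%:R < q /\ q <= m.+1%:R.
Proof.
move=> q0; have ex : exists k : nat, q <= k.+1%:R.
  by exists (Num.truncn q); apply: ltW; exact: truncnS_gt.
have [m qm mmin] := ex_minnP ex; exists m; split => //.
case: m qm mmin => [//|m] qm mmin.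
by rewrite ltNge; apply/negP => /mmin; rewrite ltnn.
Qed.

Lemma measurable_inner e (h : 'rV[R]_n -> R) x : measurable_fun setT h -> (forall z, 0 <= h z) ->
  measurable_fun setT (fun y : 'rV[R]_n => \int[P1]_r (h (x + (e * clamp r) *: y)%R)%:E)%E.
Proof.
move=> mh h0.
pose f (t : measurableTypeR R * 'rV[R]_n) := (h (x + (e * clamp t.1) *: t.2))%:E.
apply: (@measurable_fun_fubini_tonelli_G _ _ _ _ R P1 f); last by move=> t; rewrite lee_fin.
by apply/measurable_EFinP; apply: (measurableT_comp mh); exact: measurable_move.
Qed.

Variables (Omega U : set 'rV[R]_n) (a : 'rV[R]_n -> R) (q B Cu : R).
Hypotheses (oO : open Omega) (oU : open U) (cO : compact (closure Omega)) (OU : closure Omega `<=` U).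
Hypotheses (sa : smooth_on U a) (a0 : forall x, U x -> 0 <= a x) (q1 : 1 <= q).
Hypotheses (B0 : 0 < B) (Cu0 : 0 <= Cu).

(** Extension by zero, which makes the energy density a function on the whole space that can be
    translated and averaged. *)
Definition weight (y : 'rV[R]_n) : R := (a \_ Omega) y.

Lemma weightE y : Omega y -> weight y = a y.
Proof. by move=> Oy; rewrite /weight patchE mem_set. Qed.

Let OU' : Omega `<=` U.
Proof. by move=> y Oy; apply: OU; exact: subset_closure. Qed.

Lemma weight_ge0 y : 0 <= weight y.
Proof. by rewrite /weight patchE; case: ifPn => [/set_mem/OU'/a0|]. Qed.

Lemma measurable_weight : measurable_fun setT weight.
Proof.
apply/(measurable_restrictT _ _).1; first exact: open_measurable_rV.
apply: continuous_measurable_rV => // x /OU' Ux.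
exact: (smooth_on_continuous (U := U)).
Qed.

Lemma measurable_weighted g : measurable_fun setT g ->
  measurable_fun setT (fun y => weight y * g y `^ q).
Proof.
move=> mg; apply: measurable_funM; first exact: measurable_weight.
exact: (measurableT_comp (measurable_powR q) mg).
Qed.

Lemma inner_average (h : 'rV[R]_n -> R) e x y : measurable_fun setT h -> (forall z, 0 <= h z) ->
  (\int[P1]_r (h (x + (e * clamp r) *: y))%:E =
   \int[lebesgue_measure]_(t in `[1%R, 2%R]) (h (x + t *: (e *: y))%R)%:E)%E.
Proof.
move=> mh h0; rewrite integral_uniform; last 2 first.
- apply/measurable_EFinP; apply: (measurableT_comp mh).
  exact: (measurableT_comp (measurable_move e x) (measurable_pair2 y)).
- by move=> r; rewrite lee_fin.
rewrite (_ : (2 - 1 : R) = 1) ?invr1 ?mul1e; last by lra.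
apply: eq_integral => t; rewrite inE /= in_itv /= => t12.
by rewrite clamp_id // scalerA mulrC.
Qed.

(* Let [m < q - 1 <= m + 1]. If [a x] is at most of order [e ^ (m + 1)], then the bound
   [Cu / e] on [z] absorbs it. Otherwise [a] behaves like a polynomial of degree [m] on
   the segments issued from [x], and [line_estimate] applies on each of them. *)
Lemma pointwise_estimate : exists C e1 : R, [/\ 0 <= C, 0 < e1 &
  forall (e : R) (rho g : 'rV[R]_n -> R) x (z : R), 0 < e < e1 -> Omega x ->
  test_functions setT rho -> (forall y, 0 <= rho y) ->
  (forall y, B < `|y| -> rho y = 0) -> (\int[mu]_y (rho y)%:E = 1)%E ->
  measurable_fun setT g -> (forall y, 0 <= g y) -> (forall y, ~ Omega y -> g y = 0) ->
  0 <= z -> z <= Cu / e -> (z%:E <= Av e rho g x)%E ->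
  ((a x * z `^ q)%:E <= C%:E * (Av e rho (fun y => weight y * g y `^ q)%R x + Av e rho g x))%E].
Proof.
have [|Ma Ma0 hMa] := continuous_compact_bounded (f := a) cO.
  by move=> x /OU Ux; exact: (smooth_on_continuous (U := U)).
have aM x : Omega x -> a x <= Ma.
  by move=> Ox; apply: le_trans (ler_norm _) (hMa x _); exact: subset_closure.
have Yge e rho g x : (forall y, 0 <= rho y) -> (0 <= Av e rho (fun y => weight y * g y `^ q)%R x)%E.
  by move=> rho0; apply: Av_ge0 => // y; rewrite mulr_ge0 ?weight_ge0 // powR_ge0.
have Gge e rho g x : (forall y, 0 <= rho y) -> (forall y, 0 <= g y) -> (0 <= Av e rho g x)%E.
  by move=> rho0 g0; exact: Av_ge0.
have [q_eq1|q_neq1] := eqVneq q 1.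
  (* For [q = 1] the term is linear in [z], and the bound of [a] on the closure suffices. *)
  exists Ma, 1; split => //; first exact: ltW.
  move=> e rho g x z _ Ox _ rho0 _ _ mg g0 _ z0 _ zAv.
  have -> : z `^ q = z by rewrite q_eq1 powRr1.
  rewrite EFinM; apply: (@le_trans _ _ (Ma%:E * Av e rho g x)%E).
    by apply: lee_pmul => //; rewrite lee_fin; [exact/a0/OU'|exact: aM].
  by rewrite lee_wpmul2l ?lee_fin ?(ltW Ma0) // leeDr // Yge.
have qgt1 : 0 < q - 1 by rewrite subr_gt0 lt_neqAle eq_sym q_neq1.
have [m [mq qm]] := exists_nat_ceil qgt1.
have [C C0 hC] := line_estimate mq.
have [d d0 hd] := compact_neighborhood cO OU oU.
(* The segments issued from points of [Omega] may leave it but not [K], on which the derivatives of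
   [a] are bounded. *)
pose K := [set w | exists y z, [/\ closure Omega y, `|z| <= d & w = y + z]].
have cK : compact K by apply: fattening_compact => //; exact: ltW.
have KU : K `<=` U by move=> _ [y [z [cy zd ->]]]; exact: hd.
have [Bm Bm0 hBm] := iter_dir_bound m.+1 [::] sa cK KU.
(* [thr e^(m+1)] is [2^(m+2) H] for [H = Bm (e B)^(m+1)], the bound of the derivative of order
   [m + 1] along a segment of direction [e y] with [|y| <= B]; [line_estimate] requires [a x] to
   exceed it. *)
pose thr := 2 ^+ m.+2 * (Bm * B ^+ m.+1).
have thr0 : 0 <= thr by rewrite mulr_ge0 ?exprn_ge0 // mulr_ge0 // exprn_ge0 // ltW.
pose C1 := 2 * (2 * (C + 1)) `^ (q - 1).
pose C2 := thr * Cu `^ (q - 1).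
have C10 : 0 <= C1 by rewrite mulr_ge0 // powR_ge0.
have C20 : 0 <= C2 by rewrite mulr_ge0 // powR_ge0.
(* [e <= 1] bounds the power [e^(m+1-(q-1))] by 1 where [a x] is small; [2 e B <= d] keeps the
   segments in [K]. *)
exists (C1 + C2), (Num.min 1 (d / (2 * B))); split; first exact: addr_ge0.
  by rewrite lt_min ltr01 divr_gt0 // mulr_gt0.
move=> e rho g x z /andP[e0]; rewrite lt_min => /andP[e1 ed] Ox trho rho0 rhoB rho1 mg g0 gO z0 zCu zAv.
have ax0 : 0 <= a x by apply/a0/OU'.
set Y := Av e rho (fun y => _) x; set W := Av e rho g x.
have Y0 : (0 <= Y)%E by exact: Yge.
have W0 : (0 <= W)%E by exact: Gge.
have [->|zn0] := eqVneq z 0.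
  rewrite powR0 ?mulr0; last by rewrite gt_eqF // (lt_le_trans ltr01).
  by apply: mule_ge0; [rewrite lee_fin addr_ge0|exact: adde_ge0].
have zp : 0 < z by rewrite lt_neqAle eq_sym zn0.
have zq : z `^ q = z `^ (q - 1) * z.
  by rewrite -[X in _ * X]powRr1 // -powRD ?zn0 ?implybT // subrK.
have [small|big] := leP (a x) (thr * e ^+ m.+1).
  apply: (@le_trans _ _ (C2%:E * W)%E); last first.
    by apply: lee_pmul; rewrite ?lee_fin // ?lerDr // leeDr.
  apply: (@le_trans _ _ (C2%:E * z%:E)%E); last by rewrite lee_wpmul2l // lee_fin.
  rewrite -EFinM lee_fin zq mulrA ler_wpM2r // /C2.
  apply: (@le_trans _ _ ((thr * e ^+ m.+1) * (Cu / e) `^ (q - 1))).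
    by apply: ler_pM => //; [exact: powR_ge0|rewrite ge0_ler_powR ?nnegrE ?(ltW qgt1) // divr_ge0 // ltW].
  rewrite -mulrA ler_wpM2l // powRM ?invr_ge0 ?(ltW e0) //.
  rewrite mulrCA -[leRHS]mulr1 ler_wpM2l ?powR_ge0 //.
  rewrite -powR_inv1 ?(ltW e0) // -powRrM -powR_mulrn ?(ltW e0) // -powRD ?(gt_eqF e0) ?implybT //.
  rewrite mulN1r -[leRHS](_ : 1 `^ (m.+1%:R - (q - 1)) = 1); last by rewrite powR1.
  by apply: ge0_ler_powR; rewrite ?nnegrE ?ler01 ?(ltW e0) ?(ltW e1) ?subr_ge0.
have axp : 0 < a x.
  by apply: le_lt_trans big; rewrite mulr_ge0 // exprn_ge0 // ltW.
(* Chosen so that [C A <= z / 2]: the first term of [line_estimate] is then absorbed into the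
   left-hand side of [z <= C A + k Y]. *)
pose A := z / (2 * (C + 1)).
have C1p : 0 < 2 * (C + 1) by rewrite mulr_gt0 // ltr_wpDl.
have A0 : 0 < A by rewrite divr_gt0.
pose k := A `^ (1 - q) / a x.
have k0 : 0 <= k by rewrite divr_ge0 ?powR_ge0.
have mrho := smooth_measurable (test_smooth trho).
have mwg := measurable_weighted mg.
have wg0 y : 0 <= weight y * g y `^ q by rewrite mulr_ge0 ?weight_ge0 // powR_ge0.
have line y : `|y| <= B ->
  (\int[P1]_r (g (x + (e * clamp r) *: y)%R)%:E <= (C * A)%:E +
    k%:E * \int[P1]_r ((weight (x + (e * clamp r) *: y) * g (x + (e * clamp r) *: y) `^ q)%R)%:E)%E.
  move=> yB; rewrite inner_average //.
  rewrite [X in (_ <= _ + _ * X)%E](@inner_average (fun y => weight y * g y `^ q) e x y mwg wg0).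
  pose v := e *: y; pose f j (t : R) := iter_dir a v j [::] (x + t *: v).
  have vB : `|v| <= e * B by rewrite normrZ gtr0_norm // ler_wpM2l // ltW.
  have inK (t : R) : 0 <= t <= 2 -> K (x + t *: v).
    move=> /andP[t0 t2]; exists x, (t *: v); split => //; first exact: subset_closure.
    rewrite normrZ ger0_norm //; apply: (@le_trans _ _ (2 * (e * B))).
      by apply: ler_pM.
    by rewrite mulrCA -ler_pdivlMr ?mulr_gt0 // ltW.
  have df j (t : R) : (j <= m)%N -> 0 <= t <= 2 -> is_derive t 1 (f j) (f j.+1 t).
    move=> _ /inK/KU Ut; apply: (is_derive_line (iter_dir a v j [::]) x v t _).1.
    exact: is_derive_iter_dir oU sa Ut.
  have fH (t : R) : 0 <= t <= 2 -> `|f m.+1 t| <= Bm * (e * B) ^+ m.+1.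
    move=> /inK Kt; apply: le_trans (hBm v _ Kt) _; rewrite ler_wpM2l //.
    by apply: lerXn2r => //; rewrite nnegrE // mulr_ge0 ?ltW.
  have f0 (t : R) : 0 <= t <= 2 -> 0 <= f 0%N t by move=> /inK/KU/a0.
  have f00 : f 0%N 0 = a x by rewrite /f scale0r addr0.
  have Hf : 2 ^+ m.+2 * (Bm * (e * B) ^+ m.+1) < f 0%N 0.
    rewrite f00; apply: le_lt_trans big; rewrite /thr exprMn; apply: le_of_eq; ring.
  have mgl (h : 'rV[R]_n -> R) : measurable_fun setT h -> measurable_fun setT (fun t : R => h (x + t *: v)).
    move=> mh; apply: (measurableT_comp mh); apply: measurable_rVP => i.
    under eq_fun do rewrite !mxE.
    by apply: measurable_funD => //; apply: measurable_funM.
  have mg12 : measurable_fun (`[1, 2]%classic : set R) (fun t : R => g (x + t *: v)).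
    by apply: measurable_funTS; exact: mgl.
  have := hC f _ A (fun t => g (x + t *: v)) df fH f0 Hf A0 mg12 (fun t => g0 _).
  rewrite f00 => /le_trans; apply; rewrite leeD2l //.
  rewrite -ge0_integralZl //; last 2 first.
  - by apply/measurable_EFinP; apply: measurable_funTS; exact: (mgl _ mwg).
  - by move=> t _; rewrite lee_fin; exact: wg0.
  apply: le_of_eq; apply: eq_integral => t _.
  rewrite -EFinM; congr (EFin (_ * _)).
  (* Outside [Omega] the function [a] and its extension by zero may differ, but [g] vanishes
     there. *)
  have [Ot|nOt] := pselect (Omega (x + t *: v)); first by rewrite weightE.
  by rewrite gO // powR0 ?mulr0 // gt_eqF // (lt_le_trans ltr01).
have WY : (W <= (C * A)%:E + k%:E * Y)%E.
  have CA0 : 0 <= C * A by rewrite mulr_ge0 // ltW.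
  rewrite /W /Y !Av_outer //.
  have m1 := @measurable_inner e g x mg g0.
  have m2 := @measurable_inner e _ x mwg wg0.
  have i1 y : (0 <= \int[P1]_r (g (x + (e * clamp r) *: y)%R)%:E)%E.
    by apply: integral_ge0 => r _; rewrite lee_fin.
  have i2 y : (0 <= \int[P1]_r ((weight (x + (e * clamp r) *: y) * g (x + (e * clamp r) *: y) `^ q)%R)%:E)%E.
    by apply: integral_ge0 => r _; rewrite lee_fin.
  have mr : measurable_fun setT (EFin \o rho) by exact/measurable_EFinP.
  apply: (@le_trans _ _ (\int[mu]_y ((C * A)%:E * (rho y)%:E + k%:E * ((rho y)%:E *
     \int[P1]_r ((weight (x + (e * clamp r) *: y) * g (x + (e * clamp r) *: y) `^ q)%R)%:E)))%E).
    apply: ge0_le_integral => //.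
    - by move=> y _; rewrite mule_ge0 // lee_fin.
    - by apply: emeasurable_funM.
    - by apply: emeasurable_funD; apply: measurable_funeM => //; apply: emeasurable_funM.
    move=> y _; have [yB|yB] := leP `|y| B; last by rewrite rhoB // !mul0e !mule0 adde0.
    rewrite muleCA [X in (X + _)%E]muleC -ge0_muleDr ?mule_ge0 ?lee_fin ?CA0 //.
    by rewrite lee_wpmul2l ?lee_fin //; exact: line.
  rewrite ge0_integralD //; first last.
  - by apply: measurable_funeM; apply: emeasurable_funM.
  - by move=> y _; rewrite !mule_ge0 // lee_fin.
  - exact: measurable_funeM.
  - by move=> y _; rewrite mule_ge0 // lee_fin.
  rewrite ge0_integralZl //; first last.
  - by move=> y _; rewrite lee_fin.
  rewrite rho1 mule1 leeD2l // ge0_integralZl //.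
  - by apply: emeasurable_funM.
  - by move=> y _; rewrite mule_ge0 // lee_fin.
apply: (@le_trans _ _ (C1%:E * Y)%E); last first.
  by apply: lee_pmul; rewrite ?lee_fin // ?lerDl // leeDl.
have [Yfin|] := boolP (Y \is a fin_num); last first.
  rewrite ge0_fin_numE // -leNgt leye_eq => /eqP ->.
  by rewrite gt0_muley ?leey // lte_fin mulr_gt0 // powR_gt0.
have := le_trans zAv WY; rewrite -(fineK Yfin) -!EFinM -EFinD !lee_fin.
set Yr := fine Y => zY.
have CA : C * A <= z / 2.
  have -> : z / 2 = (C + 1) * A by rewrite /A; field; rewrite gt_eqF // ltr_wpDl.
  by rewrite ler_wpM2r ?(ltW A0) // lerDl.
have zk : z / 2 <= k * Yr.
  by rewrite -(lerD2l (z / 2)) -splitr; apply: le_trans zY _; rewrite lerD2r.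
rewrite /C1 zq.
have A1q : A `^ (1 - q) = (2 * (C + 1)) `^ (q - 1) / z `^ (q - 1).
  rewrite -opprB powRN /A powRM ?invr_ge0 ?(ltW C1p) // invfM.
  rewrite -powR_inv1 ?(ltW C1p) // -powRrM mulN1r powRN invrK mulrC //.
have zq0 : 0 < z `^ (q - 1) by rewrite powR_gt0.
move: zk; rewrite /k A1q => zk.
have : z / 2 * (a x * z `^ (q - 1)) <= (2 * (C + 1)) `^ (q - 1) / z `^ (q - 1) / a x * Yr * (a x * z `^ (q - 1)).
  by rewrite ler_wpM2r // mulr_ge0 // ltW.
rewrite [leRHS](_ : _ = (2 * (C + 1)) `^ (q - 1) * Yr); last by field; rewrite !gt_eqF.
rewrite (_ : a x * (_ * z) = 2 * (z / 2 * (a x * z `^ (q - 1)))); last by field.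
by rewrite -[2 * _ * Yr]mulrA ler_pM2l.
Qed.

End pointwise.

(** * Dominated convergence and uniform integrability *)

Section dominated.
Context {R : realType} d {T : measurableType d}.
Variables (m : {measure set T -> \bar R}).
Implicit Types h : T -> R.

Lemma dominated_small (D : set T) (f : nat -> T -> R) h : measurable D ->
  (forall k, measurable_fun D (f k)) -> m.-integrable D (EFin \o h) ->
  (forall k x, D x -> `|f k x| <= h x) -> (forall x, D x -> f ^~ x @ \oo --> (0 : R)) ->
  forall eta : R, 0 < eta -> exists k, (\int[m]_(x in D) (`|f k x|%R)%:E < eta%:E)%E.
Proof.
move=> mD mf ih fh f0 eta eta0.
have [] := @dominated_convergence _ _ _ m D mD (fun k x => (f k x)%:E) (cst 0%E) (EFin \o h).
- by move=> k; apply/measurable_EFinP.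
- exact: measurable_cst.
- by apply: aeW => x Dx; apply: cvg_EFin; [exact: nearW|exact: f0].
- exact: ih.
- by apply: aeW => x k Dx /=; rewrite lee_fin fh.
move=> _ /fine_cvgP[_ cv] _.
move/cvgrPdist_lt/(_ _ eta0) : cv => [N _ /(_ N (leqnn N))] /=.
rewrite sub0r normrN => hN; exists N.
have fin : (\int[m]_(x in D) (`|f N x|%R)%:E)%E \is a fin_num.
  apply: integrable_fin_num => //; apply: (le_integrable mD _ _ ih).
    by apply/measurable_EFinP; exact: measurableT_comp.
  by move=> x Dx /=; rewrite lee_fin normr_id; apply: le_trans (fh _ _ Dx) (ler_norm _).
rewrite -(fineK fin) lte_fin; apply: le_lt_trans hN; apply: le_trans (ler_norm _).
by under [X in _ <= fine X]eq_integral do rewrite subr0.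
Qed.

Lemma measurable_tail h (L : R) : measurable_fun setT h ->
  measurable_fun setT (fun x => h x * (L < h x)%R%:R).
Proof.
move=> mh; apply: measurable_funM => //.
apply: (@measurableT_comp _ _ _ _ _ _ (fun b : bool => b%:R : R)) => //.
exact: measurable_fun_ltr.
Qed.

Lemma tail_small h : (forall x, 0 <= h x) -> m.-integrable setT (EFin \o h) ->
  forall eta : R, 0 < eta -> exists k : nat,
    (\int[m]_x (`|h x * (k%:R < h x)%R%:R|%R)%:E < eta%:E)%E.
Proof.
move=> h0 ih eta eta0; have mh : measurable_fun setT h by apply/measurable_EFinP; have /integrableP[] := ih.
apply: (dominated_small measurableT _ ih) => // [k|k x _|x _].
- exact: measurable_tail.
- by rewrite ger0_norm ?mulr_ge0 // ler_piMr // lern1 leq_b1.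
apply: cvg_near_cst; exists (Num.truncn (h x)).+1 => // k /= hk.
rewrite ltNge (_ : h x <= k%:R) ?mulr0 //.
by apply: le_trans (ltW (truncnS_gt _)) _; rewrite ler_nat.
Qed.

(** Cutting [h] at a height [k], the part above has small integral everywhere, and the part below
    contributes at most [k] times the measure of [E]. *)
Lemma uniformly_integrable h : (forall x, 0 <= h x) -> m.-integrable setT (EFin \o h) ->
  forall eta : R, 0 < eta -> exists2 tau : R, 0 < tau &
    forall E, measurable E -> (m E < tau%:E)%E -> (\int[m]_(x in E) (h x)%:E <= eta%:E)%E.
Proof.
move=> h0 ih eta eta0; have mh : measurable_fun setT h by apply/measurable_EFinP; have /integrableP[] := ih.
have [k hk] := tail_small h0 ih (divr_gt0 eta0 (ltr0n R 2)).
pose f k x : R := h x * (k%:R < h x)%R%:R.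
have mf k' : measurable_fun setT (f k') by exact: measurable_tail.
exists (eta / 2 / (k%:R + 1)); first by rewrite !divr_gt0 // ltr_wpDl.
move=> E mE Etau.
apply: (@le_trans _ _ (\int[m]_(x in E) ((`|f k x|%R)%:E + (k%:R)%:E))%E).
  apply: ge0_le_integral => //.
  - by move=> x _; rewrite lee_fin.
  - by apply: measurable_funTS; exact/measurable_EFinP.
  - apply: emeasurable_funD => //; apply/measurable_EFinP; apply: measurable_funTS.
    exact: measurableT_comp.
  move=> x _; rewrite -EFinD lee_fin /f; case: ltP => hx.
    by rewrite mulr1 ger0_norm // lerDl.
  by rewrite mulr0 normr0 add0r.
rewrite ge0_integralD //; last first.
  by apply: measurable_funTS; apply/measurable_EFinP; exact: measurableT_comp.
rewrite integral_cst // [eta]splitr EFinD leeD //.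
  apply: le_trans (ltW hk); apply: ge0_subset_integral => //.
  by apply/measurable_EFinP; exact: measurableT_comp.
apply: (@le_trans _ _ ((k%:R + 1)%:E * (eta / 2 / (k%:R + 1))%:E)%E).
  by apply: lee_pmul => //; rewrite ?lee_fin ?ler_wpDr // ltW.
by rewrite -EFinM mulrC divfK // gt_eqF // ltr_wpDl.
Qed.

End dominated.
Section average_integral.
Context {R : realType} {n : nat}.
Local Notation mu := (lebesgue_rV n : {sigma_finite_measure set 'rV[R]_n -> \bar R}).
Local Notation P1 := (uniform_prob (@lt12 R)).
Implicit Types (chi h rho : 'rV[R]_n -> R).

Variable e : R.
Hypothesis e0 : 0 < e.

Let X := 'rV[R]_n.

Let inner h (z : X * X) : \bar R := (\int[P1]_r (h (z.1 + (e * clamp r) *: z.2)%R)%:E)%E.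

Let measurable_joint h : measurable_fun setT h ->
  measurable_fun setT (fun t : measurableTypeR R * (X * X) => h (t.2.1 + (e * clamp t.1) *: t.2.2)).
Proof.
move=> mh; apply: (measurableT_comp mh); apply: measurable_rVP => i.
under eq_fun do rewrite !mxE.
have m2 : measurable_fun setT (fun t : measurableTypeR R * (X * X) => t.2) by exact: measurable_snd.
apply: measurable_funD => //.
  exact: (measurableT_comp (measurable_coord i) (measurableT_comp measurable_fst m2)).
apply: measurable_funM => //.
  apply: measurable_funM => //; exact: (measurableT_comp measurable_clamp measurable_fst).
exact: (measurableT_comp (measurable_coord i) (measurableT_comp measurable_snd m2)).
Qed.

Let measurable_inner2 h : measurable_fun setT h -> (forall z, 0 <= h z) ->
  measurable_fun setT (inner h).
Proof.
move=> mh h0.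
pose f (t : measurableTypeR R * (X * X)) := (h (t.2.1 + (e * clamp t.1) *: t.2.2))%:E.
apply: (@measurable_fun_fubini_tonelli_G _ _ _ _ R P1 f); last by move=> t; rewrite lee_fin.
by apply/measurable_EFinP; exact: measurable_joint.
Qed.

Let inner_ge0 h z : (forall z, 0 <= h z) -> (0 <= inner h z)%E.
Proof. by move=> h0; apply: integral_ge0 => r _; rewrite lee_fin. Qed.

Variables (rho h : X -> R).
Hypotheses (mrho : measurable_fun setT rho) (rho0 : forall y, 0 <= rho y).
Hypotheses (mh : measurable_fun setT h) (h0 : forall y, 0 <= h y).

Let outer (z : X * X) : \bar R := ((rho z.2)%:E * inner h z)%E.

Let measurable_outer : measurable_fun setT outer.
Proof.
apply: emeasurable_funM; last exact: measurable_inner2.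
by apply/measurable_EFinP; exact: (measurableT_comp mrho measurable_snd).
Qed.

Let outer_ge0 z : (0 <= outer z)%E.
Proof. by rewrite mule_ge0 ?lee_fin // inner_ge0. Qed.

Lemma measurable_Av : measurable_fun setT (Av e rho h).
Proof.
rewrite (_ : Av e rho h = fubini_F mu outer).
  exact: measurable_fun_fubini_tonelli_F.
by apply/funext => x; rewrite Av_outer.
Qed.

(** By Tonelli the integral of [Av] is an average of integrals of translates of [h], with total mass
    1, so a bound uniform in the translation is inherited. *)
Lemma weighted_integral_Av_le chi (c : \bar R) : measurable_fun setT chi -> (forall y, 0 <= chi y) ->
  (0 <= c)%E ->
  (\int[mu]_y (rho y)%:E = 1)%E ->
  (forall z, \int[mu]_x ((chi x)%:E * (h (x + z)%R)%:E) <= c)%E ->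
  (\int[mu]_x ((chi x)%:E * Av e rho h x) <= c)%E.
Proof.
move=> mchi chi0 c0 rho1 hc.
have mchiE : measurable_fun setT (fun z : X * X => (chi z.1)%:E).
  by apply/measurable_EFinP; exact: (measurableT_comp mchi measurable_fst).
under eq_integral => x _.
  rewrite Av_outer // -ge0_integralZl //; first over.
  - exact: (measurableT_comp measurable_outer (measurable_pair1 x)).
  - by move=> y _; exact: (outer_ge0 (x, y)).
  - by rewrite lee_fin.
rewrite (fubini_tonelli (fun z : X * X => ((chi z.1)%:E * outer z)%E)); last 2 first.
- exact: emeasurable_funM.
- by move=> z; rewrite mule_ge0 ?lee_fin.
rewrite -[leRHS]mule1 -rho1 -ge0_integralZl //; first last.
- by move=> y _; rewrite lee_fin.
- exact/measurable_EFinP.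
apply: ge0_le_integral => //.
- by move=> y _; apply: integral_ge0 => x _; rewrite mule_ge0 ?lee_fin.
- apply: (measurable_fun_fubini_tonelli_G (fun z : X * X => ((chi z.1)%:E * outer z)%E)).
    exact: emeasurable_funM.
  by move=> z; rewrite mule_ge0 ?lee_fin.
- by apply: emeasurable_funM => //; exact/measurable_EFinP.
move=> y _; rewrite /outer /=.
under eq_integral do rewrite muleCA.
have mi : measurable_fun setT (fun x => inner h (x, y)).
  exact: (measurableT_comp (measurable_inner2 mh h0) (measurable_pair2 y)).
rewrite ge0_integralZl ?lee_fin //; last 2 first.
- by apply: emeasurable_funM => //; exact/measurable_EFinP.
- by move=> x _; rewrite mule_ge0 ?lee_fin // inner_ge0.
rewrite [leRHS]muleC lee_wpmul2l ?lee_fin //.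
pose k (z : X * measurableTypeR R) := ((chi z.1)%:E * (h (z.1 + (e * clamp z.2) *: y)%R)%:E)%E.
have mk : measurable_fun setT k.
  apply: emeasurable_funM.
    by apply/measurable_EFinP; exact: (measurableT_comp mchi measurable_fst).
  apply/measurable_EFinP; apply: (measurableT_comp mh); apply: measurable_rVP => i.
  under eq_fun do rewrite !mxE.
  apply: measurable_funD; first exact: (measurableT_comp (measurable_coord i) measurable_fst).
  apply: measurable_funM => //; apply: measurable_funM => //.
  exact: (measurableT_comp measurable_clamp measurable_snd).
rewrite (_ : \int[mu]_x _ = \int[mu]_x \int[P1]_r k (x, r))%E; last first.
  apply: eq_integral => x _; rewrite /inner /k /= ge0_integralZl ?lee_fin //.
    apply/measurable_EFinP; apply: (measurableT_comp mh).
    exact: (measurableT_comp (measurable_move e x) (measurable_pair2 y)).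
  by move=> r _; rewrite lee_fin.
rewrite (fubini_tonelli (m1 := mu) (m2 := P1) k) //; last by move=> z; rewrite mule_ge0 ?lee_fin.
rewrite -[leRHS]integral_uniform_cst; apply: ge0_le_integral => //.
- by move=> r _; apply: integral_ge0 => x _; rewrite mule_ge0 ?lee_fin.
- apply: (measurable_fun_fubini_tonelli_G k) => //.
  by move=> z; rewrite mule_ge0 ?lee_fin.
- by move=> r _; apply: le_trans (hc ((e * clamp r) *: y)).
Qed.

Lemma integral_Av_le E (c : \bar R) : measurable E -> (0 <= c)%E ->
  (\int[mu]_y (rho y)%:E = 1)%E ->
  (forall z, \int[mu]_(x in E) (h (x + z)%R)%:E <= c)%E ->
  (\int[mu]_(x in E) Av e rho h x <= c)%E.
Proof.
move=> mE c0 rho1 hc; rewrite integral_mkcond epatch_indic.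
under eq_integral do rewrite muleC.
apply: weighted_integral_Av_le => //; last first.
  move=> z; apply: le_trans (hc z); rewrite [leRHS]integral_mkcond epatch_indic.
  by under eq_integral do rewrite muleC.
Qed.

(** Integrating a translate of [h] over [E] amounts to integrating [h] over a translate of [E], a
    set of the same measure. Hence the averages are uniformly integrable, uniformly in [e]. *)
Lemma uniformly_integrable_Av : mu.-integrable setT (EFin \o h) -> (\int[mu]_y (rho y)%:E = 1)%E ->
  forall E (eta : R), measurable E -> 0 <= eta ->
  (forall F, measurable F -> mu F = mu E -> (\int[mu]_(x in F) (h x)%:E <= eta%:E)%E) ->
  (\int[mu]_(x in E) Av e rho h x <= eta%:E)%E.
Proof.
move=> ih rho1 E eta mE eta0 hF; apply: integral_Av_le; rewrite ?lee_fin // => z.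
pose F : set X := (fun x => x - z) @^-1` E.
have mF : measurable F.
  by rewrite /F -[X in measurable X]setTI; apply: measurable_shift.
have muF : mu F = mu E by rewrite /F (lebesgue_rV_shift (- z) mE).
apply: le_trans (hF F mF muF).
rewrite integral_mkcond [leRHS]integral_mkcond -(@ge0_integral_shift _ _ z ((fun x => (h x)%:E) \_ F)).
- apply: le_of_eq; apply: eq_integral => x _.
  rewrite !patchE; congr (if _ then _ else _).
  by apply/idP/idP => /set_mem Ex; apply/mem_set; move: Ex; rewrite /F /= addrK.
- have mhF : measurable_fun F (fun x => (h x)%:E) by apply: measurable_funTS; exact/measurable_EFinP.
  exact: ((measurable_restrictT _ mF).1 mhF).
- by move=> x; rewrite patchE; case: ifP => // _; rewrite lee_fin.
Qed.

End average_integral.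

(** * Mollification of limits of test functions *)

Section test_limits.
Context {R : realType} {n : nat}.
Local Notation mu := (lebesgue_rV n : {sigma_finite_measure set 'rV[R]_n -> \bar R}).
Local Notation P1 := (uniform_prob (@lt12 R)).
Local Notation M := (P1 \x mu)%E.
Local Notation T := (measurableTypeR R * 'rV[R]_n)%type.
Local Notation L1T u := (mu.-integrable setT (EFin \o u)).
Implicit Types (u v rho phi : 'rV[R]_n -> R) (G : 'I_n -> 'rV[R]_n -> R) (x : 'rV[R]_n).
Implicit Types Omega : set 'rV[R]_n.

(* The space W^{1,1}_0(Omega), as a set of pairs (function, gradient) extended by zero. *)
Definition test_limit Omega u G :=
  [/\ L1T u /\ forall i, L1T (G i),
      forall x, ~ Omega x -> u x = 0 /\ forall i, G i x = 0 &
      forall delta : R, 0 < delta -> exists2 phi, test_functions Omega phi &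
        (\int[mu]_x (`|u x - phi x|%R)%:E < delta%:E)%E /\
        forall i, (\int[mu]_x (`|G i x - partial i phi x|%R)%:E < delta%:E)%E].

Lemma test_functions_setT Omega phi : test_functions Omega phi -> test_functions setT phi.
Proof. by move=> [sp cp _]; split => //; exact: subsetT. Qed.

Section fixed_kernel.
Variable rho : 'rV[R]_n -> R.
Hypotheses (trho : test_functions setT rho) (rho0 : forall y, 0 <= rho y).

Let mrho := smooth_measurable (test_smooth trho).

(** True for test functions by [partial_moll_test]. For fixed [e] both sides are controlled at the
    point [x] by [L^1] norms, with constants depending on [e], so the identity passes to the
    limit. *)
Lemma partial_moll_limit Omega u G e x i : 0 < e -> test_limit Omega u G ->
  partial i (moll e rho u) x = moll e rho (G i) x.
Proof.
move=> e0 [[iu iG] _ lim]; have [B1 B10 hB1] := test_bounded trho.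
have [B2 B20 hB2] := test_partial_bounded trho.
apply/eqP; rewrite -subr_eq0 -normr_le0; apply/ler_addgt0Pl => eta eta0; rewrite addr0.
pose c := e^-1 * (e^-1 ^+ n * B2) + e^-1 ^+ n * B1.
have en0 : 0 <= e^-1 ^+ n by rewrite exprn_ge0 // invr_ge0 ltW.
have c0 : 0 <= c by rewrite addr_ge0 // !mulr_ge0 ?invr_ge0 // ltW.
have [phi tphi [uphi Gphi]] := lim (eta / (c + 1)) (divr_gt0 eta0 (ltr_wpDl c0 ltr01)).
have tphiT := test_functions_setT tphi; have iphi := test_integrable tphiT.
have ip := test_integrable (test_partial i tphiT).
have iup : L1T (fun y => u y - phi y) by exact: rintegrableB.
have iGp : L1T (fun y => G i y - partial i phi y) by exact: rintegrableB.
have E1 : partial i (moll e rho u) x - moll e rho (partial i phi) x =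
    partial i (moll e rho (fun y => u y - phi y)) x.
  rewrite -(partial_moll_test e0 trho) // /partial.
  rewrite (_ : moll e rho (fun y => u y - phi y) = moll e rho u - moll e rho phi); last first.
    by apply/funext => y; rewrite -(mollB e0 trho).
  by rewrite deriveB //; apply: smooth_derivable; exact: moll_smooth.
have E2 : moll e rho (G i) x - moll e rho (partial i phi) x =
    moll e rho (fun y => G i y - partial i phi y) x by exact: (mollB e0 trho).
rewrite (_ : _ - _ = (partial i (moll e rho u) x - moll e rho (partial i phi) x) -
   (moll e rho (G i) x - moll e rho (partial i phi) x)); last by rewrite opprB addrA subrK.
rewrite E1 E2; apply: le_trans (ler_normB _ _) _; rewrite -lee_fin EFinD.
have n1 := norm_partial_moll_L1 e0 trho x i iup hB2.
have n2 : ((`|moll e rho (fun y => G i y - partial i phi y) x|%R)%:E <=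
    (e^-1 ^+ n * B1)%:E * \int[mu]_y (`|G i y - partial i phi y|%R)%:E)%E.
  apply: le_trans (norm_moll_le e0 trho rho0 x iGp) _.
  apply: integral_kernel_le => //; first by apply: measurableT_comp => //; exact: rintegrable_measurable iGp.
  by move=> y; apply: le_trans (ler_norm _) (hB1 y).
apply: (@le_trans _ _ ((e^-1 * (e^-1 ^+ n * B2))%:E * (eta / (c + 1))%:E + (e^-1 ^+ n * B1)%:E * (eta / (c + 1))%:E)%E).
  apply: leeD; [apply: le_trans n1 _|apply: le_trans n2 _].
    by rewrite lee_wpmul2l ?lee_fin ?mulr_ge0 ?invr_ge0 ?(ltW e0) ?(ltW B20) ?exprn_ge0 ?invr_ge0 ?(ltW e0) // ltW.
  by rewrite lee_wpmul2l ?lee_fin ?mulr_ge0 ?(ltW B10) // ltW.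
rewrite -!EFinM -EFinD lee_fin -mulrDl -/c mulrCA ler_piMr ?(ltW eta0) //.
by rewrite ler_pdivrMr ?mul1r ?lerDl // ltr_wpDl.
Qed.

Hypothesis rho1 : (\int[mu]_y (rho y)%:E = 1)%E.
Variable B : R.
Hypotheses (B0 : 0 < B) (rhoB : forall y, B < `|y| -> rho y = 0).

(** The kernel has mass 1 and moves points by at most [2 e B] in each coordinate, the scale being at
    most [2 e]. *)
Lemma moll_test_close phi (L : R) e x : 0 < e -> 0 <= L -> test_functions setT phi ->
  (forall i y, `|partial i phi y| <= L) ->
  `|moll e rho phi x - phi x| <= L * (n%:R * (2 * e * B)).
Proof.
move=> e0 L0 tphi hL; have iphi := test_integrable tphi; have mphi := smooth_measurable (test_smooth tphi).
have irho : M.-integrable setT (EFin \o (fun t : T => rho t.2)).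
  by apply: integrable_snd; exact: test_integrable trho.
have rhoM : (\int[M]_t rho t.2)%R = 1.
  have h := @Av_cst _ _ e rho 1 x mrho rho0 ler01.
  rewrite mul1e rho1 in h; apply: EFin_inj; rewrite EFin_Rintegral_int // -h /Av.
  by apply: eq_integral => t _; rewrite /shift_form mulr1.
have [Bp _ hBp] := test_bounded tphi.
have ish : M.-integrable setT (EFin \o shift_form e rho phi x).
  apply: (@rintegrable_mul_bounded _ _ _ _ _ measurableT _ _ Bp) => //.
  exact: (measurableT_comp mphi (measurable_move e x)).
have icst : M.-integrable setT (EFin \o (fun t : T => phi x * rho t.2)) by exact: rintegrableZ.
have E c : c = (\int[M]_t (c * rho t.2))%R by rewrite RintegralZl // rhoM mulr1.
rewrite (moll_shift e0 trho rho0 x iphi) [X in _ - X]E -RintegralB //.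
apply: le_trans (le_normr_Rintegral measurableT (rintegrableB measurableT ish icst)) _.
rewrite [leRHS]E; apply: le_Rintegral => //.
- by apply: rintegrable_norm; exact: rintegrableB.
- exact: rintegrableZ.
move=> t _; rewrite /shift_form [phi x * _]mulrC -mulrBr normrM ger0_norm // mulrC.
have [tB|tB] := leP `|t.2| B; last by rewrite rhoB // !mulr0.
rewrite ler_wpM2r //; apply: le_trans (smooth_lipschitz x _ (test_smooth tphi) hL) _.
rewrite ler_wpM2l // mulr_natl -[X in _ *+ X]card_ord -sumr_const; apply: ler_sum => i _.
apply: le_trans (coord_le_norm _ i) _; rewrite normrZ gtr0_norm ?clamp_gt0 //; apply: ler_pM => //.
  by rewrite ltW // clamp_gt0.
by rewrite mulrC ler_wpM2r ?(ltW e0) // clamp_le2.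
Qed.

Lemma moll_L1_close v D (eta : R) : L1T v ->
  (forall delta : R, 0 < delta -> exists2 phi, test_functions setT phi &
     (\int[mu]_x (`|v x - phi x|%R)%:E < delta%:E)%E) ->
  measurable D -> (mu D < +oo)%E -> 0 < eta ->
  exists2 e1 : R, 0 < e1 & forall e, 0 < e < e1 ->
    (\int[mu]_(x in D) (`|moll e rho v x - v x|%R)%:E < eta%:E)%E.
Proof.
move=> iv lim mD Doo eta0.
have [phi tphi vphi] := lim _ (divr_gt0 eta0 (ltr0n R 4)).
have [L L0 hL] := test_partial_bounded tphi; have iphi := test_integrable tphi.
have ivp : L1T (fun y => v y - phi y) by exact: rintegrableB.
have mh : measurable_fun setT (fun y => `|v y - phi y|).
  by apply: measurableT_comp => //; exact: rintegrable_measurable ivp.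
have Dfin : mu D \is a fin_num by rewrite ge0_fin_numE.
set m := fine (mu D); have m0 : 0 <= m by exact: fine_ge0.
pose k := L * (n%:R * (2 * B)) * m.
have k0 : 0 <= k by rewrite !mulr_ge0 // ltW.
exists (eta / 4 / (k + 1)); first by rewrite !divr_gt0 // ltr_wpDl.
move=> e /andP[e0]; rewrite ltr_pdivlMr ?ltr_wpDl // => ek.
pose c := L * (n%:R * (2 * e * B)).
have c0 : 0 <= c by rewrite !mulr_ge0 // ltW.
apply: (@le_lt_trans _ _ (\int[mu]_(x in D) (Av e rho (fun y => `|v y - phi y|%R) x + (c%:E + (`|v x - phi x|%R)%:E)))%E).
  apply: ge0_le_integral => //.
  - apply: measurable_funTS; apply/measurable_EFinP; apply: measurableT_comp => //.
    apply: measurable_funB; last exact: rintegrable_measurable iv.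
    by apply: smooth_measurable; exact: moll_smooth.
  - apply: emeasurable_funD; first by apply: measurable_funTS; exact: measurable_Av.
    apply: emeasurable_funD => //; apply: measurable_funTS; exact/measurable_EFinP.
  move=> x _; apply: (@le_trans _ _ ((`|moll e rho (fun y => v y - phi y) x|%R)%:E + (c%:E + (`|v x - phi x|%R)%:E))%E); last first.
    by apply: leeD => //; exact: norm_moll_le.
  rewrite -!EFinD lee_fin -(mollB e0 trho) //.
  have := moll_test_close x e0 (ltW L0) tphi hL; rewrite -/c => h.
  rewrite (_ : _ - v x = (moll e rho v x - moll e rho phi x) + ((moll e rho phi x - phi x) - (v x - phi x))); last by ring.
  apply: le_trans (ler_normD _ _) _; rewrite lerD2l; apply: le_trans (ler_normB _ _) _.
  by rewrite lerD2r.
rewrite ge0_integralD //; first last.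
- apply: emeasurable_funD => //; apply: measurable_funTS; exact/measurable_EFinP.
- by move=> x _; rewrite -EFinD lee_fin addr_ge0.
- by apply: measurable_funTS; exact: measurable_Av.
- by move=> x _; apply: Av_ge0.
rewrite [X in (_ + X)%E]ge0_integralD //; last by apply: measurable_funTS; exact/measurable_EFinP.
have mhE : measurable_fun setT (fun y => (`|v y - phi y|%R)%:E) by exact/measurable_EFinP.
have h1 : (\int[mu]_(x in D) Av e rho (fun y => `|v y - phi y|%R) x <= (eta / 4)%:E)%E.
  apply: integral_Av_le => //; first by rewrite lee_fin divr_ge0 // ltW.
  move=> z; apply: le_trans (ltW vphi).
  rewrite -(@ge0_integral_shift _ _ z (fun y => (`|v y - phi y|%R)%:E)) //.
  apply: ge0_subset_integral => //.
  exact: (measurableT_comp mhE (measurable_shift z)).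
have h2 : (\int[mu]_(x in D) c%:E <= (eta / 4)%:E)%E.
  rewrite integral_cst // -[X in (_ * X)%E](fineK Dfin) -/m -EFinM lee_fin.
  apply: le_trans (ltW ek); rewrite /c (_ : _ * m = e * k); last by rewrite /k; ring.
  by rewrite ler_wpM2l ?(ltW e0) // lerDl.
have h3 : (\int[mu]_(x in D) (`|v x - phi x|%R)%:E <= (eta / 4)%:E)%E.
  by apply: le_trans (ltW vphi); exact: ge0_subset_integral.
apply: le_lt_trans (leeD h1 (leeD h2 h3)) _.
by rewrite -!EFinD lte_fin; lra.
Qed.

End fixed_kernel.
End test_limits.

Lemma powR_add_le {R : realType} (s t r : R) : 0 <= s -> 0 <= t -> 0 <= r ->
  (s + t) `^ r <= 2 `^ r * (s `^ r + t `^ r).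
Proof.
move=> s0 t0 r0; wlog st : s t s0 t0 / s <= t.
  by move=> H; have [st|/ltW ts] := leP s t; [exact: H|rewrite addrC [s `^ r + _]addrC; exact: H].
apply: (@le_trans _ _ ((2 * t) `^ r)).
  by apply: ge0_ler_powR; rewrite ?nnegrE ?addr_ge0 ?mulr_ge0 // mulr2n mulrDl !mul1r lerD2r.
by rewrite powRM // ler_wpM2l ?powR_ge0 // lerDr powR_ge0.
Qed.

Lemma phase_add_le {R : realType} (w s t y p q : R) : 0 <= w -> 0 <= s -> 0 <= t ->
  0 <= y <= s + t -> 0 <= p -> 0 <= q ->
  y `^ p + w * y `^ q <=
  (2 `^ p + 2 `^ q) * ((s `^ p + w * s `^ q) + (t `^ p + w * t `^ q)).
Proof.
move=> w0 s0 t0 /andP[y0 yst] p0 q0.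
have le_r (r : R) : 0 <= r -> y `^ r <= 2 `^ r * (s `^ r + t `^ r).
  move=> r0; apply: le_trans (powR_add_le s0 t0 r0).
  by apply: ge0_ler_powR; rewrite ?nnegrE ?addr_ge0.
apply: le_trans (lerD (le_r p p0) (ler_wpM2l w0 (le_r q q0))) _.
rewrite mulrCA [leRHS]mulrDl; apply: lerD; rewrite ler_wpM2l ?powR_ge0 //.
  by rewrite addrACA lerDl -mulrDr mulr_ge0 // addr_ge0 ?powR_ge0.
by rewrite mulrDr addrACA lerDr addr_ge0 ?powR_ge0.
Qed.

Lemma finite_small {R : realType} (I : finType) (P : I -> R -> Prop) :
  (forall i, exists2 e1, 0 < e1 & forall e, 0 < e < e1 -> P i e) ->
  exists2 e1, 0 < e1 & forall e, 0 < e < e1 -> forall i, P i e.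
Proof.
move=> h; have [E hE] := choice (fun i => let: ex_intro2 b b0 k := h i in
  ex_intro (fun b => 0 < b /\ forall e, 0 < e < b -> P i e) b (conj b0 k)).
have E0 i : 0 < E i := (hE i).1.
have S0 : 0 < 1 + \sum_i (E i)^-1.
  by rewrite ltr_pwDl // sumr_ge0 // => i _; rewrite invr_ge0 ltW.
(* A positive lower bound of all the [E i], which also makes sense for an empty index type. *)
exists (1 + \sum_i (E i)^-1)^-1 => [|e /andP[e0 eS] i]; first by rewrite invr_gt0.
apply: (hE i).2; rewrite e0 /=; apply: lt_le_trans eS _.
rewrite -[E i]invrK lef_pV2 ?posrE ?invr_gt0 //.
rewrite (bigD1 i) //= addrCA lerDl addr_ge0 // sumr_ge0 // => j _.
by rewrite invr_ge0 ltW.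
Qed.

Lemma relatively_compact_lty {R : realType} {n : nat} (Omega : set 'rV[R]_n) :
  measurable Omega -> compact (closure Omega) -> (lebesgue_rV n Omega < +oo)%E.
Proof.
move=> mO cO; have mc : measurable (closure Omega).
  by apply: closed_measurable_rV; exact: closed_closure.
apply: (@le_lt_trans _ _ (lebesgue_rV n (closure Omega))).
  by apply: le_measure; rewrite ?inE //; exact: subset_closure.
by apply: bounded_lebesgue_lty => //; exact: compact_bounded.
Qed.

(** * Convergence of mollifications in energy *)

Section phase_energy.
Context {R : realType} {n : nat}.
Local Notation mu := (lebesgue_rV n : {sigma_finite_measure set 'rV[R]_n -> \bar R}).
Local Notation L1T u := (mu.-integrable setT (EFin \o u)).
Implicit Types (u v g rho phi : 'rV[R]_n -> R) (G : 'I_n -> 'rV[R]_n -> R) (x : 'rV[R]_n).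

(** The sum of absolute values is additive over coordinates, hence commutes with averages, and is
    comparable with the Euclidean norm; the latter returns in [double_phase_close], where it must
    carry the constant 1. *)
Definition norm1 G x := \sum_i `|G i x|.

Lemma norm1_ge0 G x : 0 <= norm1 G x.
Proof. exact: sumr_ge0. Qed.

Lemma measurable_norm1 G : (forall i, measurable_fun setT (G i)) -> measurable_fun setT (norm1 G).
Proof. by move=> mG; apply: measurable_sum => i; exact: measurableT_comp. Qed.

Variables (Omega U : set 'rV[R]_n) (a : 'rV[R]_n -> R) (p q : R).

Definition phase_energy g : \bar R := (\int[mu]_(x in Omega) (g x `^ p + a x * g x `^ q)%:E)%E.

Hypotheses (oO : open Omega) (oU : open U) (cO : compact (closure Omega)) (OU : closure Omega `<=` U).
Hypotheses (sa : smooth_on U a) (a0 : forall x, U x -> 0 <= a x) (p1 : 1 <= p) (q1 : 1 <= q).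

Let OU' x : Omega x -> U x.
Proof. by move=> Ox; apply/OU/subset_closure. Qed.

Let mO : measurable Omega.
Proof. exact: open_measurable_rV. Qed.

Lemma measurable_phase g : measurable_fun setT g ->
  measurable_fun Omega (fun x => (g x `^ p + a x * g x `^ q)%:E).
Proof.
move=> mg; apply/measurable_EFinP; apply: measurable_funD.
  by apply: measurable_funTS; exact: (measurableT_comp (measurable_powR p) mg).
apply: measurable_funM.
  by apply: continuous_measurable_rV => // x Ox; apply: (smooth_on_continuous (U := U)) => //; exact: OU'.
by apply: measurable_funTS; exact: (measurableT_comp (measurable_powR q) mg).
Qed.

Lemma phase_ge0 (g : 'rV[R]_n -> R) x : Omega x -> (0 <= (g x `^ p + a x * g x `^ q)%:E)%E.
Proof. by move=> Ox; rewrite lee_fin addr_ge0 ?mulr_ge0 ?powR_ge0 //; exact/a0/OU'. Qed.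

Let p0 : 0 <= p. Proof. exact: le_trans p1. Qed.
Let q0 : 0 <= q. Proof. exact: le_trans q1. Qed.

Let finO : (mu Omega < +oo)%E.
Proof. exact: relatively_compact_lty. Qed.

(* The mollified gradients converge in [L1], so the set where they are not close to [G]
   is small; on it the energy is bounded by averages of a fixed integrable function, which
   are uniformly integrable because the averages are taken over translations. *)
Lemma mollify_energy u G rho (Mu B eta : R) : test_limit Omega u G -> (forall x, `|u x| <= Mu) ->
  (phase_energy (norm1 G) < +oo)%E ->
  test_functions setT rho -> (forall y, 0 <= rho y) -> (\int[mu]_y (rho y)%:E = 1)%E ->
  0 < B -> (forall y, B < `|y| -> rho y = 0) -> 0 < eta ->
  exists2 e1 : R, 0 < e1 & forall e, 0 < e < e1 ->
    (phase_energy (norm1 (fun i x => partial i (moll e rho u) x - G i x)%R) < eta%:E)%E.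
Proof.
move=> lim uM Efin trho rho0 rho1 B0 rhoB eta0; have [[iu iG] off lim'] := lim.
have mG i := rintegrable_measurable (iG i).
pose g := norm1 G; have mg : measurable_fun setT g by exact: measurable_norm1.
have g0 x : 0 <= g x by exact: norm1_ge0.
have gO x : ~ Omega x -> g x = 0.
  by move=> /off[_ G0]; rewrite /g /norm1 big1 // => i _; rewrite G0 normr0.
have mrho := smooth_measurable (test_smooth trho).
have Mu0 : 0 <= Mu by apply: le_trans (uM 0).
pose C := \sum_i fine (\int[mu]_y (`|partial i rho y|%R)%:E)%E.
have C0 : 0 <= C by apply: sumr_ge0 => i _; apply: fine_ge0; exact: integral_ge0.
have hC i : (\int[mu]_y (`|partial i rho y|%R)%:E <= C%:E)%E.
  rewrite -(@fineK _ (\int[mu]_y (`|partial i rho y|%R)%:E)%E).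
    rewrite lee_fin /C (bigD1 i) //= lerDl; apply: sumr_ge0 => j _.
    by apply: fine_ge0; exact: integral_ge0.
  apply: integrable_fin_num => //; apply: rintegrable_norm.
  exact: (test_integrable (test_partial i trho)).
pose Cu := n%:R * (Mu * C); have Cu0 : 0 <= Cu by rewrite !mulr_ge0.
have [C1 [e1 [C10 e10 est1]]] := pointwise_estimate oO oU cO OU sa a0 q1 B0 Cu0.
have s1 : smooth_on U (fun=> 1 : R) by move=> s x _; exact: (smooth_cst 1 s).
(* The same estimate with weight 1 and exponent [p] controls the unweighted term. *)
have [C2 [e2 [C20 e20 est2]]] := pointwise_estimate oO oU cO OU s1 (fun _ _ => ler01) p1 B0 Cu0.
pose hq y := weight Omega a y * g y `^ q.
pose hp y := weight Omega (fun=> 1 : R) y * g y `^ p.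
pose h y := hp y + hq y + g y.
have mhq : measurable_fun setT hq by exact: (measurable_weighted _ oO OU sa).
have mhp : measurable_fun setT hp by exact: (measurable_weighted _ oO OU s1).
have mh : measurable_fun setT h by do 2 apply: measurable_funD => //.
have hq0 y : 0 <= hq y by rewrite mulr_ge0 ?powR_ge0 // (weight_ge0 OU a0).
have hp0 y : 0 <= hp y by rewrite mulr_ge0 ?powR_ge0 // (weight_ge0 OU (fun _ _ => ler01)).
have h0 y : 0 <= h y by rewrite !addr_ge0.
have ih : L1T h.
  apply: rintegrableD => //; last by apply: rintegrable_sum => // i; exact: rintegrable_norm.
  apply/integrableP; split; first by apply/measurable_EFinP; exact: measurable_funD.
  apply: le_lt_trans Efin; rewrite /phase_energy [leRHS]integral_mkcond.
  apply: le_of_eq; apply: eq_integral => y _.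
  rewrite /= ger0_norm ?addr_ge0 // patchE /hp /hq /weight !patchE.
  by case: ifPn => _; rewrite ?mul1r // !mul0r addr0.
have [Ma Ma0 hMa] := @continuous_compact_bounded _ _ (closure Omega) a cO
  (fun x Kx => smooth_on_continuous sa (OU Kx)).
pose m := fine (mu Omega); have mE : mu Omega = m%:E.
  by rewrite fineK // ge0_fin_numE.
have m0 : 0 <= m by exact: fine_ge0.
pose K := (2 `^ p + 2 `^ q) * (1 + 2 * C1 + 2 * C2).
have K0 : 0 <= K by rewrite mulr_ge0 ?addr_ge0 ?powR_ge0 // mulr_ge0.
have eta4 : 0 < eta / 4 by rewrite divr_gt0.
pose eta' := eta / 4 / (K + 1).
have eta'0 : 0 < eta' by rewrite divr_gt0 // ltr_wpDl.
have [tau tau0 htau] := uniformly_integrable h0 ih eta'0.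
(* Where [d x <= delta <= 1], both powers of [d x] are at most [delta], so the energy there is at
   most [delta (1 + Ma) m]. The added 1 covers a null [Omega]. *)
pose delta := Num.min 1 (eta / 4 / ((1 + Ma) * m + 1)).
have den0 : 0 < (1 + Ma) * m + 1 by rewrite ltr_wpDl // mulr_ge0 // addr_ge0 // ltW.
have delta0 : 0 < delta by rewrite lt_min ltr01 divr_gt0.
have delta1 : delta <= 1 by rewrite ge_min lexx.
have deltam : delta * ((1 + Ma) * m) <= eta / 4.
  apply: (@le_trans _ _ (delta * ((1 + Ma) * m + 1))); first by rewrite ler_wpM2l ?(ltW delta0) // lerDl.
  by rewrite -ler_pdivlMr // ge_min lexx orbT.
(* Dividing by [n + 1] makes the sum over the [n] coordinates strictly smaller than [delta tau],
   even for [n = 0]. Chebyshev's inequality then gives the exceptional set measure less than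
   [tau]. *)
have dt0 : 0 < delta * tau / n.+1%:R by rewrite divr_gt0 // mulr_gt0.
have [e3 e30 close] := @finite_small _ _ (fun i e =>
    (\int[mu]_(x in Omega) (`|moll e rho (G i) x - G i x|%R)%:E < (delta * tau / n.+1%:R)%:E)%E)
  (fun i => moll_L1_close trho rho0 rho1 B0 rhoB (iG i)
    (fun d d0 => let: ex_intro2 phi tphi hphi := lim' d d0 in
       ex_intro2 _ _ (partial i phi) (test_partial i (test_functions_setT tphi)) (hphi.2 i)) mO finO dt0).
exists (Num.min e1 (Num.min e2 e3)); first by rewrite !lt_min e10 e20.
move=> e; rewrite !lt_min => /and4P[e0 ee1 ee2 ee3].
have pm i x : partial i (moll e rho u) x = moll e rho (G i) x.
  exact: (partial_moll_limit trho rho0 x i e0 lim).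
pose z x := norm1 (fun i => moll e rho (G i)) x.
have z0 x : 0 <= z x by exact: norm1_ge0.
have zCu x : z x <= Cu / e.
  rewrite /z /norm1 /Cu -mulrA mulr_natl -[X in _ *+ X]card_ord -sumr_const.
  apply: ler_sum => i _; rewrite -pm mulrC.
  exact: (norm_partial_moll_bounded e0 trho x iu uM (hC i)).
have zAv x : ((z x)%:E <= Av e rho g x)%E.
  rewrite /z /norm1 -sumEFin; apply: (@le_trans _ _ (\sum_i Av e rho (fun y => `|G i y|%R) x)%E).
    by apply: lee_sum => i _; exact: norm_moll_le.
  rewrite /Av -ge0_integral_sum //; last 2 first.
  - by move=> i; apply/measurable_EFinP; apply: measurable_shift_form => //; exact: measurableT_comp.
  - by move=> i t _; rewrite lee_fin mulr_ge0.
  apply: le_of_eq; apply: eq_integral => t _.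
  by rewrite sumEFin /shift_form -mulr_sumr.
have zh x : Omega x -> ((a x * z x `^ q + z x `^ p)%:E <= ((2 * C1 + 2 * C2)%:E * Av e rho h x))%E.
  move=> Ox; have hh (f : 'rV[R]_n -> R) : measurable_fun setT f -> (forall y, 0 <= f y) -> (forall y, f y <= h y) ->
      (Av e rho f x <= Av e rho h x)%E by move=> mf f0 fh; exact: Av_mono.
  have l1 := est1 e rho g x (z x) _ Ox trho rho0 rhoB rho1 mg g0 gO (z0 x) (zCu x) (zAv x).
  have l2 := est2 e rho g x (z x) _ Ox trho rho0 rhoB rho1 mg g0 gO (z0 x) (zCu x) (zAv x).
  have Ag : (Av e rho g x <= Av e rho h x)%E by apply: hh => // y; rewrite lerDr addr_ge0.
  have Aq : (Av e rho hq x <= Av e rho h x)%E by apply: hh => // y; rewrite /h addrAC lerDr addr_ge0.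
  have Ap : (Av e rho hp x <= Av e rho h x)%E by apply: hh => // y; rewrite /h -addrA lerDl addr_ge0.
  have A0 : (0 <= Av e rho h x)%E by exact: Av_ge0.
  have twice (c : R) (f : 'rV[R]_n -> R) : 0 <= c -> (Av e rho f x <= Av e rho h x)%E ->
      (c%:E * (Av e rho f x + Av e rho g x) <= (2 * c)%:E * Av e rho h x)%E.
    move=> c0 Af; apply: (@le_trans _ _ (c%:E * (Av e rho h x + Av e rho h x))%E).
      by rewrite lee_wpmul2l ?lee_fin // leeD.
    by rewrite ge0_muleDr // -ge0_muleDl ?lee_fin // -EFinD mulr2n mulrDl !mul1r.
  rewrite EFinD EFinD ge0_muleDl ?lee_fin ?mulr_ge0 //; apply: leeD.
    by apply: le_trans (l1 _) (twice _ _ C10 Aq); rewrite e0.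
  rewrite -[X in X%:E]mul1r; by apply: le_trans (l2 _) (twice _ _ C20 Ap); rewrite e0.
pose d := norm1 (fun i x => partial i (moll e rho u) x - G i x)%R.
have md : measurable_fun setT d.
  apply: measurable_norm1 => i; apply: measurable_funB => //.
  by apply: smooth_partial_measurable; exact: moll_smooth.
have d0 x : 0 <= d x by exact: norm1_ge0.
have dzg x : d x <= z x + g x.
  rewrite /d /z /g /norm1 -big_split /=; apply: ler_sum => i _.
  by rewrite pm; exact: ler_normB.
have Fh x : Omega x -> ((d x `^ p + a x * d x `^ q)%:E <= (K%:E * ((h x)%:E + Av e rho h x)))%E.
  move=> Ox; have ax0 := a0 (OU' Ox).
  have A0 : (0 <= Av e rho h x)%E by exact: Av_ge0.
  have K1 : 0 <= 2 `^ p + 2 `^ q :> R by rewrite addr_ge0 ?powR_ge0.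
  apply: (@le_trans _ _ ((2 `^ p + 2 `^ q)%:E * ((h x)%:E + (a x * z x `^ q + z x `^ p)%:E))%E).
    rewrite -EFinD -EFinM lee_fin.
    have dz : 0 <= d x <= g x + z x by rewrite d0 addrC dzg.
    apply: le_trans (phase_add_le ax0 (g0 x) (z0 x) dz p0 q0) _.
    rewrite ler_wpM2l // [a x * _ + _]addrC lerD2r.
    by rewrite /h /hp /hq !weightE // mul1r lerDl.
  rewrite /K EFinM -muleA lee_wpmul2l ?lee_fin //.
  rewrite ge0_muleDr ?lee_fin //; apply: leeD.
    by rewrite -EFinM lee_fin ler_peMl // -addrA lerDl addr_ge0 // mulr_ge0.
  by apply: le_trans (zh x Ox) _; rewrite lee_wpmul2r // lee_fin -addrA lerDr.
pose E := Omega `&` [set x | delta < d x].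
have mE' : measurable E.
  by apply: measurableI => //; rewrite -[X in measurable X]setTI; apply: measurable_fun_ltr.
have dE : (\int[mu]_(x in Omega) (d x)%:E < (delta * tau)%:E)%E.
  apply: (@le_lt_trans _ _ (\sum_(i < n) (delta * tau / n.+1%:R)%:E)%E); last first.
    rewrite sumEFin sumr_const card_ord lte_fin -[_ *+ n]mulr_natr mulrAC ltr_pdivrMr //.
    by rewrite ltr_pM2l ?mulr_gt0 // ltr_nat.
  rewrite /d /norm1; under eq_integral do rewrite -sumEFin.
  rewrite ge0_integral_sum //; last first.
    move=> i; apply/measurable_EFinP; apply: measurable_funTS; apply: measurableT_comp => //.
    apply: measurable_funB => //.
    by apply: smooth_partial_measurable; exact: moll_smooth.
  apply: lee_sum => i _; under eq_integral do rewrite pm.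
  by apply/ltW/close; rewrite e0.
have muE : (mu E < tau%:E)%E.
  have : (delta%:E * mu E < (delta * tau)%:E)%E.
    apply: le_lt_trans dE; rewrite -integral_cst //.
    apply: (@le_trans _ _ (\int[mu]_(x in E) (d x)%:E)%E).
      apply: ge0_le_integral => //; first by move=> x _; rewrite lee_fin ltW.
        by apply/measurable_EFinP; exact: measurable_funTS.
      by move=> x [_ /ltW]; rewrite lee_fin.
    apply: ge0_subset_integral => //.
      by apply/measurable_EFinP; exact: measurable_funTS.
      by move=> x _; rewrite lee_fin.
    by move=> x [].
  by rewrite EFinM lte_pmul2l // lte_fin.
have mD : measurable (Omega `\` E) by exact: measurableD.
have mF := measurable_phase md.
have OE : Omega = E `|` (Omega `\` E).
  by rewrite setDUK // => x [].
rewrite /phase_energy [X in integral _ X]OE ge0_integral_setU //; first last.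
- by apply/disj_setPS => x [Ex [_ nEx]].
- by rewrite -OE => x; exact: phase_ge0.
- by rewrite -OE.
have subE : E `<=` Omega by move=> x [].
have iE : (\int[mu]_(x in E) (d x `^ p + a x * d x `^ q)%:E <= (eta / 2)%:E)%E.
  apply: (@le_trans _ _ (\int[mu]_(x in E) (K%:E * ((h x)%:E + Av e rho h x)))%E).
    apply: ge0_le_integral => //.
    - by move=> x /subE; exact: phase_ge0.
    - exact: measurable_funS mF.
    - apply: measurable_funeM; apply: emeasurable_funD.
        by apply: measurable_funTS; exact/measurable_EFinP.
      by apply: measurable_funTS; exact: measurable_Av.
    - by move=> x /subE; exact: Fh.
  have mAv : measurable_fun E (Av e rho h) by apply: measurable_funTS; exact: measurable_Av.
  have mhE : measurable_fun E (EFin \o h) by apply: measurable_funTS; exact/measurable_EFinP.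
  rewrite ge0_integralZl ?lee_fin //; last 2 first.
  - exact: emeasurable_funD.
  - by move=> x _; rewrite adde_ge0 ?lee_fin // Av_ge0.
  rewrite ge0_integralD //; last 2 first.
  - by move=> x _; rewrite lee_fin.
  - by move=> x _; exact: Av_ge0.
  apply: (@le_trans _ _ (K%:E * (eta'%:E + eta'%:E))%E).
    rewrite lee_wpmul2l ?lee_fin // leeD //; first exact: htau.
    apply: uniformly_integrable_Av => //; first exact: ltW.
    by move=> F mF' EF; apply: htau => //; apply: le_lt_trans muE; exact: le_of_eq.
  rewrite -EFinD -EFinM lee_fin /eta'.
  have : K * (eta / 4 / (K + 1)) <= eta / 4.
    by rewrite mulrCA ler_piMr ?(ltW eta4) // ler_pdivrMr ?mul1r ?lerDl // ltr_wpDl.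
  by move=> h4; rewrite mulrDr (_ : eta / 2 = eta / 4 + eta / 4) ?lerD //; field.
have iD : (\int[mu]_(x in Omega `\` E) (d x `^ p + a x * d x `^ q)%:E <= (eta / 4)%:E)%E.
  apply: (@le_trans _ _ (\int[mu]_(x in Omega `\` E) (delta * (1 + Ma))%:E)%E).
    apply: ge0_le_integral => //.
    - by move=> x [Ox _]; exact: phase_ge0.
    - by apply: measurable_funS mF => // x [].
    move=> x [Ox nE]; rewrite lee_fin mulrDr mulr1.
    have dx : d x <= delta by rewrite leNgt; apply/negP => dd; apply: nE.
    have dr (r : R) : 1 <= r -> d x `^ r <= delta.
      move=> r1; apply: (@le_trans _ _ (delta `^ r)).
        by apply: ge0_ler_powR; rewrite ?nnegrE ?(ltW delta0) ?(le_trans ler01 r1).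
      rewrite -[X in _ <= X]powRr1 ?(ltW delta0) // -[r](subrK 1) powRD; last by rewrite (gt_eqF delta0) implybT.
      rewrite ler_piMl ?powR_ge0 // -[leRHS](_ : 1 `^ (r - 1) = 1); last by rewrite powR1.
      by apply: ge0_ler_powR; rewrite ?nnegrE ?subr_ge0 ?(ltW delta0).
    have ax : a x <= Ma.
      by apply: le_trans (ler_norm _) (hMa x _); exact: subset_closure.
    apply: lerD; first exact: dr.
    rewrite mulrC; apply: ler_pM; rewrite ?powR_ge0 ?dr //.
    exact/a0/OU'.
  rewrite integral_cst //; apply: (@le_trans _ _ ((delta * (1 + Ma))%:E * mu Omega)%E).
    rewrite lee_wpmul2l ?lee_fin ?mulr_ge0 ?addr_ge0 ?(ltW delta0) ?(ltW Ma0) //.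
    by apply: le_measure; rewrite ?inE // => x [].
  by rewrite mE -EFinM lee_fin -mulrA.
apply: le_lt_trans (leeD iE iD) _; rewrite -EFinD lte_fin.
by rewrite [ltRHS]splitr ltrD2l ltr_pM2l // ltf_pV2 ?posrE // ltr_nat.
Qed.

End phase_energy.

(** * Truncation and localization *)

Section test_limit_closure.
Context {R : realType} {n : nat}.
Local Notation mu := (lebesgue_rV n : {sigma_finite_measure set 'rV[R]_n -> \bar R}).
Local Notation L1T u := (mu.-integrable setT (EFin \o u)).
Implicit Types (u v psi phi : 'rV[R]_n -> R) (G H : 'I_n -> 'rV[R]_n -> R) (x : 'rV[R]_n).
Implicit Types Omega : set 'rV[R]_n.

Lemma integral_norm_le (f g1 g2 : 'rV[R]_n -> R) (c1 c2 d1 d2 : R) :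
  measurable_fun setT f -> measurable_fun setT g1 -> measurable_fun setT g2 ->
  0 <= c1 -> 0 <= c2 ->
  (forall x, `|f x| <= c1 * `|g1 x| + c2 * `|g2 x|) ->
  (\int[mu]_x (`|g1 x|%R)%:E <= d1%:E)%E -> (\int[mu]_x (`|g2 x|%R)%:E <= d2%:E)%E ->
  (\int[mu]_x (`|f x|%R)%:E <= (c1 * d1 + c2 * d2)%:E)%E.
Proof.
move=> mf m1 m2 c10 c20 hf h1 h2.
have mn (g : 'rV[R]_n -> R) : measurable_fun setT g -> measurable_fun setT (fun x => (`|g x|%R)%:E).
  by move=> mg; apply/measurable_EFinP; exact: measurableT_comp.
apply: (@le_trans _ _ (\int[mu]_x (c1%:E * (`|g1 x|%R)%:E + c2%:E * (`|g2 x|%R)%:E))%E).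
  apply: ge0_le_integral => //; first exact: mn.
  - by apply: emeasurable_funD; apply: measurable_funeM; exact: mn.
  - by move=> x _; rewrite -!EFinM -EFinD lee_fin.
rewrite ge0_integralD //; last 4 first.
- by move=> x _; rewrite mule_ge0 ?lee_fin.
- by apply: measurable_funeM; exact: mn.
- by move=> x _; rewrite mule_ge0 ?lee_fin.
- by apply: measurable_funeM; exact: mn.
rewrite !ge0_integralZl ?lee_fin //; [|exact: mn|exact: mn].
by rewrite EFinD !EFinM; apply: leeD; rewrite lee_wpmul2l ?lee_fin.
Qed.

Lemma smooth_sub (f g : 'rV[R]_n -> R) : smooth_on setT f -> smooth_on setT g ->
  smooth_on setT (fun x => f x - g x).
Proof.
move=> sf sg; rewrite (_ : (fun x => _) = (fun x => f x + -1 * g x)).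
  exact: (smooth_add sf (smooth_mul (smooth_cst (-1)) sg)).
by apply/funext => x; rewrite mulN1r.
Qed.

Lemma partial_sub (f g : 'rV[R]_n -> R) x i : smooth_on setT f -> smooth_on setT g ->
  partial i (fun x => f x - g x) x = partial i f x - partial i g x.
Proof. by move=> sf sg; apply: deriveB; exact: smooth_derivable. Qed.

Lemma partial_smooth_mul (f g : 'rV[R]_n -> R) x i : smooth_on setT f -> smooth_on setT g ->
  partial i (fun x => f x * g x) x = f x * partial i g x + g x * partial i f x.
Proof. by move=> sf sg; apply: partial_mul; exact: smooth_derivable. Qed.

Lemma test_limit_mul Omega u G psi (M1 M2 : R) : smooth_on setT psi -> 0 < M1 -> 0 < M2 ->
  (forall x, `|psi x| <= M1) -> (forall i x, `|partial i psi x| <= M2) -> test_limit Omega u G ->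
  test_limit Omega (fun x => psi x * u x) (fun i x => psi x * G i x + u x * partial i psi x).
Proof.
move=> spsi M10 M20 hM1 hM2 [[iu iG] off lim].
have mpsi := smooth_measurable spsi.
have mu' := rintegrable_measurable iu.
split.
- split=> [|i].
    under eq_fun do rewrite mulrC.
    by apply: (@rintegrable_mul_bounded _ _ _ _ _ measurableT _ _ M1).
  apply: rintegrableD => //.
    under eq_fun do rewrite mulrC.
    by apply: (@rintegrable_mul_bounded _ _ _ _ _ measurableT _ _ M1).
  apply: (@rintegrable_mul_bounded _ _ _ _ _ measurableT _ _ M2) => //.
  exact: smooth_partial_measurable.
- by move=> x /off[-> G0]; rewrite mulr0; split => // i; rewrite G0 mulr0 mul0r addr0.
move=> delta d0; have den0 : 0 < M1 + M2 + 1 by rewrite !addr_gt0.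
have [phi tphi [uphi Gphi]] := lim _ (divr_gt0 d0 den0).
have sphi := test_smooth tphi; have mphi := smooth_measurable sphi.
have small : (M1 + M2) * (delta / (M1 + M2 + 1)) < delta.
  by rewrite mulrCA gtr_pMr // ltr_pdivrMr // mul1r ltrDl.
exists (fun x => psi x * phi x); first exact: test_mul.
split=> [|i].
  apply: (@le_lt_trans _ _ (M1 * (delta / (M1 + M2 + 1)) + M2 * (delta / (M1 + M2 + 1)))%:E); last first.
    by rewrite lte_fin -mulrDl.
  apply: (@integral_norm_le _ (fun x => u x - phi x) (fun x => u x - phi x)) => //; try exact: ltW.
  - by apply: measurable_funB; exact: measurable_funM.
  - exact: measurable_funB.
  - exact: measurable_funB.
  move=> x; rewrite -mulrBr normrM -mulrDl ler_wpM2r //.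
  by apply: le_trans (hM1 x) _; rewrite lerDl ltW.
have mG := rintegrable_measurable (iG i).
have mp := smooth_partial_measurable i sphi; have mp' := smooth_partial_measurable i spsi.
apply: (@le_lt_trans _ _ (M1 * (delta / (M1 + M2 + 1)) + M2 * (delta / (M1 + M2 + 1)))%:E); last first.
  by rewrite lte_fin -mulrDl.
under eq_integral do rewrite partial_smooth_mul //.
apply: (@integral_norm_le _ (fun x => G i x - partial i phi x) (fun x => u x - phi x)) => //; try exact: ltW.
- apply: measurable_funB; apply: measurable_funD; exact: measurable_funM.
- exact: measurable_funB.
- exact: measurable_funB.
move=> x; rewrite (_ : _ - _ = psi x * (G i x - partial i phi x) + partial i psi x * (u x - phi x)); last by ring.
apply: le_trans (ler_normD _ _) _; rewrite !normrM; apply: lerD; rewrite ler_wpM2r //.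
Qed.

End test_limit_closure.
Section trigonometric_truncation.
Context {R : realType}.
Implicit Types (k s t : R).

Lemma derive1_lipschitz (f df : R -> R) s t : (forall x : R, is_derive x 1 f (df x)) ->
  (forall x, `|df x| <= 1) -> `|f s - f t| <= `|s - t|.
Proof.
move=> Df df1; wlog ts : s t / t <= s.
  by move=> H; have [st|/ltW st] := leP t s; [exact: H|rewrite distrC [leRHS]distrC; exact: H].
have [|c _ ->] := @MVT_segment R f df t s ts (fun x _ => Df x).
  apply: continuous_subspaceT => x; apply: differentiable_continuous.
  by apply/derivable1_diffP; case: (Df x).
by rewrite normrM ler_piMl.
Qed.

Lemma sin_lipschitz s t : `|sin s - sin t| <= `|s - t|.
Proof. exact: (@derive1_lipschitz sin cos s t (fun x => is_derive_sin x) (fun x => cos_max x)). Qed.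

Lemma cos_lipschitz s t : `|cos s - cos t| <= `|s - t|.
Proof.
apply: (@derive1_lipschitz cos (fun x => - sin x) s t (fun x => is_derive_cos x)) => x.
by rewrite normrN; exact: sin_max.
Qed.

(* [k sin (t / k)] is a bounded smooth substitute for truncation at height [k], with
   derivative at most 1; [j] counts its derivatives. *)
Definition sine_truncation k (j : nat) t : R :=
  k * sin (k^-1 * t + j%:R * (pi / 2)) * k^-1 ^+ j.

Lemma is_derive_sine_truncation k j t : k != 0 ->
  is_derive t 1 (sine_truncation k j) (sine_truncation k j.+1 t).
Proof.
move=> k0; pose c := j%:R * (pi / 2) : R.
have D : is_derive t 1 (k^-1 \*: (id : R -> R) + cst c) k^-1.
  by apply: is_derive_eq; rewrite addr0 /GRing.scale /= mulr1.
have D2 := @is_derive1_comp R sin (k^-1 \*: (id : R -> R) + cst c) t _ _ (is_derive_sin _) D.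
rewrite (_ : sine_truncation k j = (k * k^-1 ^+ j) \*: (sin \o (k^-1 \*: (id : R -> R) + cst c))); last first.
  by apply/funext => s; rewrite /sine_truncation /= /GRing.scale /= mulrAC.
apply: is_derive_eq.
rewrite /sine_truncation exprS -[j.+1]addn1 natrD mulrDl mul1r addrA sinDpihalf.
rewrite /GRing.scale /= -/c; ring.
Qed.

Lemma sine_truncation0 k : sine_truncation k 0 0 = 0.
Proof. by rewrite /sine_truncation mulr0 mul0r addr0 sin0 mulr0 mul0r. Qed.

Lemma sine_truncationE k t : sine_truncation k 0 t = k * sin (k^-1 * t).
Proof. by rewrite /sine_truncation mul0r addr0 expr0 mulr1. Qed.

Lemma sine_truncation1E k t : k != 0 -> sine_truncation k 1 t = cos (k^-1 * t).
Proof.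
by move=> k0; rewrite /sine_truncation mul1r sinDpihalf expr1 mulrAC divff // mul1r.
Qed.

End trigonometric_truncation.

Section truncation.
Context {R : realType} {n : nat}.
Local Notation mu := (lebesgue_rV n : {sigma_finite_measure set 'rV[R]_n -> \bar R}).
Local Notation L1T u := (mu.-integrable setT (EFin \o u)).
Implicit Types (u v phi : 'rV[R]_n -> R) (G : 'I_n -> 'rV[R]_n -> R) (x : 'rV[R]_n).
Implicit Types Omega : set 'rV[R]_n.

Lemma partial_sine_truncation (k : R) phi x i : k != 0 -> smooth_on setT phi ->
  partial i (fun y => sine_truncation k 0 (phi y)) x = cos (k^-1 * phi x) * partial i phi x.
Proof.
move=> k0 sphi.
have D : is_derive (phi x) 1 (sine_truncation k 0) (cos (k^-1 * phi x)).
  by rewrite -sine_truncation1E //; exact: is_derive_sine_truncation.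
apply: (partial_comp D); exact: smooth_derivable.
Qed.

(** The delicate term is the difference of the two cosines times [G i], a product in which [G i] is
    merely integrable. Where [norm1 G <= L] the cosines are compared by their Lipschitz constant, at
    the cost [L/k] times the distance of [u] and [phi]; elsewhere their difference is at most 2 and
    the tail of [norm1 G] is small. Hence [L] is fixed before [phi]. *)
Lemma test_limit_truncation Omega u G (k : R) : 0 < k -> test_limit Omega u G ->
  test_limit Omega (fun x => k * sin (k^-1 * u x)) (fun i x => cos (k^-1 * u x) * G i x).
Proof.
move=> k0 [[iu iG] off lim]; have kn0 : k != 0 by rewrite gt_eqF.
have mu' := rintegrable_measurable iu.
have mk : measurable_fun setT (fun x => k^-1 * u x) by exact: measurable_funM.
have mcos : measurable_fun setT (fun x => cos (k^-1 * u x)).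
  by apply: (measurableT_comp _ mk); apply: continuous_measurable_fun; exact: continuous_cos.
have msin : measurable_fun setT (fun x => k * sin (k^-1 * u x)).
  apply: measurable_funM => //.
  by apply: (measurableT_comp _ mk); apply: continuous_measurable_fun; exact: continuous_sin.
have lip (s t : R) : `|k * sin (k^-1 * s) - k * sin (k^-1 * t)| <= `|s - t|.
  rewrite -mulrBr normrM gtr0_norm // -ler_pdivlMl //.
  apply: le_trans (sin_lipschitz _ _) _.
  by rewrite -mulrBr normrM gtr0_norm ?invr_gt0.
split.
- split=> [|i].
    apply: (le_integrable measurableT _ _ iu); first exact/measurable_EFinP.
    move=> x _; rewrite /= lee_fin; have := lip (u x) 0.
    by rewrite mulr0 sin0 mulr0 !subr0.
  under eq_fun do rewrite mulrC.
  apply: (@rintegrable_mul_bounded _ _ _ _ _ measurableT _ _ 1) => // x _.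
  exact: cos_max.
- by move=> x /off[-> G0]; rewrite mulr0 sin0 mulr0; split=> // i; rewrite G0 mulr0.
move=> delta d0; pose g := norm1 G.
have mG i := rintegrable_measurable (iG i).
have ig : L1T g by apply: rintegrable_sum => // i; exact: rintegrable_norm.
have g0 x : 0 <= g x by exact: norm1_ge0.
have [L hL] := tail_small g0 ig (divr_gt0 d0 (ltr0n R 8)).
have den0 : 0 < 4 * (1 + L%:R / k) by rewrite mulr_gt0 // ltr_pwDl // divr_ge0 // ltW.
have [phi tphi [uphi Gphi]] := lim _ (divr_gt0 d0 den0).
have sphi := test_smooth tphi; have mphi := smooth_measurable sphi.
exists (fun x => sine_truncation k 0 (phi x)).
  apply: test_comp => //; last exact: sine_truncation0.
  by move=> j t; exact: is_derive_sine_truncation.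
have small : (1 + L%:R / k) * (delta / (4 * (1 + L%:R / k))) = delta / 4.
  by field; rewrite kn0 /= gt_eqF // ltr_pwDl // ltW.
have mt : measurable_fun setT (fun x => sine_truncation k 0 (phi x)).
  apply: smooth_measurable; apply: test_smooth; apply: (test_comp _ _ tphi); last exact: sine_truncation0.
  by move=> j t; exact: is_derive_sine_truncation.
have dd0 : 0 <= delta / (4 * (1 + L%:R / k)) by rewrite divr_ge0 ?ltW.
split=> [|i].
  have Lk : 0 <= L%:R / k by rewrite divr_ge0 // ltW.
  have dd : delta / (4 * (1 + L%:R / k)) <= delta.
    by rewrite ler_piMr ?(ltW d0) // invf_le1 //; lra.
  apply: le_lt_trans (lt_le_trans uphi _); last by rewrite lee_fin.
  apply: ge0_le_integral => //.
  - by apply/measurable_EFinP; apply: measurableT_comp => //; exact: measurable_funB.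
  - by apply/measurable_EFinP; apply: measurableT_comp => //; exact: measurable_funB.
  by move=> x _; rewrite lee_fin sine_truncationE.
have mp := smooth_partial_measurable i sphi.
under eq_integral do rewrite partial_sine_truncation //.
pose T x := g x * (L%:R < g x)%R%:R.
have mT : measurable_fun setT T by apply: measurable_tail; exact: measurable_norm1.
have mcp : measurable_fun setT (fun x => cos (k^-1 * phi x)).
  apply: (@measurableT_comp _ _ _ _ _ _ (@cos R)); first by apply: continuous_measurable_fun; exact: continuous_cos.
  exact: measurable_funM.
have h1 : (\int[mu]_x (`|cos (k^-1 * u x) * G i x - cos (k^-1 * phi x) * G i x|%R)%:E <= (L%:R / k * (delta / (4 * (1 + L%:R / k))) + 2 * (delta / 8))%:E)%E.
  apply: (@integral_norm_le _ _ _ (fun x => u x - phi x) T) => //; try exact: ltW.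
  - by apply: measurable_funB; exact: measurable_funM.
  - exact: measurable_funB.
  - by rewrite divr_ge0 // ltW.
  move=> x; rewrite -mulrBl normrM.
  have Gg : `|G i x| <= g x by rewrite /g /norm1 (bigD1 i) //= lerDl sumr_ge0.
  rewrite [`|T x|]ger0_norm; last by rewrite mulr_ge0.
  rewrite /T; case: ltP => Lg; rewrite ?mulr1 ?mulr0 ?addr0.
    apply: (@le_trans _ _ (2 * g x)); last by rewrite lerDr mulr_ge0 // divr_ge0 // ltW.
    apply: ler_pM => //; apply: le_trans (ler_normB _ _) _.
    by rewrite (natrD R 1 1) lerD // cos_max.
  apply: (@le_trans _ _ ((`|u x - phi x| / k) * L%:R)); last by apply: le_of_eq; ring.
  apply: ler_pM => //; last exact: le_trans Lg.
  apply: le_trans (cos_lipschitz _ _) _.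
  by rewrite -mulrBr normrM gtr0_norm ?invr_gt0 // mulrC.
have h2 : (\int[mu]_x (`|cos (k^-1 * u x) * G i x - cos (k^-1 * phi x) * partial i phi x|%R)%:E <= (1 * (delta / (4 * (1 + L%:R / k))) + 1 * (L%:R / k * (delta / (4 * (1 + L%:R / k))) + 2 * (delta / 8)))%:E)%E.
  apply: (@integral_norm_le _ _ _ (fun x => G i x - partial i phi x) (fun x => cos (k^-1 * u x) * G i x - cos (k^-1 * phi x) * G i x)) => //; try exact: ltW.
  - by apply: measurable_funB; exact: measurable_funM.
  - exact: measurable_funB.
  - by apply: measurable_funB; exact: measurable_funM.
  move=> x; rewrite !mul1r.
  rewrite (_ : _ - _ = cos (k^-1 * phi x) * (G i x - partial i phi x) + (cos (k^-1 * u x) * G i x - cos (k^-1 * phi x) * G i x)); last by ring.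
  apply: le_trans (ler_normD _ _) _; rewrite lerD2r normrM ler_piMl //; exact: cos_max.
apply: le_lt_trans h2 _; rewrite lte_fin.
move: small; rewrite mulrDl; set A := 1 * _; set B := _ / k * _; lra.
Qed.

End truncation.

Section kernel_existence.
Context {R : realType} {n : nat}.
Local Notation mu := (lebesgue_rV n : {sigma_finite_measure set 'rV[R]_n -> \bar R}).

Lemma lebesgue_cube_gt0 (v : 'rV[R]_n) (eta : R) : 0 < eta ->
  (0 < mu (box (fun i => v ord0 i - eta)%R (fun i => v ord0 i + eta)%R))%E.
Proof.
move=> eta0; rewrite [X in (_ < X)%E]lebesgue_box.
rewrite (eq_bigr (fun=> (2 * eta)%:E)) => [|i _]; last first.
  rewrite lebesgue_measure_itv /= lte_fin ltrD2l gtrN // -EFinB; congr EFin; ring.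
by rewrite prodEFin lte_fin; apply: prodr_gt0 => i _; rewrite mulr_gt0.
Qed.

Lemma exists_kernel (v : 'rV[R]_n) (eta : R) : 0 < eta ->
  exists rho : 'rV[R]_n -> R, [/\ test_functions setT rho, forall y, 0 <= rho y,
    (\int[mu]_y (rho y)%:E = 1)%E & forall y, eta < `|y - v| -> rho y = 0].
Proof.
move=> eta0; pose a i : R := v ord0 i - eta; pose b i : R := v ord0 i + eta.
pose f := box_bump a b.
have sf : smooth_on setT f by apply: smP; exact: sm_box_bump.
have tf : test_functions setT f.
  apply: (@test_of_compact _ _ setT _ f sf (@closed_box_compact R n a b) (@subsetT _ _)) => x nx; apply: box_bump_out => h.
  by apply: nx => i; have := h i; rewrite /= !in_itv /= => /andP[/ltW -> /ltW ->].
have mf := smooth_measurable sf.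
have f0 y : 0 <= f y by exact: box_bump_ge0.
have iE : (\int[mu]_y (`|(f y)%:E|) = \int[mu]_y (f y)%:E)%E.
  by apply: eq_integral => y _; rewrite gee0_abs ?lee_fin.
have ifin : (\int[mu]_y (f y)%:E)%E \is a fin_num.
  by apply: integrable_fin_num => //; exact: (test_integrable tf).
set I := fine (\int[mu]_y (f y)%:E)%E.
have IE : (\int[mu]_y (f y)%:E = I%:E)%E by rewrite fineK.
have I0 : 0 < I.
  have Ige0 : 0 <= I by apply: fine_ge0; apply: integral_ge0 => y _; rewrite lee_fin.
  rewrite lt_neqAle Ige0 andbT.
  (* A vanishing integral would make the bump zero almost everywhere, yet it is positive on a cube
     of positive measure. *)
  apply/eqP => I0; have := lebesgue_cube_gt0 v eta0.
  suff -> : mu (box a b) = 0%E by rewrite ltxx.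
  have mfE : measurable_fun setT (fun y => (f y)%:E) by exact/measurable_EFinP.
  have := (@ae_eq_integral_abs _ _ _ mu setT measurableT _ mfE).1.
  rewrite iE IE -I0 => /(_ erefl) [N [mN N0 hN]].
  apply: (@subset_measure0 _ _ _ _ _ N) => //; first exact: measurable_box.
  move=> y /box_bump_gt0 fy; apply: hN => /= /(_ Logic.I) [] e.
  by move: fy; rewrite -/f e ltxx.
exists (fun y => I^-1 * f y); split.
- exact: (test_mul tf (smooth_cst I^-1)).
- by move=> y; rewrite mulr_ge0 // invr_ge0 ltW.
- under eq_integral do rewrite EFinM.
  rewrite ge0_integralZl ?lee_fin ?invr_ge0 ?(ltW I0) //; first last.
  + by move=> y _; rewrite lee_fin.
  + exact/measurable_EFinP.
  by rewrite IE -EFinM mulVf // gt_eqF.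
move=> y yv; rewrite /f box_bump_out ?mulr0 // => h.
move: yv; rewrite ltNge => /negP; apply; apply: norm_le_coord => [|i]; first exact: ltW.
rewrite !mxE ler_norml; have := h i; rewrite /a /b /= in_itv /= => /andP[h1 h2].
by apply/andP; split; lra.
Qed.

End kernel_existence.

(** * From local to global approximation in energy *)

Section approximation.
Context {R : realType} {n : nat}.
Local Notation mu := (lebesgue_rV n : {sigma_finite_measure set 'rV[R]_n -> \bar R}).
Local Notation L1T u := (mu.-integrable setT (EFin \o u)).
Implicit Types (u v g phi : 'rV[R]_n -> R) (G H : 'I_n -> 'rV[R]_n -> R) (x : 'rV[R]_n).

Variables (Omega U : set 'rV[R]_n) (a : 'rV[R]_n -> R) (p q : R).
Hypotheses (oO : open Omega) (oU : open U) (cO : compact (closure Omega)) (OU : closure Omega `<=` U).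
Hypotheses (sa : smooth_on U a) (a0 : forall x, U x -> 0 <= a x) (p1 : 1 <= p) (q1 : 1 <= q).

Local Notation energy := (phase_energy Omega a p q).

Let p0 : 0 <= p. Proof. exact: le_trans p1. Qed.
Let q0 : 0 <= q. Proof. exact: le_trans q1. Qed.

Let OU' x : Omega x -> U x.
Proof. by move=> Ox; apply/OU/subset_closure. Qed.

Let mO : measurable Omega.
Proof. exact: open_measurable_rV. Qed.

Let mphase g (mg : measurable_fun setT g) := measurable_phase p q oO OU sa mg.

Let ph0 g x : Omega x -> (0 <= (g x `^ p + a x * g x `^ q)%:E)%E.
Proof. by move=> Ox; rewrite lee_fin addr_ge0 ?mulr_ge0 ?powR_ge0 //; exact/a0/OU'. Qed.

Lemma phase_energy_ge0 g : (0 <= energy g)%E.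
Proof. by apply: integral_ge0 => x Ox; exact: ph0. Qed.

Lemma phase_energy_mono g h : measurable_fun setT g -> measurable_fun setT h ->
  (forall x, Omega x -> 0 <= g x <= h x) -> (energy g <= energy h)%E.
Proof.
move=> mg mh gh; apply: ge0_le_integral => //; [by move=> x Ox; exact: ph0|exact: mphase|exact: mphase|].
move=> x Ox; have /andP[g0 gh'] := gh x Ox; rewrite lee_fin.
have h0 := le_trans g0 gh'.
apply: lerD; [|apply: ler_wpM2l; first exact/a0/OU'];
  by apply: ge0_ler_powR; rewrite ?nnegrE.
Qed.

(** The constant of the quasi-triangle inequality [phase_energyD], which replaces the triangle
    inequality of a norm. *)
Definition energy_quasi : R := 2 `^ p + 2 `^ q.

Lemma energy_quasi_gt0 : 0 < energy_quasi.
Proof. by rewrite addr_gt0 // powR_gt0. Qed.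

Lemma phase_energy_comb (A C : R) (g g1 g2 : 'rV[R]_n -> R) : 0 <= A -> 0 <= C ->
  measurable_fun setT g -> measurable_fun setT g1 -> measurable_fun setT g2 ->
  (forall x, Omega x -> g x `^ p + a x * g x `^ q <=
     A * (g1 x `^ p + a x * g1 x `^ q) + C * (g2 x `^ p + a x * g2 x `^ q)) ->
  (energy g <= A%:E * energy g1 + C%:E * energy g2)%E.
Proof.
move=> A0 C0 mg m1 m2 gg.
rewrite /phase_energy -ge0_integralZl //; [|exact: mphase|by move=> x; exact: ph0].
rewrite -ge0_integralZl //; [|exact: mphase|by move=> x; exact: ph0].
rewrite -ge0_integralD //; first last.
- by apply: measurable_funeM; exact: mphase.
- by move=> x Ox; rewrite mule_ge0 ?lee_fin //; exact: ph0.
- by apply: measurable_funeM; exact: mphase.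
- by move=> x Ox; rewrite mule_ge0 ?lee_fin //; exact: ph0.
apply: ge0_le_integral => //.
- by move=> x; exact: ph0.
- exact: mphase.
- by apply: emeasurable_funD; apply: measurable_funeM; exact: mphase.
Qed.

Lemma phase_energyD g g1 g2 : measurable_fun setT g -> measurable_fun setT g1 -> measurable_fun setT g2 ->
  (forall x, 0 <= g x) -> (forall x, 0 <= g1 x) -> (forall x, 0 <= g2 x) ->
  (forall x, Omega x -> g x <= g1 x + g2 x) ->
  (energy g <= energy_quasi%:E * (energy g1 + energy g2))%E.
Proof.
move=> mg m1 m2 g0 g10 g20 gg.
have D0 := ltW energy_quasi_gt0.
rewrite ge0_muleDr ?phase_energy_ge0 //; apply: phase_energy_comb => // x Ox; rewrite -mulrDr.
by apply: phase_add_le => //; [exact/a0/OU'|rewrite g0 gg].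
Qed.

Lemma phase_energy_lty_le g g1 g2 : measurable_fun setT g -> measurable_fun setT g1 -> measurable_fun setT g2 ->
  (forall x, 0 <= g x) -> (forall x, 0 <= g1 x) -> (forall x, 0 <= g2 x) ->
  (forall x, Omega x -> g x <= g1 x + g2 x) ->
  (energy g1 < +oo)%E -> (energy g2 < +oo)%E -> (energy g < +oo)%E.
Proof.
move=> mg m1 m2 g0 g10 g20 gg e1 e2.
apply: le_lt_trans (phase_energyD mg m1 m2 g0 g10 g20 gg) _.
have f1 : energy g1 \is a fin_num by rewrite (ge0_fin_numE (phase_energy_ge0 g1)); exact: e1.
have f2 : energy g2 \is a fin_num by rewrite (ge0_fin_numE (phase_energy_ge0 g2)); exact: e2.
by rewrite -(fineK f1) -(fineK f2) -EFinD -EFinM ltry.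
Qed.

Lemma phase_energy_scale (c : R) g : 0 <= c -> measurable_fun setT g -> (forall x, 0 <= g x) ->
  (energy g < +oo)%E -> (energy (fun x => c * g x)%R < +oo)%E.
Proof.
move=> c0 mg g0 eg; have mcg : measurable_fun setT (fun x => c * g x) by exact: measurable_funM.
have P0 : 0 <= c `^ p by exact: powR_ge0.
have Q0 : 0 <= c `^ q by exact: powR_ge0.
apply: (@le_lt_trans _ _ ((c `^ p + c `^ q)%:E * energy g + 0%:E * energy g)%E); last first.
  have f1 : energy g \is a fin_num by rewrite ge0_fin_numE // phase_energy_ge0.
  by rewrite mul0e adde0 -(fineK f1) -EFinM ltry.
apply: phase_energy_comb => // [|x Ox]; first exact: addr_ge0.
rewrite mul0r addr0 !powRM // mulrCA.
have := a0 (OU' Ox); move: P0 Q0 (powR_ge0 (g x) p) (powR_ge0 (g x) q).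
set b := g x `^ p; set b' := g x `^ q; set A := c `^ p; set A' := c `^ q.
move=> P0 Q0 b0 b'0 ax; rewrite mulrDl; apply: lerD; rewrite ler_wpM2l //.
  by rewrite lerDl mulr_ge0.
by rewrite lerDr.
Qed.

Lemma phase_energy_cst (c : R) : 0 <= c -> (energy (fun=> c) < +oo)%E.
Proof.
move=> c0; have [Ma Ma0 hMa] := @continuous_compact_bounded _ _ (closure Omega) a cO
  (fun x Kx => smooth_on_continuous sa (OU Kx)).
have P0 : 0 <= c `^ p by exact: powR_ge0.
have Q0 : 0 <= c `^ q by exact: powR_ge0.
apply: (@le_lt_trans _ _ (\int[mu]_(x in Omega) (c `^ p + Ma * c `^ q)%:E)%E).
  apply: ge0_le_integral => //.
  - by move=> x Ox; exact: (ph0 (fun=> c)).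
  - exact: mphase.
  - move=> x Ox; rewrite lee_fin lerD2l ler_wpM2r //.
    by apply: le_trans (ler_norm _) (hMa x _); exact: subset_closure.
have finO := relatively_compact_lty mO cO.
rewrite integral_cst //; have f1 : mu Omega \is a fin_num by rewrite ge0_fin_numE.
by rewrite -[X in (_ * X)%E](fineK f1) -EFinM ltry.
Qed.

(** It is the energy of the difference that is small. Through the quasi-triangle inequality this
    makes the property stable under sums, as localization requires. *)
Definition approximable G := forall eta : R, 0 < eta -> exists2 phi, test_functions Omega phi &
  (energy (norm1 (fun i x => G i x - partial i phi x)%R) < eta%:E)%E.

Lemma norm1D G H x : norm1 (fun i x => G i x + H i x) x <= norm1 G x + norm1 H x.
Proof. by rewrite /norm1 -big_split /=; apply: ler_sum => i _; exact: ler_normD. Qed.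

Lemma phase_energyD_lt (eta : R) g g1 g2 : measurable_fun setT g -> measurable_fun setT g1 -> measurable_fun setT g2 ->
  (forall x, 0 <= g x) -> (forall x, 0 <= g1 x) -> (forall x, 0 <= g2 x) ->
  (forall x, Omega x -> g x <= g1 x + g2 x) -> 0 < eta ->
  (energy g1 < (eta / (2 * energy_quasi + 1))%:E)%E -> (energy g2 < (eta / (2 * energy_quasi + 1))%:E)%E ->
  (energy g < eta%:E)%E.
Proof.
move=> mg m1 m2 g0 g10 g20 gg eta0 e1 e2; have D0 := energy_quasi_gt0.
apply: le_lt_trans (phase_energyD mg m1 m2 g0 g10 g20 gg) _.
apply: (@le_lt_trans _ _ (energy_quasi%:E * ((eta / (2 * energy_quasi + 1))%:E + (eta / (2 * energy_quasi + 1))%:E))%E).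
  apply: lee_wpmul2l; first by rewrite lee_fin ltW.
  exact: leeD (ltW e1) (ltW e2).
rewrite -EFinD -EFinM lte_fin; have d0 : 0 < 2 * energy_quasi + 1 by lra.
rewrite (_ : _ * (_ + _) = eta * (2 * energy_quasi) / (2 * energy_quasi + 1)); last by ring.
by rewrite ltr_pdivrMr // ltr_pM2l // ltrDl.
Qed.

Lemma approximableD G H : (forall i, measurable_fun setT (G i)) -> (forall i, measurable_fun setT (H i)) ->
  approximable G -> approximable H -> approximable (fun i x => G i x + H i x).
Proof.
move=> mG mH aG aH eta eta0; have D0 := energy_quasi_gt0.
have d0 : 0 < eta / (2 * energy_quasi + 1) by rewrite divr_gt0 //; lra.
have [f tf ef] := aG _ d0; have [g tg eg] := aH _ d0.
have sf := test_smooth tf; have sg := test_smooth tg.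
have mf i := smooth_partial_measurable i sf; have mg i := smooth_partial_measurable i sg.
have sfg := test_add tf tg.
exists (fun x => f x + g x); first exact: test_add.
apply: (phase_energyD_lt _ _ _ _ _ _ _ eta0 ef eg).
- apply: measurable_norm1 => i; apply: measurable_funB; first exact: measurable_funD.
  exact: (smooth_partial_measurable i (test_smooth sfg)).
- by apply: measurable_norm1 => i; exact: measurable_funB.
- by apply: measurable_norm1 => i; exact: measurable_funB.
- by move=> x; exact: norm1_ge0.
- by move=> x; exact: norm1_ge0.
- by move=> x; exact: norm1_ge0.
move=> x _; apply: le_trans (norm1D _ _ x).
apply: le_of_eq; apply: eq_bigr => i _; congr (`|_|).
rewrite partial_add; [|exact: smooth_derivable|exact: smooth_derivable]; ring.
Qed.

Lemma approximable0 G : (forall x, Omega x -> forall i, G i x = 0) -> approximable G.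
Proof.
move=> G0 eta eta0; exists (fun=> 0); first exact: test0.
rewrite /phase_energy (eq_integral (fun=> 0%E)) ?integral0 ?lte_fin // => x /set_mem Ox.
have -> : norm1 (fun i x => G i x - partial i (fun=> 0) x) x = 0.
  by apply: big1 => i _; rewrite G0 // partial_cst subrr normr0.
by rewrite !powR0 ?gt_eqF ?(lt_le_trans ltr01) // mulr0 addr0.
Qed.

(** If the average at [x] meets a point [s = x + t y] where [u] does not vanish, then
    [x = s + t (- y)] with [t] in [[e, 2 e]] and [- y] within [eta] of the axis, so [x] lies in the
    cone attached to [s]. Such points form the continuous image [K] of a compact set; [s] may be
    taken in the closure of [Omega], and [t >= e] keeps [x] inside. *)
Lemma moll_test u rho e c (d eta tau : R) (v : 'rV[R]_n) : 0 < e -> 2 * e <= tau -> 0 <= d -> 0 <= eta ->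
  cone_at Omega c d v eta tau -> L1T u -> (forall x, ~ Omega x -> u x = 0) ->
  (forall x, d < `|x - c| -> u x = 0) -> test_functions setT rho -> (forall y, 0 <= rho y) ->
  (forall y, eta < `|y - - v| -> rho y = 0) -> test_functions Omega (moll e rho u).
Proof.
move=> e0 e_tau d0 eta0 cone iu uO ud trho rho0 rhov.
pose S := closure Omega `&` [set s : 'rV[R]_n | `|s - c| <= d].
pose K := (fun z : 'rV[R]_n * (R^o * 'rV[R]_n) => z.1 + (z.2.1 : R) *: z.2.2) @`
  (S `*` (`[e, 2 * e]%classic `*` [set w : 'rV[R]_n | `|w - v| <= eta])).
have cS : compact S.
  apply: compact_closedI => //; apply: compact_closed; first exact: norm_hausdorff.
  exact: compact_norm_ball.
have cK : compact K.
  apply: continuous_compact; last first.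
    apply: compact_setX => //; apply: compact_setX; first exact: segment_compact.
    exact: compact_norm_ball.
  apply: continuous_subspaceT => z; apply: cvgD; first exact: cvg_fst.
  apply: cvgZ; first exact: (cvg_comp _ _ cvg_snd cvg_fst).
  exact: (cvg_comp _ _ cvg_snd cvg_snd).
have KO : K `<=` Omega.
  move=> _ [[s [t w]] [[cs sc] [/= + wv]] <-]; rewrite in_itv /= => /andP[et te].
  by apply: cone => //; rewrite (lt_le_trans e0 et) (le_trans te).
apply: (test_of_compact _ cK KO); first exact: (moll_smooth e0 trho).
move=> x nK; rewrite (moll_shift e0 trho rho0 x iu) /Rintegral.
rewrite (eq_integral (fun=> 0%E)) ?integral0 // => t _; congr EFin; rewrite /shift_form.
have [ty|ty] := leP `|t.2 - - v| eta; last by rewrite rhov // mul0r.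
have [xO|xO] := pselect (Omega (x + (e * clamp t.1) *: t.2)); last by rewrite uO // mulr0.
have [xc|xc] := leP `|x + (e * clamp t.1) *: t.2 - c| d; last by rewrite ud // mulr0.
exfalso; apply: nK; exists (x + (e * clamp t.1) *: t.2, ((e * clamp t.1), - t.2)) => /=.
  split; first by split => //; exact: subset_closure.
  split => /=; last by rewrite -normrN opprD !opprK; move: ty; rewrite opprK.
  rewrite in_itv /= ler_peMr ?clamp_ge1 ?(ltW e0) //= mulrC ler_wpM2r ?(ltW e0) //; exact: clamp_le2.
by rewrite scalerN addrK.
Qed.

Lemma local_approximable u G (Mu : R) c (d eta tau : R) (v : 'rV[R]_n) : 0 <= d -> 0 < eta -> 0 < tau ->
  cone_at Omega c d v eta tau -> test_limit Omega u G -> (forall x, `|u x| <= Mu) ->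
  (energy (norm1 G) < +oo)%E -> (forall x, d < `|x - c| -> u x = 0) -> approximable G.
Proof.
move=> d0 eta0 tau0 cone lim uM eG ud delta delta0.
(* The kernel is concentrated around [- v] since the average is taken over [x + e r y]: the support
   of the result moves in the direction of [v]. *)
have [rho [trho rho0 rho1 rhov]] := exists_kernel (- v) eta0.
pose B := `|v| + eta; have B0 : 0 < B by rewrite ltr_wpDl.
have rhoB y : B < `|y| -> rho y = 0.
  move=> yB; apply: rhov; rewrite opprK -(ltrD2l `|v|); apply: lt_le_trans yB _.
  by rewrite addrC -[X in `|X| <= _](addrK v y); exact: ler_normB.
have [e1 e10 he1] := mollify_energy oO oU cO OU sa a0 p1 q1 lim uM eG trho rho0 rho1 B0 rhoB delta0.
pose e := Num.min (e1 / 2) (tau / 2).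
have e0 : 0 < e by rewrite lt_min !divr_gt0.
have ee1 : e < e1 by rewrite /e gt_min; apply/orP; left; lra.
have et : 2 * e <= tau by rewrite mulrC -ler_pdivlMr // ge_min lexx orbT.
have [[iu iG] off _] := lim.
exists (moll e rho u).
  have uO x : ~ Omega x -> u x = 0 by move=> /off[].
  exact: (moll_test e0 et d0 (ltW eta0) cone iu uO ud trho rho0 rhov).
have -> : norm1 (fun i x => G i x - partial i (moll e rho u) x) =
    norm1 (fun i x => partial i (moll e rho u) x - G i x).
  by apply/funext => x; apply: eq_bigr => i _; rewrite distrC.
by apply: he1; rewrite e0.
Qed.

Lemma product_measurable psi u G : smooth_on setT psi -> test_limit Omega u G ->
  forall i, measurable_fun setT (fun x => psi x * G i x + u x * partial i psi x).
Proof.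
move=> spsi [[iu iG] _ _] i; apply: measurable_funD; apply: measurable_funM.
- exact: smooth_measurable.
- exact: rintegrable_measurable (iG i).
- exact: rintegrable_measurable iu.
- exact: smooth_partial_measurable.
Qed.

(** The term [u partial i psi] has finite energy because it is bounded and [Omega] has finite
    measure. Hence truncation precedes localization. *)
Lemma product_energy_lty psi u G (M1 M2 Mu : R) : smooth_on setT psi -> 0 < M1 -> 0 < M2 ->
  (forall x, `|psi x| <= M1) -> (forall i x, `|partial i psi x| <= M2) ->
  test_limit Omega u G -> (forall x, `|u x| <= Mu) -> (energy (norm1 G) < +oo)%E ->
  (energy (norm1 (fun i x => psi x * G i x + u x * partial i psi x)%R) < +oo)%E.
Proof.
move=> spsi M10 M20 hM1 hM2 lim uM eG; have [[iu iG] _ _] := lim.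
have mnG : measurable_fun setT (norm1 G).
  by apply: measurable_norm1 => i; exact: rintegrable_measurable (iG i).
have Mu0 : 0 <= Mu by apply: le_trans (uM 0).
apply: (@phase_energy_lty_le _ (fun x => M1 * norm1 G x) (fun=> n%:R * (Mu * M2))).
- by apply: measurable_norm1; exact: (product_measurable spsi lim).
- exact: measurable_funM.
- exact: measurable_cst.
- by move=> x; exact: norm1_ge0.
- by move=> x; rewrite mulr_ge0 ?norm1_ge0 // ltW.
- by move=> x; rewrite !mulr_ge0 // ltW.
- move=> x _; apply: le_trans (norm1D _ _ x) _; apply: lerD.
    by rewrite /norm1 mulr_sumr; apply: ler_sum => i _; rewrite normrM ler_wpM2r.
  rewrite mulr_natl -[X in _ *+ X]card_ord -sumr_const; apply: ler_sum => i _.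
  by rewrite normrM; apply: ler_pM.
- by apply: (phase_energy_scale (ltW M10) mnG _ eG) => x; exact: norm1_ge0.
- by apply: phase_energy_cst; rewrite !mulr_ge0 // ltW.
Qed.

(** The cone condition is asked on twice the radius because [plateau c d] equals 1 up to distance
    [d] but vanishes only from [2 d] on. *)
Definition cone_center (z : 'rV[R]_n * R) := 0 < z.2 /\
  exists (v : 'rV[R]_n) (eta tau : R), [/\ 0 < eta, 0 < tau & cone_at Omega z.1 (2 * z.2) v eta tau].

(* Each step splits [u] as [psi u + (1 - psi) u] with [psi = 1] around the next center, so
   that the second term vanishes on one more ball of the cover. *)
Lemma cover_approximable (s : seq ('rV[R]_n * R)) u G (Mu : R) : (forall z, z \in s -> cone_center z) ->
  test_limit Omega u G -> (forall x, `|u x| <= Mu) -> (energy (norm1 G) < +oo)%E ->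
  (forall x, Omega x -> (forall z, z \in s -> z.2 <= `|x - z.1|) -> u x = 0 /\ forall i, G i x = 0) ->
  approximable G.
Proof.
elim: s u G Mu => [|[c d] s IH] u G Mu cs lim uM eG far.
  by apply: approximable0 => x Ox i; have [_ ->] := far x Ox (fun z => False_ind _ \o notF).
have /= [d0 [v [eta [tau [eta0 tau0 cone]]]]] := cs (c, d) (mem_head _ _).
pose psi := plateau c d; have tpsi : test_functions setT psi by exact: test_plateau.
have spsi : smooth_on setT psi by exact: smooth_plateau.
pose chi x := 1 - psi x; have schi : smooth_on setT chi by exact: (smooth_sub (smooth_cst 1) spsi).
have chiE i x : partial i chi x = - partial i psi x.
  by rewrite (partial_sub x i (smooth_cst 1) spsi) partial_cst sub0r.
have [M1 M10 hM1] := test_bounded tpsi; have [M2 M20 hM2] := test_partial_bounded tpsi.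
have hN1 x : `|chi x| <= 1 + M1 by apply: le_trans (ler_normB _ _) _; rewrite normr1 lerD2l.
have hN2 i x : `|partial i chi x| <= M2 by rewrite chiE normrN.
have N10 : 0 < 1 + M1 by rewrite addr_gt0.
have [lim1 e1] := (test_limit_mul spsi M10 M20 hM1 hM2 lim, product_energy_lty spsi M10 M20 hM1 hM2 lim uM eG).
have [lim2 e2] := (test_limit_mul schi N10 M20 hN1 hN2 lim, product_energy_lty schi N10 M20 hN1 hN2 lim uM eG).
have bd (f : 'rV[R]_n -> R) M : (forall x, `|f x| <= M) -> forall x, `|f x * u x| <= M * Mu.
  by move=> fM x; rewrite normrM; exact: (ler_pM (normr_ge0 _) (normr_ge0 _) (fM x) (uM x)).
have aH : approximable (fun i x => psi x * G i x + u x * partial i psi x).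
  apply: (local_approximable _ eta0 tau0 cone lim1 (bd _ _ hM1) e1) => [|x xc].
    by rewrite mulr_ge0 // ltW.
  by rewrite /psi plateau0 ?mul0r // ltW.
have aK : approximable (fun i x => chi x * G i x + u x * partial i chi x).
  apply: (IH _ _ _ _ lim2 (bd _ _ hN1) e2) => [z zs|x Ox xs].
    by apply: cs; rewrite in_cons zs orbT.
  have [xc|xc] := ltP `|x - c| d.
    rewrite /chi /psi plateau1 ?(ltW xc) // subrr mul0r; split => // i.
    by rewrite chiE partial_plateau1 // oppr0 mulr0 mul0r addr0.
  have [|-> G0] := far x Ox.
    by move=> z; rewrite in_cons => /orP[/eqP ->//|/xs].
  by rewrite mulr0; split => // i; rewrite G0 mulr0 mul0r addr0.
rewrite (_ : G = fun i x => (psi x * G i x + u x * partial i psi x) + (chi x * G i x + u x * partial i chi x)).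
  by apply: approximableD => // i; [exact: (product_measurable spsi lim)|exact: (product_measurable schi lim)].
apply/funext => i; apply/funext => x; rewrite chiE /chi; ring.
Qed.

Hypothesis cones : forall x0, closure Omega x0 -> exists (d : R) (v : 'rV[R]_n) (eta tau : R),
  [/\ 0 < d, 0 < eta, 0 < tau & cone_at Omega x0 d v eta tau].

Lemma finite_cone_cover : exists2 s : seq ('rV[R]_n * R), forall z, z \in s -> cone_center z &
  forall x, Omega x -> exists2 z, z \in s & `|x - z.1| < z.2.
Proof.
have ex x : exists d : R, 0 < d /\ (closure Omega x -> cone_center (x, d)).
  have [/cones[d [v [eta [tau [d0 eta0 tau0 h]]]]]|nx] := pselect (closure Omega x); last by exists 1.
  exists (d / 2); split; first by rewrite divr_gt0.
  by move=> _; split => /=; [rewrite divr_gt0|exists v, eta, tau; split; rewrite // mulrC divfK].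
have [r hr] := choice ex; have cO' := cO; rewrite compact_cover in cO'.
have [||D' D'O cov] := cO' 'rV[R]_n (closure Omega) (fun x => ball x (r x)).
- by move=> x _; apply: ball_open; exact: (hr x).1.
- by move=> x cx; exists x => //; apply: ballxx; exact: (hr x).1.
exists [seq (x, r x) | x <- finmap.enum_fset D'].
  by move=> _ /mapP[x xD ->]; apply: (hr x).2; apply/set_mem; exact: D'O.
move=> x /subset_closure/cov[y yD /mx_ballP xy]; exists (y, r y); last by rewrite distrC.
exact: map_f.
Qed.

Lemma bounded_approximable u G (Mu : R) : test_limit Omega u G -> (forall x, `|u x| <= Mu) ->
  (energy (norm1 G) < +oo)%E -> approximable G.
Proof.
move=> lim uM eG; have [s sc cov] := finite_cone_cover.
apply: (cover_approximable sc lim uM eG) => x Ox far.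
by have [z zs] := cov x Ox; rewrite ltNge far.
Qed.

(** Truncation changes the gradient by the factor [cos (u / (k + 1))], which tends to 1 pointwise.
    The energy of the difference tends to 0 by dominated convergence, with the energy density of
    [2 G] as the majorant. *)
Lemma energy_approximable u G : test_limit Omega u G -> (energy (norm1 G) < +oo)%E -> approximable G.
Proof.
move=> lim eG eta eta0; have [[iu iG] off _] := lim.
have mu' := rintegrable_measurable iu; have mG i := rintegrable_measurable (iG i).
pose g := norm1 G; have mg : measurable_fun setT g by exact: measurable_norm1.
have g0 x : 0 <= g x by exact: norm1_ge0.
pose c (k : nat) x : R := `|1 - cos (k.+1%:R^-1 * u x)|.
have mcos k : measurable_fun setT (fun x => cos (k.+1%:R^-1 * u x)).
  apply: (@measurableT_comp _ _ _ _ _ _ (@cos R)); first by apply: continuous_measurable_fun; exact: continuous_cos.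
  exact: measurable_funM.
have mc k : measurable_fun setT (c k).
  by apply: measurableT_comp => //; exact: measurable_funB.
have c0 k x : 0 <= c k x by exact: normr_ge0.
have c2 k x : c k x <= 2.
  by apply: le_trans (ler_normB _ _) _; rewrite normr1 (natrD R 1 1) lerD2l cos_max.
pose h x := 2 `^ p * g x `^ p + 2 `^ q * (a x * g x `^ q).
have P0 : 0 <= 2 `^ p :> R by exact: powR_ge0.
have Q0 : 0 <= 2 `^ q :> R by exact: powR_ge0.
have h0 x : Omega x -> 0 <= h x.
  by move=> Ox; rewrite addr_ge0 // !mulr_ge0 ?powR_ge0 //; exact/a0/OU'.
have ma : measurable_fun Omega a.
  by apply: continuous_measurable_rV => // x Ox; apply: (smooth_on_continuous (U := U)) => //; exact: OU'.
have mgr (r : R) : measurable_fun Omega (fun x => g x `^ r).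
  by apply: measurable_funTS; exact: (measurableT_comp (measurable_powR r) mg).
have mh : measurable_fun Omega h.
  by apply: measurable_funD; apply: measurable_funM => //; exact: measurable_funM.
have ih : mu.-integrable Omega (EFin \o h).
  apply/integrableP; split; first exact/measurable_EFinP.
  apply: le_lt_trans (_ : _ < +oo)%E; last first.
    apply: (phase_energy_scale (c := 2) _ mg g0 eG); by [].
  apply: ge0_le_integral => //.
  - by apply/measurable_EFinP; exact: measurableT_comp.
  - by apply: mphase; exact: measurable_funM.
  - by move=> x Ox /=; rewrite lee_fin ger0_norm ?h0 // /h !powRM // [a x * (_ * _)]mulrCA.
pose f k x := c k x / 2 * h x.
have fh k x : Omega x -> `|f k x| <= h x.
  move=> Ox; rewrite ger0_norm; last by rewrite mulr_ge0 ?h0 // divr_ge0.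
  by rewrite ler_piMl ?h0 // ler_pdivrMr // mul1r.
have mf k : measurable_fun Omega (f k).
  apply: measurable_funM => //; apply: measurable_funM => //.
  exact: (measurable_funTS (mc k)).
have f0 x : Omega x -> f ^~ x @ \oo --> (0 : R).
  move=> Ox; rewrite -[X in _ --> X](mul0r (h x)); apply: cvgMl.
  rewrite -[X in _ --> X](mul0r (2^-1 : R)); apply: cvgMl.
  rewrite -(@normr0 _ R); apply: cvg_norm.
  rewrite -[X in _ --> X](subrr (1 : R)) -[X in _ --> _ - X]cos0.
  apply: cvgB; first exact: cvg_cst.
  have cv : (fun k : nat => k.+1%:R^-1 * u x) @ \oo --> (0 : R).
    by rewrite -[X in _ --> X](mul0r (u x)); apply: cvgMl; exact: cvg_harmonic.
  exact: (cvg_comp _ _ cv (@continuous_cos R 0)).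
have D0 := energy_quasi_gt0.
have eta'0 : 0 < eta / (2 * energy_quasi + 1) by rewrite divr_gt0 //; lra.
have [k hk] := dominated_small mO mf ih fh f0 eta'0.
have k0 : 0 < k.+1%:R :> R by [].
pose H i x := cos (k.+1%:R^-1 * u x) * G i x.
have limH := test_limit_truncation k0 lim.
have mH i : measurable_fun setT (H i) by exact: measurable_funM.
have eH : (energy (norm1 H) < +oo)%E.
  apply: le_lt_trans eG; apply: phase_energy_mono; [exact: measurable_norm1|exact: measurable_norm1|].
  move=> x _; rewrite norm1_ge0 /=; apply: ler_sum => i _.
  by rewrite normrM ler_piMl // cos_max.
have uk x : `|k.+1%:R * sin (k.+1%:R^-1 * u x)| <= k.+1%:R.
  by rewrite normrM ger0_norm // ler_piMr // sin_max.
have [phi tphi ephi] := bounded_approximable limH uk eH eta'0.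
have mp i := smooth_partial_measurable i (test_smooth tphi).
exists phi => //.
have eGH : (energy (norm1 (fun i x => G i x - H i x)%R) < (eta / (2 * energy_quasi + 1))%:E)%E.
  apply: le_lt_trans hk; apply: ge0_le_integral => //.
  - by move=> x Ox; exact: (ph0 (norm1 (fun i x => G i x - H i x))).
  - by apply: mphase; apply: measurable_norm1 => i; exact: measurable_funB.
  - by apply/measurable_EFinP; exact: measurableT_comp.
  move=> x Ox; rewrite lee_fin ger0_norm; last by rewrite mulr_ge0 ?h0 // divr_ge0.
  have -> : norm1 (fun i x => G i x - H i x) x = c k x * g x.
    rewrite /norm1 /g mulr_sumr; apply: eq_bigr => i _.
    by rewrite /H -normrM mulrBl mul1r.
  (* As [c / 2] lies in [[0, 1]], its powers with exponent at least 1 are below it. Both terms of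
     the density thus share one linear factor, which tends to 0. *)
  have cr (r : R) : 1 <= r -> (c k x) `^ r <= 2 `^ r * (c k x / 2).
    move=> r1; rewrite -{1}(divfK (_ : 2 != 0 :> R) (c k x)) // [_ / 2 * 2]mulrC powRM ?divr_ge0 //.
    rewrite ler_wpM2l ?powR_ge0 //.
    have y0 : 0 <= c k x / 2 by rewrite divr_ge0.
    have y1 : c k x / 2 <= 1 by rewrite ler_pdivrMr // mul1r.
    move: y0 y1; set y := c k x / 2 => y0 y1.
    have [->|yn0] := eqVneq y 0; first by rewrite powR0 // gt_eqF // (lt_le_trans ltr01).
    have yp : 0 < y by rewrite lt_neqAle eq_sym yn0.
    rewrite -[X in _ <= X]powRr1 // -[r](subrK 1) powRD; last by rewrite yn0 implybT.
    rewrite ler_piMl ?powR_ge0 // -[leRHS](_ : 1 `^ (r - 1) = 1); last by rewrite powR1.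
    by apply: ge0_ler_powR; rewrite ?nnegrE ?subr_ge0.
  rewrite !powRM // /f /h mulrDr; apply: lerD.
    by rewrite mulrA [_ / 2 * _]mulrC ler_wpM2r ?powR_ge0 // cr.
  rewrite mulrCA [leRHS]mulrA [_ / 2 * _]mulrC ler_wpM2r ?cr //.
  by rewrite mulr_ge0 ?powR_ge0 //; exact/a0/OU'.
apply: (phase_energyD_lt _ _ _ _ _ _ _ eta0 eGH ephi).
- by apply: measurable_norm1 => i; exact: measurable_funB.
- by apply: measurable_norm1 => i; exact: measurable_funB.
- by apply: measurable_norm1 => i; exact: (measurable_funB (mH i) (mp i)).
- by move=> x; exact: norm1_ge0.
- by move=> x; exact: norm1_ge0.
- by move=> x; exact: norm1_ge0.
move=> x _; apply: le_trans (norm1D _ _ x).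
apply: le_of_eq; apply: eq_bigr => i _; congr (`|_|); rewrite /H; ring.
Qed.

End approximation.

(** * Weak gradients *)

Section fundamental_lemma.
Context {R : realType} {n : nat}.
Local Notation mu := (lebesgue_rV n : {sigma_finite_measure set 'rV[R]_n -> \bar R}).
Implicit Types (f psi : 'rV[R]_n -> R) (Omega W : set 'rV[R]_n).

Definition rational_box (u : 'rV[rat]_n * 'rV[rat]_n) : set 'rV[R]_n :=
  [set x | forall i, `[ratr (u.1 ord0 i) : R, ratr (u.2 ord0 i)]%classic (x ord0 i)].

Definition rational_bump (u : 'rV[rat]_n * 'rV[rat]_n) : 'rV[R]_n -> R :=
  box_bump (fun i => ratr (u.1 ord0 i)) (fun i => ratr (u.2 ord0 i)).

Lemma rational_box_nbhd W x : open W -> W x ->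
  exists2 u, rational_box u `<=` W & 0 < rational_bump u x.
Proof.
move=> oW Wx; have /nbhs_ballP[e /= e0 eW] : nbhs x W by exact: open_nbhs_nbhs.
have lo i : exists r : rat, x ord0 i - e < ratr r < x ord0 i.
  by have [|r] := @rat_in_itvoo R (x ord0 i - e) (x ord0 i); [lra | rewrite in_itv /= => ?; exists r].
have hi i : exists r : rat, x ord0 i < ratr r < x ord0 i + e.
  by have [|r] := @rat_in_itvoo R (x ord0 i) (x ord0 i + e); [lra | rewrite in_itv /= => ?; exists r].
have [l hl] := choice lo; have [h hh] := choice hi.
exists (\row_i l i, \row_i h i) => [y yb|].
  apply: eW; rewrite rV_ballE // => i; have := yb i; rewrite !mxE /= in_itv /=.
  have := hl i; have := hh i; rewrite ltr_norml; lra.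
apply: box_bump_gt0 => i; rewrite /= !mxE in_itv /=; have := hl i; have := hh i; lra.
Qed.

(* The derivatives of [1 - exp (- k t)], which tends to the indicator of [t > 0]. *)
Definition exp_saturation (k : R) (j : nat) (t : R) : R :=
  (j == 0)%:R - (- k) ^+ j * expR (- k * t).

Lemma is_derive_exp_saturation (k : R) j (t : R) :
  is_derive t 1 (exp_saturation k j) (exp_saturation k j.+1 t).
Proof.
have D : is_derive t (1 : R) (- k \*: (id : R -> R)) (- k).
  by apply: is_derive_eq; rewrite /GRing.scale /= mulr1.
have D2 := @is_derive1_comp R expR (- k \*: (id : R -> R)) t _ _ (is_derive_expR _) D.
rewrite (_ : exp_saturation k j = cst (j == 0)%:R - ((- k) ^+ j \*: (expR \o (- k \*: (id : R -> R))))); last first.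
  by apply/funext => s.
apply: is_derive_eq; rewrite /exp_saturation /= !sub0r exprSr /GRing.scale /=; ring.
Qed.

Lemma exp_saturation0 (k : R) : exp_saturation k 0 0 = 0.
Proof. by rewrite /exp_saturation expr0 mul1r mulr0 expR0 subrr. Qed.

(** [psi k] is [1 - exp (- k S k)], with [S k] the sum of the first [k] bumps on rational boxes
    contained in [W], in the enumeration by [unpickle]. At a point of [W] the sums stay above a
    positive constant from some index on, so [k S k] tends to infinity; only finite sums of bumps
    ever occur. *)
Lemma open_set_tests W : open W -> exists psi : nat -> 'rV[R]_n -> R,
  [/\ forall k, test_functions W (psi k), forall k x, 0 <= psi k x <= 1 &
      forall x, W x -> psi^~ x @ \oo --> (1 : R)].
Proof.
move=> oW.
pose beta j : 'rV[R]_n -> R := if unpickle j is Some u then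
  (if `[< rational_box u `<=` W >] then rational_bump u else fun=> 0) else fun=> 0.
have tbeta j : test_functions W (beta j).
  rewrite /beta; case: unpickle => [u|]; last exact: test0.
  case: asboolP => [uW|_]; last exact: test0.
  apply: (@test_of_compact _ _ _ _ _ _ (@closed_box_compact R n (fun i => ratr (u.1 ord0 i)) (fun i => ratr (u.2 ord0 i))) uW).
    by apply: smP; exact: sm_box_bump.
  move=> x nx; apply: box_bump_out => h; apply: nx => i; have := h i.
  by rewrite /= !in_itv /= => /andP[/ltW -> /ltW ->].
have beta0 j x : 0 <= beta j x.
  by rewrite /beta; case: unpickle => [u|] //; case: asboolP => // _; exact: box_bump_ge0.
pose S k x := \sum_(j < k) beta j x.
have tS k : test_functions W (S k).
  elim: k => [|k IH].
    rewrite (_ : S 0%N = fun=> 0); first exact: test0.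
    by apply/funext => x; rewrite /S big_ord0.
  rewrite (_ : S k.+1 = fun x => S k x + beta k x); first exact: test_add.
  by apply/funext => x; rewrite /S big_ord_recr.
have S0 k x : 0 <= S k x by exact: sumr_ge0.
exists (fun k x => exp_saturation k%:R 0 (S k x)); split.
- move=> k; apply: test_comp; [|exact: exp_saturation0|exact: tS].
  by move=> j t; exact: is_derive_exp_saturation.
- move=> k x; rewrite /exp_saturation expr0 mul1r subr_ge0 -expR0 ler_expR.
  by rewrite mulNr oppr_le0 mulr_ge0 //= gerBl expR_ge0.
move=> x Wx; have [u uW ux] := rational_box_nbhd oW Wx.
have bx : 0 < beta (pickle u) x.
  by rewrite /beta pickleK; case: asboolP.
rewrite -[X in _ --> X]subr0; apply: cvgB; first exact: cvg_cst.
apply/cvgrPdist_lt => e e0; set b := beta _ _ in bx.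
have [N eN] : exists N : nat, e^-1 / b < N%:R by exists (Num.truncn (e^-1 / b)).+1; exact: truncnS_gt.
exists (maxn N (pickle u).+1) => // k /=; rewrite geq_max => /andP[Nk uk].
rewrite sub0r normrN expr0 mul1r gtr0_norm ?expR_gt0 // mulNr expRN.
have kS : e^-1 < expR (k%:R * S k x).
  apply: (@lt_le_trans _ _ (1 + k%:R * S k x)); last exact: expR_ge1Dx.
  have bS : b <= S k x by rewrite /S (bigD1 (Ordinal uk)) //= lerDl sumr_ge0.
  move: eN; rewrite ltr_pdivrMr // => eN.
  apply: (lt_le_trans eN); apply: (@le_trans _ _ (k%:R * S k x)); last by rewrite lerDr.
  by apply: ler_pM => //; [exact: ltW|rewrite ler_nat].
by rewrite -[ltRHS]invrK ltf_pV2 ?posrE ?expR_gt0 ?invr_gt0.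
Qed.

(** The indicator of [W] is a pointwise limit of test functions with values in [[0, 1]], so
    dominated convergence with majorant [|f|] applies. *)
Lemma integral_open_eq0 Omega f W : open Omega -> mu.-integrable Omega (EFin \o f) ->
  (forall psi, test_functions Omega psi -> (\int[mu]_(x in Omega) (f x * psi x)%:E = 0)%E) ->
  open W -> W `<=` Omega -> (\int[mu]_(x in W) (f x)%:E = 0)%E.
Proof.
move=> oO jf f0 oW WO; have mO := open_measurable_rV oO; have mW := open_measurable_rV oW.
have [psi [tpsi psi01 psi1]] := open_set_tests oW.
have mf := rintegrable_measurable jf.
have tpsiO k : test_functions Omega (psi k).
  by have [s1 s2 s3] := tpsi k; split => //; exact: subset_trans WO.
have mpsi k : measurable_fun Omega (psi k).
  by apply: measurable_funTS; exact: (smooth_measurable (test_smooth (tpsi k))).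
have ind01 (x : 'rV[R]_n) : 0 <= (\1_W x : R) <= 1 by rewrite indicE; case: (_ \in _); rewrite /= ?lexx ?ler01.
pose g k x := f x * (\1_W x - psi k x).
have d1 k x : `|\1_W x - psi k x| <= 1.
  by rewrite ler_norml; have := ind01 x; have := psi01 k x; lra.
have mind : measurable_fun Omega (\1_W : 'rV[R]_n -> R) by exact: measurable_indic.
have jg k : mu.-integrable Omega (EFin \o g k).
  by apply: (@rintegrable_mul_bounded _ _ _ _ _ mO _ _ 1) => //; exact: measurable_funB.
have jW : mu.-integrable Omega (EFin \o (fun x => f x * \1_W x)).
  apply: (@rintegrable_mul_bounded _ _ _ _ _ mO _ _ 1) => // x _.
  by rewrite ger0_norm; have /andP[] := ind01 x.
have jpsi k : mu.-integrable Omega (EFin \o (fun x => f x * psi k x)).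
  apply: (@rintegrable_mul_bounded _ _ _ _ _ mO _ _ 1) => // x _.
  by rewrite ger0_norm; have /andP[] := psi01 k x.
have g0 x : Omega x -> g^~ x @ \oo --> (0 : R).
  move=> Ox; rewrite -[X in _ --> X](mulr0 (f x)); apply: cvgMr.
  have [Wx|nWx] := pselect (W x).
    rewrite -[X in _ --> X](subrr (1 : R)); apply: cvgB; last exact: psi1.
    rewrite (_ : (fun=> _) = cst 1); last by apply/funext => k; rewrite indicE mem_set.
    exact: cvg_cst.
  rewrite (_ : (fun k => _) = cst 0); first exact: cvg_cst.
  by apply/funext => k; rewrite indicE memNset // (test_out (tpsi k) nWx) subrr.
have gf k x : Omega x -> `|g k x| <= `|f x|.
  by move=> _; rewrite normrM ler_piMr.
have mg k := rintegrable_measurable (jg k).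
have -> : (\int[mu]_(x in W) (f x)%:E = \int[mu]_(x in Omega) (f x * \1_W x)%:E)%E.
  rewrite integral_mkcond [RHS]integral_mkcond; apply: eq_integral => x _.
  rewrite !patchE indicE; case: ifPn => [/set_mem Wx|nWx]; first by rewrite mem_set ?mulr1 //; exact: WO.
  by rewrite mulr0; case: ifP.
have fin := integrable_fin_num mO jW.
rewrite -(fineK fin); congr EFin; apply/eqP; rewrite -normr_le0; apply/ler_addgt0Pl => eta eta0; rewrite addr0.
have [k hk] := dominated_small mO mg (rintegrable_norm jf) gf g0 eta0.
rewrite -lee_fin; apply: le_trans (ltW hk).
have -> : fine (\int[mu]_(x in Omega) (f x * \1_W x)%:E)%E = (\int[mu]_(x in Omega) g k x)%R.
  have -> : (\int[mu]_(x in Omega) g k x)%R = (\int[mu]_(x in Omega) (f x * \1_W x - f x * psi k x))%R.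
    by apply: eq_Rintegral => x _; rewrite /g mulrBr.
  by rewrite RintegralB // /Rintegral (f0 _ (tpsiO k)) subr0.
rewrite -EFin_Rintegral_int //; last exact: rintegrable_norm.
by rewrite lee_fin le_normr_Rintegral.
Qed.

(** No mollification is involved: the integral vanishes over the part of [Omega] in any box, a set
    open in [Omega], and the sets with this property form a Dynkin class; it therefore vanishes over
    every measurable subset. *)
Lemma fundamental_lemma Omega f : open Omega -> mu.-integrable Omega (EFin \o f) ->
  (forall psi, test_functions Omega psi -> (\int[mu]_(x in Omega) (f x * psi x)%:E = 0)%E) ->
  ae_eq mu Omega (EFin \o f) (cst 0%E).
Proof.
move=> oO jf f0; have mO := open_measurable_rV oO.
have mf : measurable_fun Omega (EFin \o f) by have /integrableP[] := jf.
have fO : (\int[mu]_(x in Omega) (f x)%:E = 0)%E by exact: (integral_open_eq0 oO jf f0 oO).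
pose P (A : set 'rV[R]_n) := (\int[mu]_(x in Omega `&` A) (f x)%:E = 0)%E.
have box_open a b : open (@box R n a b).
  rewrite (_ : box a b = box_bump a b @^-1` [set t | 0 < t]).
    apply: open_comp; last exact: open_gt.
    by move=> x _; apply: smooth_continuous; apply: smP; exact: sm_box_bump.
  apply/seteqP; split => x /=; first exact: box_bump_gt0.
  by apply: contraPP => nx; rewrite box_bump_out // ltxx.
have HP A : <<s boxes >> A -> P A.
  apply: dynkin_induction.
  - exact: measurable_boxes.
  - exact: setI_boxes.
  - by rewrite /P setIT.
  - move=> _ [a [b ->]]; apply: (integral_open_eq0 oO jf f0); last exact: subIsetl.
    exact: openI.
  - move=> S mS PS; rewrite /P -setDE.
    have := fO; rewrite -[X in integral _ X](setUIDK Omega S) integral_setU.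
    + by rewrite PS add0e.
    + exact: measurableI.
    + exact: measurableD.
    + by rewrite setUIDK.
    + by apply/disj_setPS => x [[_ Sx] [_ nSx]].
  - move=> F mF tF PF; rewrite /P setI_bigcupr integral_bigcup.
    + by rewrite eseries0 // => i _ _; exact: PF.
    + exact: trivIset_setIl.
    + by move=> k; exact: measurableI.
    + apply: (integrableS mO _ _ jf); last by move=> x [? _ []].
      by apply: bigcup_measurable => k _; exact: measurableI.
apply: integral_ae_eq => // E EO mE; rewrite integral0.
have := HP E; rewrite -measurable_boxes => /(_ mE); rewrite /P setIidr //.
Qed.

End fundamental_lemma.

Section weak_gradients.
Context {R : realType} {n : nat}.
Local Notation mu := (lebesgue_rV n : {sigma_finite_measure set 'rV[R]_n -> \bar R}).
Implicit Types (f g phi psi : 'rV[R]_n -> R) (u v : 'rV[R]_n -> R) (G H : 'rV[R]_n -> 'rV[R]_n).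

(* Integrating over the translates of [f] gives a constant, whose derivative is [- \int partial i f]. *)
Lemma integral_partial_eq0 f i : test_functions setT f ->
  (\int[mu]_x (partial i f x)%:E = 0)%E.
Proof.
move=> tf; have [sf cf _] := tf; have ip := test_integrable (test_partial i tf).
(* [K] contains every translate of the support by a vector of norm at most 1. Its indicator is an
   integrable weight that leaves the integral over translates unchanged near the origin. *)
pose K := [set w | exists y z : 'rV[R]_n, [/\ supp f y, `|z| <= 1 & w = y + z]].
have cK : compact K by exact: fattening_compact.
have mK : measurable K by apply: closed_measurable_rV; apply: compact_closed => //; exact: norm_hausdorff.
pose c := \1_K : 'rV[R]_n -> R.
have ic : mu.-integrable setT (EFin \o c).
  apply/integrableP; split; first by apply/measurable_EFinP; exact: measurable_indic.
  under eq_integral do rewrite /= ger0_norm //.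
  rewrite integral_indic // setIT; apply: bounded_lebesgue_lty => //.
  exact: compact_bounded.
pose S := superposition mu (fun=> 1) id c f.
have m1 : measurable_fun setT ((fun=> 1) : 'rV[R]_n -> R) by exact: measurable_cst.
have mid : measurable_fun setT (id : 'rV[R]_n -> 'rV[R]_n) by exact: measurable_id.
have n1 (t : 'rV[R]_n) : `|(1 : R)| <= 1 by rewrite normr1.
have Scst x : `|x| <= 1 -> S x = (\int[mu]_y f y)%R.
  move=> x1; rewrite /S /superposition /Rintegral; congr fine.
  rewrite -(integral_shift (- x) (test_integrable tf)); apply: eq_integral => y _ /=; congr EFin.
  rewrite scale1r /c indicE; have [yK|yK] := boolP (y \in K); first by rewrite mul1r.
  rewrite mul0r supp0 // => fy; move/negP: yK; apply; apply/mem_set.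
  by exists (y - x), x; split => //; rewrite subrK.
have S0 : partial i S 0 = 0.
  rewrite /partial (@near_eq_derive _ _ _ S (cst (\int[mu]_y f y)%R)) ?derive_cst //.
  have : nbhs (0 : 'rV[R]_n) (ball (0 : 'rV[R]_n) 1) by exact: nbhsx_ballx.
  by apply: filterS => y /mx_ballP; rewrite sub0r normrN => /ltW; exact: Scst.
have := partial_superposition m1 mid n1 0 i ic tf; rewrite -/S S0 /superposition.
have -> : (\int[mu]_t (-1 * c t * partial i f (1 *: (t - 0))))%R = (\int[mu]_t (- 1 * partial i f t))%R.
  apply: eq_Rintegral => t _; rewrite scale1r subr0 -mulrA; congr (_ * _).
  rewrite /c indicE; have [tK|tK] := boolP (t \in K); first by rewrite mul1r.
  rewrite mul0r partial_supp // => ft; move/negP: tK; apply; apply/mem_set.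
  by exists t, 0; split; rewrite ?normr0 ?addr0.
rewrite RintegralZl // mulN1r => /esym/eqP; rewrite oppr_eq0 => /eqP h.
by rewrite -EFin_Rintegral_int // h.
Qed.

Variable Omega : set 'rV[R]_n.
Hypothesis oO : open Omega.
Let mO : measurable Omega. Proof. exact: open_measurable_rV. Qed.

Lemma integral_zero_off (h : 'rV[R]_n -> \bar R) : (forall x, ~ Omega x -> h x = 0%E) ->
  (\int[mu]_(x in Omega) h x = \int[mu]_x h x)%E.
Proof.
move=> h0; rewrite integral_mkcond; apply: eq_integral => x _; rewrite patchE.
by case: ifPn => // /negP nO; rewrite h0 // => /mem_set.
Qed.

Local Notation L1O u := (mu.-integrable Omega (EFin \o u)).

Lemma test_L1 phi : test_functions Omega phi -> L1O phi.
Proof. by move=> tphi; apply: (integrableS measurableT mO (@subsetT _ _)); exact: (test_integrable tphi). Qed.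

Lemma L1_mul_test u psi : L1O u -> test_functions Omega psi -> L1O (fun x => u x * psi x).
Proof.
move=> ju tpsi; have [M _ hM] := test_bounded tpsi.
apply: (@rintegrable_mul_bounded _ _ _ _ _ mO _ _ M) => //.
by apply: measurable_funTS; exact: smooth_measurable (test_smooth tpsi).
Qed.

Definition gradient phi (x : 'rV[R]_n) : 'rV[R]_n := \row_i partial i phi x.

Lemma test_weak_gradient phi : test_functions Omega phi -> is_weak_gradient Omega phi (gradient phi).
Proof.
move=> tphi; have sphi := test_smooth tphi; split=> [i|i psi tpsi].
  rewrite /L1 (_ : _ \o _ = EFin \o partial i phi); first exact: (test_L1 (test_partial i tphi)).
  by apply/funext => x; rewrite /= mxE.
have spsi := test_smooth tpsi.
under [in RHS]eq_integral do rewrite mxE.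
have j1 := L1_mul_test (test_L1 tphi) (test_partial i tpsi).
have j2 := L1_mul_test (test_L1 (test_partial i tphi)) tpsi.
have tm : test_functions setT (fun x => phi x * psi x).
  exact: (test_functions_setT (test_mul tpsi sphi)).
have := integral_partial_eq0 i tm.
rewrite -integral_zero_off; last first.
  move=> x Ox; congr EFin; rewrite partial_smooth_mul //.
  by rewrite (test_out tphi) // (test_out tpsi) // !mul0r addr0.
have -> : (\int[mu]_(x in Omega) (partial i (fun x => phi x * psi x)%R x)%:E =
    \int[mu]_(x in Omega) ((phi x * partial i psi x)%:E + (partial i phi x * psi x)%:E))%E.
  by apply: eq_integral => x _; rewrite partial_smooth_mul // [psi x * _]mulrC EFinD.
rewrite integralD_EFin // => h.
have f1 := integrable_fin_num mO j1; have f2 := integrable_fin_num mO j2.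
by move/eqP: h; rewrite -[X in (X + _)%E]fineK // -[X in (_ + X)%E]fineK // -EFinD eqe addr_eq0 => /eqP h; rewrite -[LHS]fineK // -[X in (- X)%E]fineK // h.
Qed.

Lemma weak_gradient_comb u v G H (c : R) : L1O u -> L1O v -> is_weak_gradient Omega u G ->
  is_weak_gradient Omega v H ->
  is_weak_gradient Omega (fun x => u x + c * v x) (fun x => G x + c *: H x).
Proof.
move=> ju jv [jG hG] [jH hH]; split=> [i|i psi tpsi].
  rewrite /L1 (_ : _ \o _ = EFin \o (fun x => G x ord0 i + c * H x ord0 i)); last first.
    by apply/funext => x; rewrite /= !mxE.
  by apply: rintegrableD => //; [exact: jG|apply: rintegrableZ => //; exact: jH].
have tp := test_partial i tpsi.
have ju' := L1_mul_test ju tp; have jv' := L1_mul_test jv tp.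
have jG' := L1_mul_test (jG i) tpsi; have jH' := L1_mul_test (jH i) tpsi.
have E (f g : 'rV[R]_n -> R) : L1O f -> L1O g ->
    (\int[mu]_(x in Omega) (f x + c * g x)%:E = \int[mu]_(x in Omega) (f x)%:E + c%:E * \int[mu]_(x in Omega) (g x)%:E)%E.
  move=> jf jg; under eq_integral do rewrite EFinD.
  rewrite integralD_EFin //; last exact: rintegrableZ.
  congr (_ + _)%E; rewrite -(integralZl mO jg); apply: eq_integral => x _.
  by [].

transitivity (\int[mu]_(x in Omega) (u x * partial i psi x + c * (v x * partial i psi x))%:E)%E.
  by apply: eq_integral => x _; congr EFin; ring.
rewrite E // hG // hH //.
have -> : (\int[mu]_(x in Omega) ((G x + c *: H x) ord0 i * psi x)%:E =
   \int[mu]_(x in Omega) (G x ord0 i * psi x + c * (H x ord0 i * psi x))%:E)%E.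
  by apply: eq_integral => x _; congr EFin; rewrite !mxE; ring.
have fH := integrable_fin_num mO jH'; have fG := integrable_fin_num mO jG'.
by rewrite E // fin_num_oppeD ?fin_numM // muleN.
Qed.

Lemma weak_gradient_unique u G H : is_weak_gradient Omega u G -> is_weak_gradient Omega u H ->
  {ae mu, forall x, Omega x -> G x = H x}.
Proof.
move=> [jG hG] [jH hH].
have h i : {ae mu, forall x, Omega x -> G x ord0 i = H x ord0 i}.
  have j := rintegrableB mO (jG i) (jH i).
  have := fundamental_lemma oO j; case/(_ _).
    move=> psi tpsi; have jG' := L1_mul_test (jG i) tpsi; have jH' := L1_mul_test (jH i) tpsi.
    transitivity (\int[mu]_(x in Omega) ((G x ord0 i * psi x)%:E - (H x ord0 i * psi x)%:E))%E.
      by apply: eq_integral => x _; rewrite -EFinB mulrBl.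
    rewrite integralB_EFin //; have := hH i psi tpsi; rewrite hG // => /eqP.
    by rewrite eqe_opp => /eqP ->; rewrite subee // integrable_fin_num.
  move=> N [mN N0 hN]; exists N; split => // x /= nx; apply: hN => /= e; apply: nx => Ox.
  by have [] := e Ox => /eqP; rewrite subr_eq0 => /eqP.
have hh : {ae mu, forall x, forall i, Omega x -> G x ord0 i = H x ord0 i} by apply: filter_forall.
by apply: filterS hh => x hx Ox; apply/rowP => i; exact: hx.
Qed.

Lemma weak_gradientP u : W11 Omega u -> is_weak_gradient Omega u (weak_gradient Omega u).
Proof. by move=> [_ [G hG]]; exact: (@xgetPex _ (fun=> 0) [set G | is_weak_gradient Omega u G] (ex_intro _ G hG)). Qed.

Lemma weak_gradient_ae u G : is_weak_gradient Omega u G ->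
  {ae mu, forall x, Omega x -> weak_gradient Omega u x = G x}.
Proof.
move=> hG; apply: (weak_gradient_unique (u := u)) => //.
exact: (@xgetPex _ (fun=> 0) [set G | is_weak_gradient Omega u G] (ex_intro _ G hG)).
Qed.

Lemma enorm_ge0 (x : 'rV[R]_n) : 0 <= enorm x.
Proof. exact: sqrtr_ge0. Qed.

Lemma coord_le_enorm (x : 'rV[R]_n) i : `|x ord0 i| <= enorm x.
Proof.
rewrite -sqrtr_sqr ler_wsqrtr // (bigD1 i) //= lerDl sumr_ge0 // => j _; exact: sqr_ge0.
Qed.

(** The constant 1 in front of [enorm x] is essential: the energy of [u + v] must reappear with a
    factor close to 1. The perturbation may be measured in the cruder norm. *)
Lemma enormD_le (x y : 'rV[R]_n) : enorm (x + y) <= enorm x + \sum_i `|y ord0 i|.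
Proof.
have S0 : 0 <= \sum_i `|y ord0 i| by exact: sumr_ge0.
have X0 := enorm_ge0 x.
rewrite -[leRHS]ger0_norm ?addr_ge0 // -sqrtr_sqr ler_wsqrtr //.
have X2 : enorm x ^+ 2 = \sum_i x ord0 i ^+ 2.
  by rewrite sqr_sqrtr // sumr_ge0 // => i _; exact: sqr_ge0.
apply: (@le_trans _ _ (\sum_i (x ord0 i ^+ 2 + (enorm x * `|y ord0 i| *+ 2 + `|y ord0 i| * \sum_i `|y ord0 i|)))).
  apply: ler_sum => i _; rewrite !mxE sqrrD -addrA lerD2l; apply: lerD.
    rewrite ler_pMn2r //; apply: le_trans (ler_norm _) _.
    by rewrite normrM ler_wpM2r // coord_le_enorm.
  rewrite -[leLHS]ger0_norm ?sqr_ge0 // normrX expr2 ler_wpM2l // (bigD1 i) //= lerDl; exact: sumr_ge0.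
rewrite big_split big_split /= -X2 sumrMnl -mulr_sumr -mulr_suml sqrrD.
by rewrite addrA -expr2.
Qed.

End weak_gradients.

(** * The density of test functions *)

Section sobolev_class.
Context {R : realType} {n : nat}.
Local Notation mu := (lebesgue_rV n : {sigma_finite_measure set 'rV[R]_n -> \bar R}).
Implicit Types (u v phi : 'rV[R]_n -> R) (G H : 'rV[R]_n -> 'rV[R]_n) (x : 'rV[R]_n).

Variable Omega : set 'rV[R]_n.
Hypothesis oO : open Omega.
Let mO : measurable Omega. Proof. exact: open_measurable_rV. Qed.

Lemma weight_out v x : ~ Omega x -> weight Omega v x = 0.
Proof. by move=> nO; rewrite /weight patchE memNset. Qed.

Lemma integrable_weight v : mu.-integrable Omega (EFin \o v) ->
  mu.-integrable setT (EFin \o weight Omega v).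
Proof.
move=> jv; have := (integrable_mkcond _ mO).1 jv.
rewrite (_ : (EFin \o v) \_ Omega = EFin \o weight Omega v) //.
by apply/funext => x; rewrite /weight /= !patchE; case: ifP.
Qed.

Lemma measurable_enorm G : (forall i, measurable_fun Omega (fun x => G x ord0 i)) ->
  measurable_fun Omega (fun x => enorm (G x)).
Proof.
move=> mG; apply: (@measurableT_comp _ _ _ _ _ _ (@Num.sqrt R)).
  by apply: continuous_measurable_fun; exact: sqrt_continuous.
apply: measurable_sum => i.
exact: (measurableT_comp (exprn_measurable 2) (mG i)).
Qed.

Lemma weak_gradient_measurable u G i : is_weak_gradient Omega u G -> measurable_fun Omega (fun x => G x ord0 i).
Proof. by move=> [jG _]; exact: rintegrable_measurable (jG i). Qed.

(** [weak_gradient] is a choice among representatives that agree almost everywhere; this lemma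
    replaces it by an explicit one inside integrals. *)
Lemma integral_weak_gradient u G (F : 'rV[R]_n -> 'rV[R]_n -> \bar R) : is_weak_gradient Omega u G ->
  (forall H, (forall i, measurable_fun Omega (fun x => H x ord0 i)) ->
     measurable_fun Omega (fun x => F x (H x))) ->
  (\int[mu]_(x in Omega) F x (weak_gradient Omega u x) = \int[mu]_(x in Omega) F x (G x))%E.
Proof.
move=> hG mF; have hW : is_weak_gradient Omega u (weak_gradient Omega u).
  exact: (@xgetPex _ (fun=> 0) [set G | is_weak_gradient Omega u G] (ex_intro _ G hG)).
apply: ae_eq_integral => //.
- by apply: mF => i; exact: weak_gradient_measurable hW.
- by apply: mF => i; exact: weak_gradient_measurable hG.
by have := weak_gradient_ae oO hG; apply: filterS => x hx Ox; rewrite hx.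
Qed.

Lemma weak_gradientB u G phi : mu.-integrable Omega (EFin \o u) -> is_weak_gradient Omega u G ->
  test_functions Omega phi ->
  is_weak_gradient Omega (u \- phi) (fun x => G x - gradient phi x).
Proof.
move=> ju hG tphi.
have := weak_gradient_comb oO (-1) ju (test_L1 oO tphi) hG (test_weak_gradient oO tphi).
rewrite (_ : (fun x => u x + _) = u \- phi); last by apply/funext => x; rewrite mulN1r.
rewrite (_ : (fun x => G x + _) = (fun x => G x - gradient phi x)) //.
by apply/funext => x; rewrite scaleN1r.
Qed.

Lemma weak_gradientD u G v H : mu.-integrable Omega (EFin \o u) -> mu.-integrable Omega (EFin \o v) ->
  is_weak_gradient Omega u G -> is_weak_gradient Omega v H ->
  is_weak_gradient Omega (u \+ v) (fun x => G x + H x).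
Proof.
move=> ju jv hG hH; have := weak_gradient_comb oO 1 ju jv hG hH.
rewrite (_ : (fun x => u x + _) = u \+ v); last by apply/funext => x; rewrite mul1r.
rewrite (_ : (fun x => G x + _) = (fun x => G x + H x)) //.
by apply/funext => x; rewrite scale1r.
Qed.

Lemma W11_normE u G : is_weak_gradient Omega u G ->
  W11_norm Omega u = (\int[mu]_(x in Omega) (`|u x|%R)%:E + \int[mu]_(x in Omega) (enorm (G x))%:E)%E.
Proof.
move=> hG; congr (_ + _)%E; apply: (integral_weak_gradient (F := fun _ y => (enorm y)%:E) hG).
by move=> H mH; apply/measurable_EFinP; exact: measurable_enorm.
Qed.

Lemma W110_test_limit v : W110 Omega v ->
  test_limit Omega (weight Omega v) (fun i => weight Omega (fun x => weak_gradient Omega v x ord0 i)).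
Proof.
move=> [W11v lim]; have hv := weak_gradientP W11v; have [jv _] := W11v.
have [jH _] := hv.
split.
- by split=> [|i]; apply: integrable_weight => //; exact: jH.
- by move=> x nO; split=> [|i]; exact: weight_out.
move=> delta d0; have [phi tphi] := lim delta d0.
have hB := weak_gradientB jv hv tphi; rewrite (W11_normE hB) => small.
have A0 : (0 <= \int[mu]_(x in Omega) (`|v x - phi x|%R)%:E)%E by exact: integral_ge0.
have B0 : (0 <= \int[mu]_(x in Omega) (enorm (weak_gradient Omega v x - gradient phi x)%R)%:E)%E.
  by apply: integral_ge0 => x _; rewrite lee_fin enorm_ge0.
have off f (h : 'rV[R]_n -> R) : (forall x, ~ Omega x -> h x = 0) ->
   (\int[mu]_x (`|weight Omega f x - h x|%R)%:E = \int[mu]_(x in Omega) (`|f x - h x|%R)%:E)%E.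
  move=> h0; rewrite -(@integral_zero_off _ _ Omega); last first.
    by move=> x nO; rewrite weight_out // h0 // subrr normr0.
  by apply: eq_integral => x /set_mem Ox; rewrite weightE.
exists phi => //; split=> [|i].
  rewrite off; last by move=> x; exact: test_out tphi.
  by apply: le_lt_trans small; rewrite leeDl.
rewrite off; last by move=> x; exact: test_out (test_partial i tphi).
apply: le_lt_trans small; apply: le_trans (leeDr _ A0).
have mB j := weak_gradient_measurable j hB.
apply: ge0_le_integral => //.
- apply/measurable_EFinP; apply: measurableT_comp => //.
  apply: eq_measurable_fun (mB i) => x _; by rewrite !mxE.
- by apply/measurable_EFinP; exact: measurable_enorm.
move=> x _; rewrite lee_fin.
by have := coord_le_enorm (weak_gradient Omega v x - gradient phi x) i; rewrite !mxE.
Qed.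

Lemma test_W110 phi : test_functions Omega phi -> W110 Omega phi.
Proof.
move=> tphi; have hg := test_weak_gradient oO tphi; have jphi := test_L1 oO tphi.
split; first by split => //; exists (gradient phi).
move=> e e0; exists phi => //.
rewrite (W11_normE (weak_gradientB jphi hg tphi)).
have -> : (\int[mu]_(x in Omega) (`|(phi \- phi)%R x|%R)%:E = 0)%E.
  by apply: integral0_eq => x _ /=; rewrite subrr normr0.
have -> : (\int[mu]_(x in Omega) (enorm (gradient phi x - gradient phi x)%R)%:E = 0)%E.
  apply: integral0_eq => x _; rewrite subrr /enorm big1 ?sqrtr0 // => i _.
  by rewrite mxE expr0n.
by rewrite adde0 lte_fin.
Qed.

End sobolev_class.

(** Either [t <= d s], and the sum is at most [(1 + d) s], or [s < t / d], and it is at most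
    [(1 + 1/d) t]. Writing the factors with the exponent [q] makes them common to both terms of the
    energy. *)
Lemma powR_add_close {R : realType} (s t d r q : R) : 0 <= s -> 0 <= t -> 0 < d -> 0 <= r -> r <= q ->
  (s + t) `^ r <= (1 + d) `^ q * s `^ r + (1 + d^-1) `^ q * t `^ r.
Proof.
move=> s0 t0 d0 r0 rq; have di0 : 0 < d^-1 by rewrite invr_gt0.
have D1 : 1 <= 1 + d by rewrite lerDl ltW.
have D2 : 1 <= 1 + d^-1 by rewrite lerDl ltW.
have A1 : (1 + d) `^ r <= (1 + d) `^ q by exact: ler_powR.
have A2 : (1 + d^-1) `^ r <= (1 + d^-1) `^ q by exact: ler_powR.
have [ts|st] := leP t (d * s).
  apply: (@le_trans _ _ ((1 + d) `^ q * s `^ r)); last by rewrite lerDl mulr_ge0 ?powR_ge0.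
  apply: (@le_trans _ _ (((1 + d) * s) `^ r)).
    apply: ge0_ler_powR; rewrite ?nnegrE ?addr_ge0 ?mulr_ge0 // ?(le_trans ler01 D1) //.
    by rewrite mulrDl mul1r lerD2l.
  by rewrite powRM ?(le_trans ler01 D1) // ler_wpM2r ?powR_ge0.
apply: (@le_trans _ _ ((1 + d^-1) `^ q * t `^ r)); last by rewrite lerDr mulr_ge0 ?powR_ge0.
apply: (@le_trans _ _ (((1 + d^-1) * t) `^ r)).
  apply: ge0_ler_powR; rewrite ?nnegrE ?addr_ge0 ?mulr_ge0 // ?(le_trans ler01 D2) //.
  by rewrite mulrDl mul1r addrC lerD2l ler_pdivlMl // ltW.
by rewrite powRM ?(le_trans ler01 D2) // ler_wpM2r ?powR_ge0.
Qed.

Lemma powR_one_add {R : realType} (e q : R) : 0 < e -> 1 <= q -> exists2 d : R, 0 < d & (1 + d) `^ q = 1 + e.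
Proof.
move=> e0 q1; have q0 : 0 < q by exact: lt_le_trans q1.
have e1 : 1 < 1 + e by rewrite ltrDl.
exists ((1 + e) `^ q^-1 - 1).
  rewrite subr_gt0 -[ltLHS](_ : 1 `^ q^-1 = 1); last by rewrite powR1.
  by apply: gt0_ltr_powR; rewrite ?invr_gt0 ?nnegrE // ltW // (lt_trans ltr01).
by rewrite subrKC -powRrM mulVf ?gt_eqF // powRr1 // ltW // (lt_trans ltr01).
Qed.

(** * Density of test functions for the double phase energy *)

Section double_phase_density.
Context {R : realType} {n : nat}.
Local Notation mu := (lebesgue_rV n : {sigma_finite_measure set 'rV[R]_n -> \bar R}).
Implicit Types (u v phi : 'rV[R]_n -> R) (G H : 'rV[R]_n -> 'rV[R]_n) (x : 'rV[R]_n).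

Variables (Omega U : set 'rV[R]_n) (a : 'rV[R]_n -> R) (p q : R).
Hypotheses (oO : open Omega) (oU : open U) (cO : compact (closure Omega)) (OU : closure Omega `<=` U).
Hypotheses (sa : smooth_on U a) (a0 : forall x, U x -> 0 <= a x) (p1 : 1 <= p) (pq : p <= q).
Hypothesis cones : forall x0, closure Omega x0 -> exists (d : R) (v : 'rV[R]_n) (eta tau : R),
  [/\ 0 < d, 0 < eta, 0 < tau & cone_at Omega x0 d v eta tau].

Local Notation energy := (phase_energy Omega a p q).

Let mO : measurable Omega. Proof. exact: open_measurable_rV. Qed.
Let q1 : 1 <= q. Proof. exact: le_trans pq. Qed.

Let OU' x : Omega x -> U x.
Proof. by move=> Ox; apply/OU/subset_closure. Qed.

Lemma phase_energy_ext (g h : 'rV[R]_n -> R) : (forall x, Omega x -> g x = h x) -> energy g = energy h.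
Proof. by move=> gh; apply: eq_integral => x /set_mem Ox; rewrite gh. Qed.

Definition wnorm G := weight Omega (fun x => enorm (G x)).

Lemma wnorm_ge0 G x : 0 <= wnorm G x.
Proof.
have [Ox|nO] := pselect (Omega x); first by rewrite /wnorm weightE // enorm_ge0.
by rewrite /wnorm weight_out.
Qed.

Lemma measurable_wnorm G : (forall i, measurable_fun Omega (fun x => G x ord0 i)) ->
  measurable_fun setT (wnorm G).
Proof. by move=> mG; apply: ((measurable_restrictT _ mO).1); exact: measurable_enorm. Qed.

Lemma double_phaseE u G : is_weak_gradient Omega u G -> double_phase Omega p q a u = energy (wnorm G).
Proof.
move=> hG; rewrite (@phase_energy_ext (wnorm G) (fun x => enorm (G x))); last first.
  by move=> x Ox; rewrite /wnorm weightE.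
apply: (integral_weak_gradient oO (F := fun x y => (enorm y `^ p + a x * enorm y `^ q)%:E) hG).
move=> H mH; have := measurable_phase p q oO OU sa (measurable_wnorm mH).
apply: eq_measurable_fun => x /set_mem Ox.
by rewrite /wnorm weightE.
Qed.

Lemma double_phase_close u v (eta : R) : W11 Omega u -> W110 Omega v ->
  (double_phase Omega p q a u < +oo)%E -> (double_phase Omega p q a (u \+ v)%R < +oo)%E -> 0 < eta ->
  exists2 phi, test_functions Omega phi &
    (double_phase Omega p q a (u \+ phi)%R <= double_phase Omega p q a (u \+ v)%R + eta%:E)%E.
Proof.
move=> Wu Wv Fu Fuv eta0; have lim := W110_test_limit oO Wv.
have [ju _] := Wu; have [[jv _] _] := Wv; have hu := weak_gradientP Wu; have hv := weak_gradientP Wv.1.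
set G := weak_gradient Omega u in hu *; set H := weak_gradient Omega v in hv lim *.
have huv := weak_gradientD oO ju jv hu hv.
have mG i := weak_gradient_measurable i hu.
have mH i := weak_gradient_measurable i hv.
have mGH i := weak_gradient_measurable i huv.
pose K i := weight Omega (fun x => H x ord0 i).
have [[_ iK] _ _] := lim; have mK i : measurable_fun setT (K i) by exact: rintegrable_measurable (iK i).
rewrite (double_phaseE huv) in Fuv *; rewrite (double_phaseE hu) in Fu.
have mwG := measurable_wnorm mG; have mwGH := measurable_wnorm mGH.
(* The gradient of [v] is that of [u + v] minus that of [u], and both of these have finite energy by
   hypothesis. *)
have eK : (energy (norm1 K) < +oo)%E.
  apply: (@phase_energy_lty_le _ _ _ U a p q oO OU sa a0 p1 q1 _ (fun x => n%:R * wnorm (fun x => G x + H x) x) (fun x => n%:R * wnorm G x)).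
  - exact: measurable_norm1.
  - exact: measurable_funM.
  - exact: measurable_funM.
  - by move=> x; exact: norm1_ge0.
  - by move=> x; rewrite mulr_ge0 ?wnorm_ge0.
  - by move=> x; rewrite mulr_ge0 ?wnorm_ge0.
  - move=> x Ox; rewrite -mulrDr mulr_natl -[X in _ *+ X]card_ord -sumr_const; apply: ler_sum => i _.
    rewrite /K /wnorm !weightE //; have h1 := coord_le_enorm (G x + H x) i; have h2 := coord_le_enorm (G x) i.
    rewrite (_ : H x ord0 i = (G x + H x) ord0 i - G x ord0 i); last by rewrite mxE addrAC subrr add0r.
    by apply: le_trans (ler_normB _ _) _; exact: lerD.
  - by apply: (phase_energy_scale oO OU sa a0 _ mwGH _ Fuv) => // x; exact: wnorm_ge0.
  - by apply: (phase_energy_scale oO OU sa a0 _ mwG _ Fu) => // x; exact: wnorm_ge0.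
have E0 g : (0 <= energy g)%E by apply: (phase_energy_ge0 (U := U)).
have f0 : 0 <= fine (energy (wnorm (fun x => G x + H x)%R)) by exact: fine_ge0.
have ffin : energy (wnorm (fun x => G x + H x)%R) \is a fin_num.
  by rewrite (ge0_fin_numE (E0 _)); exact: Fuv.
set f := fine (energy (wnorm (fun x => G x + H x)%R)) in f0.
have fE : energy (wnorm (fun x => G x + H x)%R) = f%:E by rewrite fineK.
(* The relative error allowed on the energy [f] of [u + v], so that it costs at most [eta / 2];
   adding 1 allows [f = 0]. *)
have e0 : 0 < eta / 2 / (f + 1) by rewrite !divr_gt0 // ltr_wpDl.
have [d d0 dE] := powR_one_add e0 q1.
pose C := (1 + d^-1) `^ q.
have C0 : 0 <= C by exact: powR_ge0.
(* [C] grows as [d] tends to 0, so the accuracy of the approximation of [v] is chosen after [d]. *)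
have eta'0 : 0 < eta / 2 / (C + 1) by rewrite !divr_gt0 // ltr_wpDl.
have [phi tphi ephi] := energy_approximable oO oU cO OU sa a0 p1 q1 cones lim eK eta'0.
exists phi => //; have hphi := test_weak_gradient oO tphi.
have hup := weak_gradientD oO ju (test_L1 oO tphi) hu hphi.
rewrite (double_phaseE hup) fE.
pose D := norm1 (fun i x => K i x - partial i phi x).
have mD : measurable_fun setT D.
  apply: measurable_norm1 => i; apply: measurable_funB => //.
  exact: (smooth_partial_measurable i (test_smooth tphi)).
have mup := measurable_wnorm (fun i => weak_gradient_measurable i hup).
have D0 x : 0 <= D x by exact: norm1_ge0.
have tri x : Omega x -> wnorm (fun x => G x + gradient phi x) x <= wnorm (fun x => G x + H x) x + D x.
  move=> Ox; rewrite /wnorm !weightE //.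
  rewrite (_ : G x + gradient phi x = (G x + H x) + (gradient phi x - H x)); last by rewrite addrACA subrr addr0.
  apply: le_trans (enormD_le _ _) _; rewrite lerD2l /D /norm1; apply: ler_sum => i _.
  by rewrite /K weightE // !mxE distrC.
have main : (energy (wnorm (fun x => G x + gradient phi x)%R) <=
    (1 + eta / 2 / (f + 1))%:E * f%:E + C%:E * energy D)%E.
  have e10 : 0 <= 1 + eta / 2 / (f + 1) by rewrite addr_ge0 // ltW.
  rewrite -fE; apply: (phase_energy_comb oO OU sa a0 e10 C0 mup mwGH mD) => x Ox; rewrite -dE -/C.
  have ax := a0 (OU' Ox).
  have close (r : R) : 1 <= r -> r <= q -> wnorm (fun x => G x + gradient phi x) x `^ r <=
      (1 + d) `^ q * wnorm (fun x => G x + H x) x `^ r + C * D x `^ r.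
    move=> r1 rq; have r0 : 0 <= r by exact: le_trans r1.
    apply: le_trans (powR_add_close (wnorm_ge0 _ x) (D0 x) d0 r0 rq).
    by apply: ge0_ler_powR; rewrite ?nnegrE ?addr_ge0 ?wnorm_ge0 ?tri.
  apply: le_trans (lerD (close p p1 pq) (ler_wpM2l ax (close q q1 (lexx q)))) _.
  apply: le_of_eq; ring.
apply: le_trans main _.
apply: (@le_trans _ _ ((1 + eta / 2 / (f + 1))%:E * f%:E + C%:E * (eta / 2 / (C + 1))%:E)%E).
  by rewrite leeD2l // lee_wpmul2l ?lee_fin // ltW.
rewrite -!EFinM -!EFinD lee_fin mulrDl mul1r -addrA lerD2l.
have h1 : eta / 2 / (f + 1) * f <= eta / 2.
  by rewrite mulrAC ler_pdivrMr ?ltr_wpDl // ler_wpM2l ?divr_ge0 ?(ltW eta0) // lerDl.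
have h2 : C * (eta / 2 / (C + 1)) <= eta / 2.
  by rewrite mulrA ler_pdivrMr ?ltr_wpDl // mulrC ler_wpM2l ?divr_ge0 ?(ltW eta0) // lerDl.
lra.
Qed.

End double_phase_density.

Theorem corollary1p1 (R : realType) (n : nat) (Omega U : set 'rV[R]_n.+1)
    (HOmega : bounded_lipschitz_domain Omega) (HU : open U)
    (HOmegaU : compactly_contained Omega U)
    (p q : R) (Hp : 1 <= p) (Hpq : p <= q)
    (a : 'rV[R]_n.+1 -> R) (Ha : smooth_on U a)
    (Ha0 : forall x, U x -> 0 <= a x)
    (u0 : 'rV[R]_n.+1 -> R) (Hu0 : W11 Omega u0)
    (HFu0 : (double_phase Omega p q a u0 < +oo)%E) :
  ereal_inf [set double_phase Omega p q a (u0 \+ v) | v in W110 Omega] =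
  ereal_inf [set double_phase Omega p q a (u0 \+ phi) |
               phi in test_functions Omega].
Proof.
have [oO _ _ _ _] := HOmega; have [cO OU] := HOmegaU.
apply/eqP; rewrite eq_le; apply/andP; split.
  apply: ereal_inf_le_tmp => _ [phi tphi <-]; exists phi => //.
  exact: test_W110.
apply: le_ereal_inf_tmp => _ [v Wv <-].
have [Fv|] := ltP (double_phase Omega p q a (u0 \+ v)) +oo%E; last by rewrite leye_eq => /eqP ->; exact: leey.
apply/lee_addgt0Pr => eta eta0.
have cones := fun x0 => lipschitz_cone (x0 := x0) HOmega.
have [phi tphi Fphi] := double_phase_close oO HU cO OU Ha Ha0 Hp Hpq cones Hu0 Wv HFu0 Fv eta0.
by apply: le_trans Fphi; apply: ereal_inf_lbound; exists phi.
Qed.
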